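(* There is a universal constant $c$ such that the following holds for every $n\ge 2$. For $\alpha\in\mathbb{R}$ let $\mu_\alpha$ denote the Gaussian measure on $\mathbb{R}$ with mean $\alpha$ and variance $1$. Let $A\subset\mathbb{R}^n$ be a monotone increasing transitive set with $A\ne\emptyset$ and $A\neq\mathbb{R}^n$. For $0<\delta<1$ denote by $\alpha_A(\delta)$ the unique value of $\alpha$ such that $\mu_\alpha^{\otimes n}(A)=\delta$. Then for any $0<\epsilon<1/2$, $$\alpha_A(1-\epsilon)-\alpha_A(\epsilon)\le c\,\frac{\log\bigl(1/(2\epsilon)\bigr)}{\sqrt{\log n}}.$$
   Context: A set $A\subseteq\mathbb{R}^n$ is monotone increasing if $x\in A$ and $y_j\ge x_j$ for all $j$ imply $y\in A$. A set $A\subseteq\mathbb{R}^n$ is transitive if its characteristic function is invariant under the action (by permuting the $n$ coordinates) of some subgroup of the symmetric group $S_n$ that acts transitively on $\{1,\dots,n\}$. *)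

(* Defs.v *)
From HB Require Import structures.
From mathcomp Require Import all_boot all_order all_fingroup all_algebra.
From mathcomp Require Import all_classical all_reals all_analysis.
Set Implicit Arguments.
Unset Strict Implicit.
Unset Printing Implicit Defensive.
Import Order.TTheory GRing.Theory Num.Theory.
Import numFieldNormedType.Exports.
Local Open Scope classical_set_scope.
Local Open Scope ring_scope.

Definition tuple_cons d (T : measurableType d) (n : nat)
  (p : T * n.-tuple T) : n.+1.-tuple T := [tuple of p.1 :: p.2].

Lemma measurable_tuple_cons d (T : measurableType d) (n : nat) :
  measurable_fun [set: T * n.-tuple T] (@tuple_cons d T n).
Proof. exact: measurable_cons. Qed.

HB.instance Definition _ d (T : measurableType d) (n : nat) :=
  isMeasurableFun.Build _ _ _ _ (@tuple_cons d T n)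
    (@measurable_tuple_cons d T n).

(* The n-fold product probability P \x ... \x P on n.-tuple T, with the
   product sigma-algebra: P \x P^n is transported along (x, t) |-> x :: t. *)
Fixpoint power_prob d (T : measurableType d) (R : realType)
    (P : probability T R) (n : nat) : probability (n.-tuple T) R :=
  match n with
  | 0 => \d_([tuple] : 0.-tuple T)
  | m.+1 => distribution (P \x power_prob P m)%E (@tuple_cons d T m)
  end.

Lemma power_prob_box d (T : measurableType d) (R : realType)
    (P : probability T R) (n : nat) (B : 'I_n -> set T) :
  (forall i, measurable (B i)) ->
  power_prob P n [set x | forall i, B i (tnth x i)] = (\prod_(i < n) P (B i))%E.
Proof.
elim: n B => [|n IHn] B mB /=.
  rewrite big_ord0 diracE mem_set//=.
  by move=> [].
rewrite /distribution /pushforward.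
have -> : @tuple_cons d T n @^-1` [set x | forall i, B i (tnth x i)] =
    B ord0 `*` [set x | forall i, B (lift ord0 i) (tnth x i)].
  apply/seteqP; split=> -[x t] /=.
    move=> h; split; first exact: (h ord0).
    by move=> i; have := h (lift ord0 i); rewrite tnthS.
  move=> [Bx Bt] i; have [j ->|->] := unliftP ord0 i; last by [].
  by rewrite tnthS; exact: Bt.
have mBox : measurable [set x : n.-tuple T |
    forall i, B (lift ord0 i) (tnth x i)].
  rewrite (_ : [set x | _] =
      \big[setI/setT]_(i < n) ((@tnth _ T ^~ i) @^-1` B (lift ord0 i))).
    apply: bigsetI_measurable => i _; rewrite -[X in measurable X]setTI.
    exact: measurable_tnth.
  by rewrite -bigcap_seq; apply/seteqP; split=> x /= h i => [_|];
    [exact: h | apply: h; rewrite /= mem_index_enum].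
rewrite product_measure1E// [RHS]big_ord_recl; congr (_ * _)%E.
by apply: (IHn (fun i => B (lift ord0 i))) => i; exact: mB.
Qed.

(* mu_alpha^{(x) n} on R^n.  A monotone set need not be Borel, but its boundary
   is Lebesgue-null, so it is measurable for the completion of the product
   measure; the completion is taken as the outer measure induced by the product
   measure, which agrees with it on all completion-measurable sets. *)
Definition gaussian_power (R : realType) (n : nat) (alpha : R) :
    set (n.-tuple R) -> \bar R :=
  mu_ext (power_prob (normal_prob alpha 1) n).

Definition monotone_increasing (R : realType) (n : nat)
    (A : set (n.-tuple R)) : Prop :=
  forall x y : n.-tuple R,
    A x -> (forall j, tnth x j <= tnth y j) -> A y.

Definition permute_coords (T : Type) (n : nat) (s : 'S_n) (x : n.-tuple T) :
  n.-tuple T := [tuple tnth x (s i) | i < n].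

Definition transitive_set (R : realType) (n : nat)
    (A : set (n.-tuple R)) : Prop :=
  exists2 G : {group 'S_n},
    [transitive G, on [set: 'I_n]%SET | 'P] &
    forall s, s \in G ->
      forall x, \1_A (permute_coords s x) = \1_A x :> R.

(* Junk value 0 when no alpha has the required property. *)
Definition threshold (R : realType) (n : nat) (A : set (n.-tuple R))
    (delta : R) : R :=
  xget 0 [set alpha : R | gaussian_power alpha A = delta%:E].

(* Main.v *)
(* The derivative of mu_a^n(A) in [a] is W = sum_i E_a[1_A (x_i - a)]; it suffices
   that W >= K p (1 - p) with p = mu_a^n(A) and K of order sqrt(log n), since then
   the logit of p grows at rate K.  Shifting A, take a = 0.  Exponential tilting and
   e^u >= 1 + u give p(a + h) >= p(a) + h W(a) - n h^2 / 2, so no derivative is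
   needed.

   For the lower bound on W, encode each coordinate by the first d ~ log n binary
   digits of Phi(x_i), Phi the Gaussian distribution function, and let g be the
   conditional probability of A given the digits, a function on {0,1}^(nd) that is
   monotone in each bit.  The variance within the cells is at most a constant times
   W / sqrt d.  Hypercontractivity, as in Kahn-Kalai-Linial, bounds Var g by
   (1/d) sum ||D_l g||_2^2 + 4^d sum ||D_l g||_1 ||D_l g||_2, and the level-1
   inequality applied to half-lines shows that the bits of coordinate i satisfy
   sum_l ||D_l g||_1 <= C sqrt d E[1_A x_i].  By transitivity the n summands of W
   are equal, so each influence is at most C sqrt d W / n; if W is small compared
   with sqrt d, the 4^d term is negligible.

   A need not be Borel; it is replaced by a countable union of open orthants from
   which it differs by arbitrarily small shifts. *)

From HB Require Import structures.
Require Import Defs.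
From mathcomp Require Import all_boot all_order all_fingroup all_algebra.
From mathcomp Require Import ring lra.
From mathcomp Require Import all_classical all_reals all_analysis measurable_realfun.
Import Order.TTheory GRing.Theory Num.Theory.
Import numFieldNormedType.Exports.
Local Open Scope classical_set_scope.
Local Open Scope ring_scope.

(** * Hypercontractivity on the discrete cube *)

(** The rate sqrt(log n) has two sources that happen to agree. The d digits of one coordinate add up
    to a sum of fair signs, of size about sqrt d, so their total influence is of order sqrt d
    E[1_A x_i] and not d E[1_A x_i]; the gain 1/d on the cube thus becomes 1/sqrt d. The loss in
    passing to digits has the same order: on a line an up-set is a half-line and cuts at most one
    dyadic cell. If its end point is farther than sqrt d / 4 from 0, then E[1_B x] is at least of
    order sqrt d times the mass of the tail; otherwise the mass 2^-d of the cut cell is negligible.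

    Both one-dimensional bounds compare integrals over half-lines, so they pass to n dimensions by
    slicing a monotone set along one coordinate. The integrand x_i changes sign, and the slicing is
    therefore done with its positive and negative parts, to which Tonelli applies directly. *)

Section Cube.
Context {R : rcfType}.
Implicit Types (f g : seq bool -> R) (N k l d : nat).

(** Functions live on all bit lists, and only the lists of size [N] count: fixing the first bit then
    gives a function of the same type, and every estimate can go by induction on [N]. *)
Fixpoint cube_mean N f : R :=
  if N is M.+1 then
    (cube_mean M (fun s => f (true :: s)) + cube_mean M (fun s => f (false :: s))) / 2
  else f [::].

(** With the first bit read as a sign x, f = [head_avg] + x [head_diff]. The two parts carry the
    Fourier coefficients of the sets without and with the first bit. *)
Definition head_avg f s : R := (f (true :: s) + f (false :: s)) / 2.
Definition head_diff f s : R := (f (true :: s) - f (false :: s)) / 2.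

Lemma cube_meanD N f g :
  cube_mean N (fun s => f s + g s) = cube_mean N f + cube_mean N g.
Proof. by elim: N f g => [//|N IH] f g /=; rewrite !IH; field. Qed.

Lemma cube_meanZ N (a : R) f : cube_mean N (fun s => a * f s) = a * cube_mean N f.
Proof. by elim: N f => [//|N IH] f /=; rewrite !IH; field. Qed.

Lemma cube_meanB N f g :
  cube_mean N (fun s => f s - g s) = cube_mean N f - cube_mean N g.
Proof. by elim: N f g => [//|N IH] f g /=; rewrite !IH; field. Qed.

Lemma cube_mean_cst N (a : R) : cube_mean N (fun=> a) = a.
Proof. by elim: N => [//|N IH] /=; rewrite IH; field. Qed.

Lemma ler_cube_mean N f g :
  (forall s, size s = N -> f s <= g s) -> cube_mean N f <= cube_mean N g.
Proof.
elim: N f g => [|N IH] f g fg /=; first exact: fg.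
rewrite ler_pM2r ?invr_gt0 ?ltr0n// lerD// IH// => s sN;
  by apply: fg; rewrite /= sN.
Qed.

Lemma eq_cube_mean N f g :
  (forall s, size s = N -> f s = g s) -> cube_mean N f = cube_mean N g.
Proof. by move=> fg; apply/eqP; rewrite eq_le !ler_cube_mean// => s /fg ->. Qed.

Lemma cube_mean_ge0 N f : (forall s, size s = N -> 0 <= f s) -> 0 <= cube_mean N f.
Proof. by move=> f0; rewrite -(cube_mean_cst N 0) ler_cube_mean. Qed.

Lemma cube_mean_sum N n (F : 'I_n -> seq bool -> R) :
  cube_mean N (fun s => \sum_(i < n) F i s) = \sum_(i < n) cube_mean N (F i).
Proof.
elim: n F => [|n IH] F.
  by rewrite big_ord0 -[RHS](cube_mean_cst N); apply: eq_cube_mean => s _; rewrite big_ord0.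
rewrite big_ord_recl -IH -cube_meanD; apply: eq_cube_mean => s _.
by rewrite big_ord_recl.
Qed.

Lemma cube_mean_head N f : cube_mean N.+1 f = cube_mean N (head_avg f).
Proof.
rewrite /= -cube_meanD mulrC -cube_meanZ.
by apply: eq_cube_mean => s _; rewrite /head_avg mulrC.
Qed.

Lemma cube_mean_headM N f g :
  cube_mean N.+1 (fun s => f s * g s) =
  cube_mean N (fun s => head_avg f s * head_avg g s) +
  cube_mean N (fun s => head_diff f s * head_diff g s).
Proof.
rewrite cube_mean_head -cube_meanD; apply: eq_cube_mean => s _.
by rewrite /head_avg /head_diff; field.
Qed.

Lemma cube_mean_CS N f g :
  cube_mean N (fun s => f s * g s) ^+ 2 <=
  cube_mean N (fun s => f s ^+ 2) * cube_mean N (fun s => g s ^+ 2).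
Proof.
set B := cube_mean N _; set A := cube_mean N _; set C := cube_mean N _.
have quad (x y : R) : 0 <= x ^+ 2 * A - 2 * x * y * B + y ^+ 2 * C.
  have : 0 <= cube_mean N (fun s => (x * f s - y * g s) ^+ 2).
    by apply: cube_mean_ge0 => s _; exact: sqr_ge0.
  suff -> : cube_mean N (fun s => (x * f s - y * g s) ^+ 2) =
      x ^+ 2 * A - 2 * x * y * B + y ^+ 2 * C by [].
  rewrite /A /B /C -!cube_meanZ -cube_meanB -cube_meanD.
  by apply: eq_cube_mean => s _; ring.
have A0 : 0 <= A by apply: cube_mean_ge0 => s _; exact: sqr_ge0.
have [A_gt0|] := ltrP 0 A.
  have := quad B A; rewrite -subr_ge0 => h.
  rewrite -subr_ge0 -(pmulr_rge0 _ A_gt0).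
  by apply: le_trans h _; rewrite le_eqVlt; apply/orP; left; apply/eqP; ring.
move=> A1; have A00 : A = 0 by apply: le_anti; rewrite A0 A1.
have [->|Bn0] := eqVneq B 0; first by rewrite expr0n A00 mul0r.
(* With A = 0 the quadratic form is affine in x; this x gives it the value -1. *)
have := quad ((C + 1) / (2 * B)) 1.
have -> : ((C + 1) / (2 * B)) ^+ 2 * A - 2 * ((C + 1) / (2 * B)) * 1 * B + 1 ^+ 2 * C = -1.
  by rewrite A00; field.
by rewrite oppr_ge0 ler10.
Qed.

(** In Fourier terms this multiplies the coefficient of a set S by 2^-|S|: each bit in S contributes
    the factor 1/2 in front of [head_diff]. *)
Fixpoint noise N f (s : seq bool) : R :=
  match N, s with
  | M.+1, x :: s' =>
      noise M (head_avg f) s' + (if x then 2^-1 else - 2^-1) * noise M (head_diff f) s'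
  | _, _ => f s
  end.

Lemma head_avg_noise N f : head_avg (noise N.+1 f) = noise N (head_avg f).
Proof. by apply/funext => s; rewrite {1}/head_avg /=; field. Qed.

Lemma head_diff_noise N f :
  head_diff (noise N.+1 f) = fun s => 2^-1 * noise N (head_diff f) s.
Proof. by apply/funext => s; rewrite {1}/head_diff /=; field. Qed.

Lemma head_avgZ (a : R) f : head_avg (fun s => a * f s) = fun s => a * head_avg f s.
Proof. by apply/funext => s; rewrite /head_avg; field. Qed.

Lemma head_diffZ (a : R) f : head_diff (fun s => a * f s) = fun s => a * head_diff f s.
Proof. by apply/funext => s; rewrite /head_diff; field. Qed.

Lemma noiseZ N (a : R) f : noise N (fun s => a * f s) = fun s => a * noise N f s.
Proof.
elim: N f => [|N IH] f; first by apply/funext => -[].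
apply/funext => -[//|x s] /=.
by rewrite head_avgZ head_diffZ !IH; ring.
Qed.

(* Hypercontractivity from L^2 to L^4; any noise rate up to 1/sqrt 3 works. *)
Lemma noise_hypercontractive N f :
  cube_mean N (fun s => noise N f s ^+ 4) <= cube_mean N (fun s => f s ^+ 2) ^+ 2.
Proof.
elim: N f => [|N IH] f; first by rewrite /= -exprM.
rewrite cube_mean_head.
set u := noise N (head_avg f); set v := noise N (head_diff f).
(* Averaging (u + v/2)^4 and (u - v/2)^4 kills the odd terms. The mixed term is handled by
   Cauchy-Schwarz, and its coefficient 3/2 fits under the 2 of (a + b)^2. *)
have -> : head_avg (fun s => noise N.+1 f s ^+ 4) =
    fun s => u s ^+ 4 + (3 / 2 * (u s ^+ 2 * v s ^+ 2) + 16^-1 * v s ^+ 4).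
  by apply/funext => s; rewrite {1}/head_avg /= -/u -/v; field.
rewrite !cube_meanD !cube_meanZ.
have -> : cube_mean N.+1 (fun s => f s ^+ 2) =
    cube_mean N (fun s => head_avg f s ^+ 2) + cube_mean N (fun s => head_diff f s ^+ 2).
  by rewrite (_ : (fun s => _) = fun s => f s * f s) ?cube_mean_headM.
set a := cube_mean N (fun s => head_avg f s ^+ 2).
set b := cube_mean N (fun s => head_diff f s ^+ 2).
have hu : cube_mean N (fun s => u s ^+ 4) <= a ^+ 2 := IH _.
have hv : cube_mean N (fun s => v s ^+ 4) <= b ^+ 2 := IH _.
have a0 : 0 <= a by apply: cube_mean_ge0 => s _; exact: sqr_ge0.
have b0 : 0 <= b by apply: cube_mean_ge0 => s _; exact: sqr_ge0.
have v4 : 0 <= cube_mean N (fun s => v s ^+ 4).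
  by apply: cube_mean_ge0 => s _; rewrite exprn_even_ge0.
have huv : cube_mean N (fun s => u s ^+ 2 * v s ^+ 2) <= a * b.
  rewrite -ler_sqr ?nnegrE ?mulr_ge0//; last first.
    by apply: cube_mean_ge0 => s _; rewrite mulr_ge0 ?sqr_ge0.
  apply: le_trans (cube_mean_CS _ _ _) _.
  rewrite exprMn; under eq_cube_mean do rewrite -exprM.
  under [X in _ * X <= _]eq_cube_mean do rewrite -exprM.
  apply: ler_pM => //.
  by apply: cube_mean_ge0 => s _; rewrite exprn_even_ge0.
nra.
Qed.

(** The noise operator is a Fourier multiplier, hence symmetric for the mean; both sides are the sum
    of 4^-|S| times the squared coefficients. *)
Lemma noise_selfadjoint N f :
  cube_mean N (fun s => f s * noise N (noise N f) s) =
  cube_mean N (fun s => noise N f s ^+ 2).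
Proof.
elim: N f => [|N IH] f; first by rewrite /= expr2.
rewrite (_ : (fun s => _ ^+ 2) = fun s => noise N.+1 f s * noise N.+1 f s) //.
rewrite !cube_mean_headM !head_avg_noise !head_diff_noise noiseZ.
congr (_ + _); first by rewrite IH.
have := IH (head_diff f).
move=> /(congr1 (fun x => 2^-1 * (2^-1 * x))); rewrite -!cube_meanZ => h.
rewrite (_ : cube_mean N _ = cube_mean N
    (fun s => 2^-1 * (2^-1 * (head_diff f s * noise N (noise N (head_diff f)) s)))).
  by rewrite h; apply: eq_cube_mean => s _; ring.
by apply: eq_cube_mean => s _; ring.
Qed.

(* The dual bound L^{4/3} -> L^2, with the 4/3-norm replaced by its
   interpolation between L^1 and L^2. *)
Lemma noise_L1_L2 N f :
  cube_mean N (fun s => noise N f s ^+ 2) <=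
  cube_mean N (fun s => `|f s|) * Num.sqrt (cube_mean N (fun s => f s ^+ 2)).
Proof.
set X := cube_mean N (fun s => noise N f s ^+ 2).
set L1 := cube_mean N (fun s => `|f s|); set L2 := cube_mean N (fun s => f s ^+ 2).
have X0 : 0 <= X by apply: cube_mean_ge0 => s _; exact: sqr_ge0.
have L10 : 0 <= L1 by apply: cube_mean_ge0.
have L20 : 0 <= L2 by apply: cube_mean_ge0 => s _; exact: sqr_ge0.
set v := noise N (noise N f).
have v4 : cube_mean N (fun s => v s ^+ 4) <= X ^+ 2 := noise_hypercontractive _ _.
(* Duality by hand: X is the mean of f v by self-adjointness, so Cauchy-Schwarz with weight |f|
   gives X^2 <= L1 Y, while the fourth-moment bound on v gives Y <= sqrt(L2) X. Dividing by X
   finishes. *)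
set Y := cube_mean N (fun s => `|f s| * v s ^+ 2).
have Y0 : 0 <= Y by apply: cube_mean_ge0 => s _; rewrite mulr_ge0 ?sqr_ge0.
have Y2 : Y <= Num.sqrt L2 * X.
  rewrite -ler_sqr ?nnegrE ?mulr_ge0 ?sqrtr_ge0// exprMn sqr_sqrtr//.
  apply: le_trans (cube_mean_CS _ _ _) _.
  rewrite (_ : cube_mean N (fun s => `|f s| ^+ 2) = L2); last first.
    by apply: eq_cube_mean => s _; rewrite real_normK// num_real.
  apply: ler_wpM2l => //; apply: le_trans v4.
  by apply: ler_cube_mean => s _; rewrite -exprM.
have X2 : X ^+ 2 <= L1 * Y.
  have XE : X <= cube_mean N (fun s => Num.sqrt `|f s| * (Num.sqrt `|f s| * `|v s|)).
    rewrite /X -noise_selfadjoint -/v; apply: ler_cube_mean => s _.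
    by rewrite mulrA -expr2 sqr_sqrtr// -normrM ler_norm.
  apply: (@le_trans _ _ (cube_mean N (fun s => Num.sqrt `|f s| * (Num.sqrt `|f s| * `|v s|)) ^+ 2)).
    by rewrite ler_sqr ?nnegrE// (le_trans X0).
  apply: le_trans (cube_mean_CS _ _ _) _.
  rewrite (_ : cube_mean N (fun s => Num.sqrt `|f s| ^+ 2) = L1); last first.
    by apply: eq_cube_mean => s _; rewrite sqr_sqrtr.
  apply: ler_wpM2l => //; apply: ler_cube_mean => s _.
  by rewrite exprMn sqr_sqrtr// real_normK ?num_real.
have [->|Xn0] := eqVneq X 0; first by rewrite mulr_ge0 ?sqrtr_ge0.
have X_gt0 : 0 < X by rewrite lt_def Xn0.
rewrite -(ler_pM2r X_gt0) -mulrA -expr2; apply: le_trans X2 _.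
exact: ler_wpM2l.
Qed.

(* [level_weight N f k] is the sum of the squared Fourier coefficients of [f]
   on the sets of size [k]. *)
Fixpoint level_weight N f k : R :=
  if N is M.+1 then
    level_weight M (head_avg f) k +
    (if k is k'.+1 then level_weight M (head_diff f) k' else 0)
  else if k is 0 then f [::] ^+ 2 else 0.

Lemma level_weight_ge0 N f k : 0 <= level_weight N f k.
Proof.
elim: N f k => [|N IH] f [|k] /=; rewrite ?sqr_ge0//.
  by rewrite addr0.
by rewrite addr_ge0.
Qed.

Lemma level_weight_gt N f k : (N < k)%N -> level_weight N f k = 0.
Proof.
elim: N f k => [|N IH] f [|k]//= Nk.
by rewrite IH ?IH ?addr0//; exact: ltnW.
Qed.

Lemma level_weight0 N f : level_weight N f 0 = cube_mean N f ^+ 2.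
Proof. by elim: N f => [//|N IH] f; rewrite cube_mean_head -IH /= addr0. Qed.

(** A set that contains the first bit loses one element in [head_diff], hence the shifted weight
    [c k.+1] there. *)
Lemma sum_level_weightS N f (c : nat -> R) :
  \sum_(k < N.+2) c k * level_weight N.+1 f k =
  \sum_(k < N.+1) c k * level_weight N (head_avg f) k +
  \sum_(k < N.+1) c k.+1 * level_weight N (head_diff f) k.
Proof.
rewrite /=; under eq_bigr do rewrite mulrDr.
rewrite big_split /= [X in X + _]big_ord_recr /= level_weight_gt// mulr0 addr0.
by congr (_ + _); rewrite big_ord_recl /= mulr0 add0r.
Qed.

(** Parseval's identity after the multiplier 2^-k has acted on level k. *)
Lemma cube_mean_noise_sqr N f :
  cube_mean N (fun s => noise N f s ^+ 2) =
  \sum_(k < N.+1) (4^-1) ^+ k * level_weight N f k.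
Proof.
elim: N f => [|N IH] f; first by rewrite big_ord_recl big_ord0 /= addr0 expr0 mul1r.
rewrite sum_level_weightS.
rewrite (_ : (fun s => _ ^+ 2) = fun s => noise N.+1 f s * noise N.+1 f s) //.
rewrite cube_mean_headM head_avg_noise head_diff_noise; congr (_ + _); first exact: IH.
under [RHS]eq_bigr do rewrite exprS -mulrA.
rewrite -mulr_sumr -IH -cube_meanZ; apply: eq_cube_mean => s _.
by field.
Qed.

Lemma cube_mean_sqr N f :
  cube_mean N (fun s => f s ^+ 2) = \sum_(k < N.+1) level_weight N f k.
Proof.
elim: N f => [|N IH] f; first by rewrite big_ord_recl big_ord0 /= addr0.
have /= := sum_level_weightS N f (fun=> 1).
under eq_bigr do rewrite mul1r.
under [X in _ = X + _ -> _]eq_bigr do rewrite mul1r.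
under [X in _ = _ + X -> _]eq_bigr do rewrite mul1r.
by rewrite -!IH => /= ->; exact: (cube_mean_headM N f f).
Qed.

(** Half the discrete derivative in bit [l]. The bit [l] of the argument is skipped and not removed,
    so the derivative is again a function on the cube of the same dimension; it is 0 on lists too
    short to have that bit. *)
Fixpoint bit_diff l f (s : seq bool) : R :=
  match l, s with
  | _, [::] => 0
  | 0, _ :: s' => head_diff f s'
  | l'.+1, x :: s' => bit_diff l' (fun t => f (x :: t)) s'
  end.

Lemma head_avg_bit_diff0 f : head_avg (bit_diff 0 f) = head_diff f.
Proof. by apply/funext => s; rewrite /head_avg /=; field. Qed.

Lemma head_diff_bit_diff0 f : head_diff (bit_diff 0 f) = fun=> 0.
Proof. by apply/funext => s; rewrite /head_diff /= subrr mul0r. Qed.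

(** The coefficients (1/2, 1/2) and (1/2, -1/2) make [bit_diff] commute with [head_avg] and
    [head_diff]. *)
Lemma bit_diffDZ l f g (a b : R) s :
  bit_diff l (fun t => a * f t + b * g t) s = a * bit_diff l f s + b * bit_diff l g s.
Proof.
elim: l f g s => [|l IH] f g [|x s] /=; rewrite ?mulr0 ?addr0 ?IH//.
  by rewrite /head_diff; field.
Qed.

Lemma head_avg_bit_diffS l f : head_avg (bit_diff l.+1 f) = bit_diff l (head_avg f).
Proof.
apply/funext => s.
have := bit_diffDZ l (fun t => f (true :: t)) (fun t => f (false :: t)) 2^-1 2^-1 s.
rewrite (_ : (fun t => _) = head_avg f) => [->|].
  by rewrite /head_avg /=; field.
by apply/funext => t; rewrite /head_avg; field.
Qed.

Lemma head_diff_bit_diffS l f : head_diff (bit_diff l.+1 f) = bit_diff l (head_diff f).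
Proof.
apply/funext => s.
have := bit_diffDZ l (fun t => f (true :: t)) (fun t => f (false :: t)) 2^-1 (- 2^-1) s.
rewrite (_ : (fun t => _) = head_diff f) => [->|].
  by rewrite /head_diff /=; field.
by apply/funext => t; rewrite /head_diff; field.
Qed.

Lemma level_weight_cst0 N k : level_weight N (fun=> 0) k = 0.
Proof.
have h : head_avg (fun=> 0) = fun=> 0.
  by apply/funext => s; rewrite /head_avg addr0 mul0r.
have h' : head_diff (fun=> 0) = fun=> 0.
  by apply/funext => s; rewrite /head_diff subrr mul0r.
elim: N k => [|N IH] [|k] //=; rewrite ?expr0n// h ?h' !IH ?addr0//.
Qed.

(** The derivative in bit l keeps the coefficients of the sets containing l and removes l from them.
    Summed over l, a set of size k + 1 is counted once for each of its elements. *)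
Lemma sum_level_weight_bit_diff N f k :
  \sum_(l < N) level_weight N (bit_diff l f) k = k.+1%:R * level_weight N f k.+1.
Proof.
elim: N f k => [|N IH] f k; first by rewrite big_ord0 /= mulr0.
rewrite big_ord_recl [level_weight]lock /= -lock.
have -> : level_weight N.+1 (bit_diff 0 f) k = level_weight N (head_diff f) k.
  rewrite /= head_avg_bit_diff0 head_diff_bit_diff0.
  by case: k => [|k]; rewrite ?level_weight_cst0 addr0.
have -> : \sum_(i < N) level_weight N.+1 (bit_diff (bump 0 i) f) k =
  \sum_(l < N) (level_weight N (bit_diff l (head_avg f)) k +
    (if k is k'.+1 then level_weight N (bit_diff l (head_diff f)) k' else 0)).
  by apply: eq_bigr => l _; rewrite -head_avg_bit_diffS -head_diff_bit_diffS.
rewrite big_split /= IH.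
case: k => [|k]; first by rewrite big1_eq; ring.
by rewrite IH -[k.+2%:R]natr1; ring.
Qed.

(** The variance is split by level. A level k + 1 >= d occurs k + 1 times in the total influence, so
    the factor 1/d still covers it; a level below d survives in the noised derivatives with weight
    at least 4^-d. *)
Theorem cube_variance_bound N f d : (0 < d)%N ->
  cube_mean N (fun s => f s ^+ 2) - cube_mean N f ^+ 2 <=
  d%:R^-1 * (\sum_(l < N) cube_mean N (fun s => bit_diff l f s ^+ 2)) +
  4 ^+ d * \sum_(l < N) cube_mean N (fun s => `|bit_diff l f s|) *
     Num.sqrt (cube_mean N (fun s => bit_diff l f s ^+ 2)).
Proof.
move=> d0.
have d_gt0 : (0 : R) < d%:R by rewrite ltr0n.
apply: (@le_trans _ _ (d%:R^-1 * (\sum_(l < N) cube_mean N (fun s => bit_diff l f s ^+ 2)) +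
  4 ^+ d * \sum_(l < N) cube_mean N (fun s => noise N (bit_diff l f) s ^+ 2))); last first.
  rewrite lerD2l ler_wpM2l ?exprn_ge0// ler_sum// => l _; exact: noise_L1_L2.
under eq_bigr do rewrite cube_mean_sqr.
under [X in _ <= _ + _ * X]eq_bigr do rewrite cube_mean_noise_sqr.
rewrite exchange_big /= [X in _ <= _ + _ * X]exchange_big /=.
under eq_bigr do rewrite sum_level_weight_bit_diff.
under [X in _ <= _ + _ * X]eq_bigr do rewrite -mulr_sumr sum_level_weight_bit_diff.
rewrite cube_mean_sqr -level_weight0 big_ord_recl /= addrC addKr.
rewrite !mulr_sumr -big_split /= [leRHS]big_ord_recr /= -[leLHS]addr0.
(* The right-hand sums have one index more than the left one; it belongs to level N + 1, which is
   empty. *)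
apply: lerD; last first.
  by rewrite level_weight_gt// !mulr0 addr0.
apply: ler_sum => k _.
rewrite /bump /= add1n; set w := level_weight _ _ _.
have w0 : 0 <= w by exact: level_weight_ge0.
have k_ge1 : (1 : R) <= k.+1%:R by rewrite ler1n.
have [dk|kd] := leqP d k.+1.
  rewrite -[leLHS]addr0; apply: lerD.
    by rewrite mulrA ler_peMl// mulrC ler_pdivlMr// mul1r ler_nat.
  by rewrite !mulr_ge0 ?exprn_ge0// ?invr_ge0.
rewrite -[leLHS]add0r; apply: lerD.
  by rewrite !mulr_ge0 ?invr_ge0// ltW.
rewrite !mulrA ler_peMl//; apply: mulr_ege1 => //.
rewrite exprVn ler_pdivlMr ?exprn_gt0// mul1r.
by rewrite ler_eXn2l ?ltr1n//; exact: ltnW (ltnW kd).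
Qed.

End Cube.

(** * Product and Gaussian measures *)

Section PowerProb.
Context {d} {T : measurableType d} {R : realType}.
Implicit Types (P : probability T R).

Lemma power_tonelli1 P n (F : n.+1.-tuple T -> \bar R) :
  measurable_fun [set: n.+1.-tuple T] F -> (forall x, 0 <= F x)%E ->
  (\int[power_prob P n.+1]_x F x =
   \int[P]_z \int[power_prob P n]_o F (tuple_cons (z, o)))%E.
Proof.
move=> mF F0 /=; rewrite ge0_integral_distribution//.
have mG : measurable_fun setT (F \o @tuple_cons _ T n).
  by apply: measurableT_comp mF _; exact: measurable_tuple_cons.
by rewrite (fubini_tonelli1 _ mG)//= => x; exact: F0.
Qed.

Lemma power_tonelli2 P n (F : n.+1.-tuple T -> \bar R) :
  measurable_fun [set: n.+1.-tuple T] F -> (forall x, 0 <= F x)%E ->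
  (\int[power_prob P n.+1]_x F x =
   \int[power_prob P n]_o \int[P]_z F (tuple_cons (z, o)))%E.
Proof.
move=> mF F0 /=; rewrite ge0_integral_distribution//.
have mG : measurable_fun setT (F \o @tuple_cons _ T n).
  by apply: measurableT_comp mF _; exact: measurable_tuple_cons.
by rewrite (fubini_tonelli2 _ mG)//= => x; exact: F0.
Qed.

Lemma measurable_tuple_box n (B : 'I_n -> set T) :
  (forall i, measurable (B i)) ->
  measurable [set x : n.-tuple T | forall i, B i (tnth x i)].
Proof.
move=> mB; rewrite (_ : [set x | _] =
    \big[setI/setT]_(i < n) ((@tnth _ T ^~ i) @^-1` B i)).
  apply: bigsetI_measurable => i _; rewrite -[X in measurable X]setTI.
  exact: measurable_tnth.
by rewrite -bigcap_seq; apply/seteqP; split=> x /= h i => [_|];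
  [exact: h | apply: h; rewrite /= mem_index_enum].
Qed.

(** Boxes are stable under intersection, include the whole space, and generate the product
    sigma-algebra since a cylinder over one coordinate is a box. *)
Lemma tuple_measure_unique n (m1 m2 : probability (n.-tuple T) R) :
  (forall B : 'I_n -> set T, (forall i, measurable (B i)) ->
    m1 [set x | forall i, B i (tnth x i)] = m2 [set x | forall i, B i (tnth x i)]) ->
  forall A, measurable A -> m1 A = m2 A.
Proof.
move=> m12 A mA.
pose G := [set C : set (n.-tuple T) | exists2 B : 'I_n -> set T,
  (forall i, measurable (B i)) & C = [set x | forall i, B i (tnth x i)]].
have GT : G setT.
  by exists (fun=> setT) => //; apply/seteqP; split => // x _ i.
apply: (measure_unique G (fun=> setT)) => //.
- apply/seteqP; split; last first.
    apply: smallest_sub; first exact: sigma_algebra_measurable.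
    by move=> _ [B mB ->]; exact: measurable_tuple_box.
  apply: smallest_sub; first exact: smallest_sigma_algebra.
  rewrite -bigcup_seq => C [i _ [D mD <-]].
  apply: sub_sigma_algebra.
  exists (fun j => if j == i then D else setT).
    by move=> j; case: ifP.
  rewrite setTI; apply/seteqP; split => x /=.
    by move=> Dx j; case: eqP => // ->.
  by move=> /(_ i); rewrite eqxx.
- move=> _ _ [B1 mB1 ->] [B2 mB2 ->].
  exists (fun i => B1 i `&` B2 i); first by move=> i; exact: measurableI.
  by apply/seteqP; split => x /=; [move=> [h1 h2] i; split|move=> h; split=> i; have [] := h i].
- by rewrite bigcup_const.
- by move=> _ [B mB ->]; exact: m12.
- by move=> k; apply: (le_lt_trans (probability_le1 m1 measurableT)); rewrite ltry.
Qed.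

Lemma measurable_permute_coords n (s : 'S_n) :
  measurable_fun [set: n.-tuple T] (@permute_coords T n s).
Proof.
apply/measurable_fun_tnthP => i.
rewrite (_ : _ \o _ = fun x => tnth x (s i)); first exact: measurable_tnth.
by apply/funext => x /=; rewrite tnth_mktuple.
Qed.

Lemma power_prob_permute P n (s : 'S_n) (A : set (n.-tuple T)) : measurable A ->
  power_prob P n (permute_coords s @^-1` A) = power_prob P n A.
Proof.
move=> mA.
pose mf := isMeasurableFun.Build _ _ _ _ _ (measurable_permute_coords n s).
pose f : {mfun n.-tuple T >-> n.-tuple T} := HB.pack (@permute_coords T n s) mf.
rewrite -[LHS]/(distribution (power_prob P n) f A).
apply: tuple_measure_unique => // B mB.
rewrite [RHS]power_prob_box//.
rewrite /= /distribution /pushforward.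
rewrite (_ : _ @^-1` _ = [set x | forall i, B ((s^-1)%g i) (tnth x i)]).
  rewrite (power_prob_box P (fun i => mB ((s^-1)%g i))) (reindex_inj (@perm_inj _ s)) /=.
  by apply: eq_bigr => i _; rewrite permK.
apply/seteqP; split => x /= h i.
  by have := h ((s^-1)%g i); rewrite tnth_mktuple permKV.
by have := h (s i); rewrite permK tnth_mktuple.
Qed.

End PowerProb.

Section Density.
Context {d} {T : measurableType d} {R : realType}.
Variables (mu nu : {measure set T -> \bar R}) (g : T -> R).
Hypothesis mg : measurable_fun [set: T] g.
Hypothesis g0 : forall x, 0 <= g x.
Hypothesis nuE : forall A, measurable A -> nu A = (\int[mu]_(x in A) (g x)%:E)%E.
Local Open Scope ereal_scope.

Import HBNNSimple.

Lemma ge0_integral_density (f : T -> \bar R) :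
  measurable_fun [set: T] f -> (forall x, 0 <= f x) ->
  \int[nu]_x f x = \int[mu]_x (f x * (g x)%:E).
Proof.
move=> mf f0.
pose f_ := nnsfun_approx measurableT mf.
have mfn n : measurable_fun [set: T] (fun x => (f_ n x)%:E).
  exact/measurable_EFinP/measurable_funP.
transitivity (limn (fun n => \int[nu]_x (f_ n x)%:E)).
  rewrite -monotone_convergence//.
  - by apply: eq_integral => y _; apply/esym/cvg_lim => //; exact: cvg_nnsfun_approx.
  - by move=> n y _; rewrite lee_fin.
  - by move=> y _ m n mn; rewrite lee_fin; exact/lefP/nd_nnsfun_approx.
transitivity (limn (fun n => \int[mu]_x ((f_ n x)%:E * (g x)%:E))); last first.
  rewrite -monotone_convergence//; first last.
  - move=> y _ m n mn; apply: lee_wpmul2r; first by rewrite lee_fin.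
    by rewrite lee_fin; exact/lefP/nd_nnsfun_approx.
  - by move=> n x _; rewrite mule_ge0// lee_fin.
  - by move=> n; apply: emeasurable_funM => //; exact/measurable_EFinP.
  apply: eq_integral => y _; apply/cvg_lim => //.
  apply: cvgeZr; first by [].
  exact: cvg_nnsfun_approx.
congr (limn _); apply/funext => n.
under eq_integral do rewrite fimfunE -fsumEFin//.
rewrite ge0_integral_fsum//; last 2 first.
  - by move=> y; exact/measurable_EFinP/measurable_funM.
  - by move=> y x _; rewrite nnfun_muleindic_ge0.
transitivity (\sum_(k \in range (f_ n))
    \int[mu]_x ((k * \1_(f_ n @^-1` [set k]) x)%:E * (g x)%:E)).
  apply: eq_fsbigr => r _; rewrite integralZl_indic_nnsfun// integral_indic//= setIT nuE//.
  have [r0|r0] := ltP r 0%R.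
    rewrite preimage_nnfun0// integral_set0 mule0.
    by rewrite integral0_eq// => x _; rewrite indic0 mulr0 mul0e.
  rewrite -ge0_integralZl//; last first.
  - by move=> x _; rewrite lee_fin.
  - by apply: measurable_funTS; exact/measurable_EFinP.
  rewrite integral_mkcond; apply: eq_integral => x _.
  rewrite patchE indicE; case: ifPn => _ /=; first by rewrite mulr1.
  by rewrite mulr0 mul0e.
rewrite -ge0_integral_fsum//.
- apply: eq_integral => x _; rewrite [in RHS]fimfunE -fsumEFin//.
  by rewrite ge0_mule_fsuml// => i; exact: nnfun_muleindic_ge0.
- move=> r; apply: emeasurable_funM; last exact/measurable_EFinP.
  by exact/measurable_EFinP/measurable_funM.
- by move=> r x _; rewrite mule_ge0 ?nnfun_muleindic_ge0// lee_fin.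
Qed.

End Density.

Section Gaussian.
Context {R : realType}.
Implicit Types (a b h x y z : R) (B : set R).
Notation mu := (@lebesgue_measure R).
Notation gamma := (normal_prob (0 : R) 1).
Notation peak := (normal_peak (1 : R)).

Lemma ge0_integral_shift a (f : R -> \bar R) :
  measurable_fun [set: R] f -> (forall x, 0 <= f x)%E ->
  (\int[mu]_x f x = \int[mu]_x f (x + a)%R)%E.
Proof.
move=> mf f0.
pose phi (x : measurableTypeR R) : measurableTypeR R := (x + a)%R.
have ms : measurable_fun [set: measurableTypeR R] phi.
  exact: measurable_funD.
have -> : (\int[mu]_x f (x + a)%R =
    \int[pushforward mu phi]_x f x)%E.
  by rewrite (ge0_integral_pushforward ms).
apply: eq_measure_integral => //= A mA _.
apply: lebesgue_measure_unique => //= _ [[x y]] _ <-.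
rewrite /pushforward (_ : _ @^-1` _ = `]x - a, y - a]%classic).
  rewrite !lebesgue_measure_itv/= !lte_fin ltrD2r; case: ifPn => // _.
  by rewrite -!EFinB; congr (_%:E); ring.
by apply/seteqP; split => u /=; rewrite !in_itv/= ltrBlDr lerBrDr.
Qed.

Lemma ge0_integral_opp (f : R -> \bar R) :
  measurable_fun [set: R] f -> (forall x, 0 <= f x)%E ->
  (\int[mu]_x f x = \int[mu]_x f (- x)%R)%E.
Proof.
move=> mf f0.
pose phi (x : measurableTypeR R) : measurableTypeR R := (- x)%R.
have ms : measurable_fun [set: measurableTypeR R] phi.
  exact: measurable_funN.
have -> : (\int[mu]_x f (- x)%R =
    \int[pushforward mu phi]_x f x)%E.
  by rewrite (ge0_integral_pushforward ms).
apply: eq_measure_integral => //= A mA _.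
by apply/esym/lebesgue_measureN.
Qed.

Lemma normal_pdf1E a x : normal_pdf a 1 x = peak * expR (- (x - a) ^+ 2 / 2).
Proof. by rewrite normal_pdfE ?oner_neq0// /normal_fun expr1n. Qed.

Lemma ge0_integral_normal a (f : R -> \bar R) :
  measurable_fun [set: R] f -> (forall x, 0 <= f x)%E ->
  (\int[normal_prob a 1]_x f x = \int[mu]_x (f x * (normal_pdf a 1 x)%:E))%E.
Proof.
move=> mf f0; apply: ge0_integral_density => //.
  exact: measurable_normal_pdf.
exact: normal_pdf_ge0.
Qed.

Lemma ge0_integral_normal_shift a (f : R -> \bar R) :
  measurable_fun [set: R] f -> (forall x, 0 <= f x)%E ->
  (\int[normal_prob a 1]_x f x = \int[gamma]_x f (x + a)%R)%E.
Proof.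
move=> mf f0.
have mfa : measurable_fun [set: R] (fun x => f (x + a)).
  by apply: measurableT_comp mf _; exact: measurable_funD.
pose F x := (f x * (normal_pdf a 1 x)%:E)%E.
have mF : measurable_fun [set: R] F.
  by apply: emeasurable_funM => //; apply/measurable_EFinP; exact: measurable_normal_pdf.
have F0 x : (0 <= F x)%E by rewrite mule_ge0// lee_fin normal_pdf_ge0.
apply: etrans (ge0_integral_normal a f mf f0) _.
apply: etrans (ge0_integral_shift a F mF F0) _.
apply: etrans (esym (ge0_integral_normal 0 _ mfa (fun x => f0 _))).
by apply: eq_integral => x _; rewrite /F !normal_pdf1E addrK subr0.
Qed.

Lemma normal_prob_shift a B : measurable B ->
  normal_prob a 1 B = gamma ((fun x => x + a) @^-1` B).
Proof.
move=> mB.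
have mp : measurable ((fun x => x + a) @^-1` B).
  by rewrite -[X in measurable X]setTI; apply: (measurable_funD _ _ measurableT).
have m1 : measurable_fun [set: R] (fun x => (\1_B x : R)%:E).
  by apply/measurable_EFinP; exact: measurable_indic.
have := ge0_integral_normal_shift a _ m1 (fun x => ltac:(by rewrite lee_fin)).
rewrite (@integral_indic _ _ _ (normal_prob a 1) setT measurableT B mB) setIT => ->.
rewrite [LHS](_ : _ = (\int[gamma]_x (\1_((fun x => x + a) @^-1` B) x)%:E)%E) //.
by rewrite integral_indic// setIT.
Qed.

(** The exponential is the ratio of the two normal densities. With f = 1 this yields the exponential
    moments of the Gaussian; applied in each coordinate it tilts the product measure. *)
Lemma normal_tilt a (f : R -> \bar R) :
  measurable_fun [set: R] f -> (forall x, 0 <= f x)%E ->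
  (\int[normal_prob a 1]_x f x =
   \int[gamma]_x (f x * (expR (a * x - a ^+ 2 / 2)%R)%:E))%E.
Proof.
move=> mf f0.
have mfe : measurable_fun [set: R] (fun x => f x * (expR (a * x - a ^+ 2 / 2)%R)%:E)%E.
  apply: emeasurable_funM => //; apply/measurable_EFinP.
  apply: measurableT_comp => //; apply: measurable_funB => //.
have fe0 x : (0 <= f x * (expR (a * x - a ^+ 2 / 2)%R)%:E)%E.
  by rewrite mule_ge0// lee_fin expR_ge0.
apply: etrans (ge0_integral_normal a f mf f0) _.
apply: etrans (esym (ge0_integral_normal 0 _ mfe fe0)).
apply: eq_integral => x _; rewrite !normal_pdf1E -muleA -EFinM; congr (_ * _%:E)%E.
rewrite mulrCA -expRD; congr (_ * expR _); by field.
Qed.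

Lemma ge0_integral_gaussian_opp (f : R -> \bar R) :
  measurable_fun [set: R] f -> (forall x, 0 <= f x)%E ->
  (\int[gamma]_x f x = \int[gamma]_x f (- x)%R)%E.
Proof.
move=> mf f0.
have mfN : measurable_fun [set: R] (fun x => f (- x)).
  by apply: measurableT_comp mf _; exact: measurable_funN.
pose F x := (f x * (normal_pdf 0 1 x)%:E)%E.
have mF : measurable_fun [set: R] F.
  by apply: emeasurable_funM => //; apply/measurable_EFinP; exact: measurable_normal_pdf.
have F0 x : (0 <= F x)%E by rewrite mule_ge0// lee_fin normal_pdf_ge0.
apply: etrans (ge0_integral_normal 0 f mf f0) _.
apply: etrans (ge0_integral_opp F mF F0) _.
apply: etrans (esym (ge0_integral_normal 0 _ mfN (fun x => f0 _))).
by apply: eq_integral => x _; rewrite /F !normal_pdf1E !subr0 sqrrN.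
Qed.

Lemma integrable_gaussian_id : gamma.-integrable [set: R] (EFin \o (@id R)).
Proof.
apply/integrableP; split; first exact/measurable_EFinP.
have mexp a : measurable_fun [set: R] (fun x => (expR (a * x - a ^+ 2 / 2))%:E).
  apply/measurable_EFinP; apply: measurableT_comp => //.
  exact: measurable_funB.
have exp1 a : (\int[gamma]_x (expR (a * x - a ^+ 2 / 2)%R)%:E = 1)%E.
  have := normal_tilt a (fun=> 1%E).
  rewrite integral_cst//= probability_setT mul1e => -> //.
  by apply: eq_integral => x _; rewrite mul1e.
(* This is e^x + e^-x, a majorant of |x|, written with the tilting densities for a = 1 and a = -1,
   each of integral 1. *)
pose F x : \bar R := ((expR (2^-1)%R)%:E * ((expR (1 * x - 1 ^+ 2 / 2)%R)%:E +
   (expR (- 1 * x - (- 1) ^+ 2 / 2)%R)%:E))%E.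
apply: (@le_lt_trans _ _ (\int[gamma]_x F x)%E).
  apply: ge0_le_integral => //=.
  - exact: measurableT_comp.
  - by apply: emeasurable_funM => //; apply: emeasurable_funD; exact: mexp.
  - move=> x _; rewrite /F -EFinD -EFinM lee_fin mulrDr -!expRD.
    have -> : 2^-1 + (1 * x - 1 ^+ 2 / 2) = x by field.
    have -> : 2^-1 + (-1 * x - (-1) ^+ 2 / 2) = - x by field.
    have h1 := expR_ge1Dx x; have h2 := expR_ge1Dx (- x).
    have e1 := expR_gt0 x; have e2 := expR_gt0 (- x).
    by rewrite ler_norml; apply/andP; split; lra.
rewrite /F ge0_integralZl//; first last.
- by move=> x _; rewrite adde_ge0// lee_fin expR_ge0.
- by apply: emeasurable_funD; exact: mexp.
rewrite ge0_integralD//.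
- by rewrite !exp1 -EFinD -EFinM ltry.
- exact: mexp.
- exact: mexp.
Qed.

End Gaussian.

Section FineProbability.
Context {d} {T : measurableType d} {R : realType} (P : probability T R).
Implicit Types A B : set T.
Notation pr B := (fine (P B)).

Lemma fine_probK B : measurable B -> (pr B)%:E = P B.
Proof. by move=> mB; rewrite fineK// fin_num_measure. Qed.

Lemma fine_prob_ge0 B : 0 <= pr B.
Proof. by rewrite fine_ge0. Qed.

Lemma fine_prob_le A B : measurable A -> measurable B -> A `<=` B -> pr A <= pr B.
Proof. by move=> mA mB AB; rewrite -lee_fin !fine_probK// le_measure// inE. Qed.

Lemma fine_prob_le1 B : measurable B -> pr B <= 1.
Proof. by move=> mB; rewrite -lee_fin fine_probK// probability_le1. Qed.

Lemma fine_probC B : measurable B -> pr (~` B) = 1 - pr B.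
Proof.
move=> mB; apply: EFin_inj; rewrite EFinB !fine_probK//; last exact: measurableC.
by rewrite probability_setC.
Qed.

Lemma fine_probU A B : measurable A -> measurable B -> [disjoint A & B] ->
  pr (A `|` B) = pr A + pr B.
Proof.
move=> mA mB AB; apply: EFin_inj; rewrite EFinD !fine_probK//; last exact: measurableU.
by rewrite measureU//; apply/eqP; rewrite -disj_set2E.
Qed.

End FineProbability.

(** * The Gaussian distribution function and its uniform law *)

Section GaussianCdf.
Context {R : realType}.
Implicit Types (a b h u x y z : R) (B D : set R).
Notation mu := (@lebesgue_measure R).
Notation gamma := (normal_prob (0 : R) 1).
Notation pr B := (fine (gamma B)).
Notation pdf := (normal_pdf (0 : R) 1).
Notation peak := (normal_peak (1 : R)).

Lemma pdf_gt0 x : 0 < pdf x.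
Proof. by rewrite normal_pdf1E mulr_gt0 ?expR_gt0// normal_peak_gt0 ?oner_neq0. Qed.

Lemma pdf_norm_le x y : `|x| <= `|y| -> pdf y <= pdf x.
Proof.
move=> xy; rewrite !normal_pdf1E ler_wpM2l ?normal_peak_ge0// ler_expR !subr0.
by rewrite ler_pM2r ?invr_gt0// lerN2 -(real_normK (num_real x)) -(real_normK (num_real y))
  ler_pXn2r ?nnegrE.
Qed.

Lemma gaussian_itv_le a b : a <= b -> pr `]a, b]%classic <= peak * (b - a).
Proof.
move=> ab; rewrite -lee_fin fine_probK//= /normal_prob.
apply: (@le_trans _ _ (\int[mu]_(x in `]a, b]) peak%:E)%E).
  apply: ge0_le_integral => //=.
  - by move=> x _; rewrite lee_fin normal_pdf_ge0.
  - by apply: measurable_funTS; apply/measurable_EFinP; exact: measurable_normal_pdf.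
  - by move=> x _; rewrite lee_fin normal_pdf_ub// oner_neq0.
rewrite integral_cst//= lebesgue_measure_itv/= lte_fin.
case: ifPn => [_|_]; first by rewrite -EFinB -EFinM.
by rewrite mule0 lee_fin mulr_ge0 ?normal_peak_ge0 ?subr_ge0.
Qed.

Lemma gaussian_itv_ge a b y : a <= b -> `|a| <= y -> `|b| <= y ->
  (b - a) * pdf y <= pr `]a, b[%classic.
Proof.
move=> ab ay bY; rewrite -lee_fin fine_probK//= /normal_prob.
apply: (@le_trans _ _ (\int[mu]_(x in `]a, b[) (pdf y)%:E)%E).
  rewrite integral_cst//= lebesgue_measure_itv/= lte_fin.
  case: ifPn => [_|]; first by rewrite -EFinB -EFinM mulrC.
  rewrite -leNgt => ba; have -> : b = a by apply: le_anti; rewrite ab ba.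
  by rewrite subrr mul0r mule0.
apply: ge0_le_integral => //=.
- by move=> x _; rewrite lee_fin normal_pdf_ge0.
- by apply: measurable_funTS; apply/measurable_EFinP; exact: measurable_normal_pdf.
- move=> x; rewrite in_itv/= => /andP[ax xb]; rewrite lee_fin pdf_norm_le//.
  move: ay bY; rewrite !ler_norml => /andP[a1 a2] /andP[b1 b2].
  by have := ler_norm y; move=> hy; apply/andP; split; lra.
Qed.

Definition gaussian_cdf z : R := pr `]-oo, z]%classic.
Notation Phi := gaussian_cdf.

Lemma gaussian_cdfB a b : a <= b -> Phi b - Phi a = pr `]a, b]%classic.
Proof.
move=> ab; rewrite /gaussian_cdf.
have -> : `]-oo, b]%classic = `]-oo, a]%classic `|` `]a, b]%classic.
  by rewrite -itv_bndbnd_setU.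
rewrite fine_probU//; first by rewrite addrC addKr.
rewrite disj_set2E; apply/eqP; rewrite -subset0 => x []/=.
by rewrite !in_itv/= => xa /andP[]; rewrite ltNge xa.
Qed.

Lemma gaussian_cdf_lt a b : a < b -> Phi a < Phi b.
Proof.
move=> ab; rewrite -subr_gt0 (gaussian_cdfB _ _ (ltW ab)).
apply: (@lt_le_trans _ _ ((b - a) * pdf (Num.max `|a| `|b|))).
  by rewrite mulr_gt0 ?subr_gt0// pdf_gt0.
apply: le_trans (gaussian_itv_ge _ _ _ (ltW ab) _ _) _; rewrite ?le_max ?lexx ?orbT//.
apply: fine_prob_le => //.
by apply: subset_itvl; rewrite bnd_simp.
Qed.

Lemma gaussian_cdf_leE a b : (Phi a <= Phi b) = (a <= b).
Proof.
have [ab|ba] := leP a b; last by rewrite leNgt gaussian_cdf_lt.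
by move: ab; rewrite le_eqVlt => /predU1P[->|/gaussian_cdf_lt/ltW]; rewrite ?lexx.
Qed.

Lemma gaussian_cdf_continuous : continuous Phi.
Proof.
have lip a b : `|Phi a - Phi b| <= peak * `|a - b|.
  wlog ab : a b / a <= b.
    move=> H; have [/H//|/ltW/H] := leP a b.
    by rewrite distrC [`|b - a|]distrC.
  rewrite distrC [`|a - b|]distrC !ger0_norm ?subr_ge0 ?gaussian_cdf_leE//.
  by rewrite gaussian_cdfB// gaussian_itv_le.
have p0 : 0 < peak by rewrite normal_peak_gt0// oner_neq0.
move=> x; apply/cvgrPdist_le => e e0.
near=> y.
apply: le_trans (lip _ _) _.
rewrite -ler_pdivlMl// mulrC; near: y.
apply: cvgr_dist_le; first exact: cvg_id.
by rewrite divr_gt0.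
Unshelve. all: by end_near. Qed.

Lemma integrable_gaussian_idS D : measurable D -> gamma.-integrable D (EFin \o (@id R)).
Proof.
move=> mD; exact: (@integrableS _ _ _ gamma setT D _ measurableT mD (@subsetT _ _)
  (@integrable_gaussian_id R)).
Qed.

(** A tail bound of order 1/y is enough for its purpose: to make the distribution function come
    close to 0 and to 1, so that every level in between is attained. *)
Lemma gaussian_markov D y : measurable D -> (forall x, D x -> y <= `|x|) ->
  y * pr D <= \int[gamma]_x `|x|.
Proof.
move=> mD Dy.
have iN B : measurable B -> gamma.-integrable B (EFin \o (@Num.norm R R)).
  move=> mB; apply: (@integrableS _ _ _ gamma setT B _ measurableT mB (@subsetT _ _)).
  exact: (integrable_abse (@integrable_gaussian_id R)).
rewrite -Rintegral_cst//.
apply: (@le_trans _ _ (\int[gamma]_(x in D) `|x|)).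
  apply: le_Rintegral => //; last exact: iN.
  by apply: finite_measure_integrable_cst.
rewrite Rintegral_mkcond; apply: le_Rintegral => //.
- by rewrite -restrict_EFin; apply: (proj1 (@integrable_mkcond _ _ _ gamma D (EFin \o Num.norm) mD)); exact: iN.
- exact: (iN setT measurableT).
- by move=> x _; rewrite patchE; case: ifP => /= _; rewrite ?normr_ge0.
Qed.

Lemma gaussian_cdf_gt0 z : 0 < Phi z.
Proof. by apply: le_lt_trans (gaussian_cdf_lt (z - 1) z _); rewrite ?fine_prob_ge0 ?ltrBlDr ?ltrDl. Qed.

Lemma gaussian_cdf_lt1 z : Phi z < 1.
Proof.
apply: lt_le_trans (gaussian_cdf_lt z (z + 1) _) _; rewrite ?ltrDl//.
exact: fine_prob_le1.
Qed.

Lemma gaussian_quantile u : 0 < u -> u < 1 -> exists q, Phi q = u.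
Proof.
move=> u0 u1; set c := \int[gamma]_x `|x|.
have c0 : 0 <= c by apply: Rintegral_ge0.
have small v : 0 < v -> exists2 y, 0 < y & c / y < v.
  move=> v0; exists (c / v + 1); first by rewrite ltr_pwDr// divr_ge0// ltW.
  rewrite ltr_pdivrMr; last by rewrite ltr_pwDr// divr_ge0// ltW.
  by rewrite mulrDr mulr1 mulrC divfK ?gt_eqF// ltrDl.
have [a a0 ha] := small u u0.
have [b b0 hb] := small (1 - u) (ltac:(lra)).
have Pa : Phi (- a) < u.
  apply: le_lt_trans ha; rewrite ler_pdivlMr// mulrC; apply: gaussian_markov => // x /=.
  by rewrite in_itv/= => xa; rewrite ler0_norm; lra.
have Pb : u < Phi b.
  suff : 1 - Phi b < 1 - u by lra.
  rewrite /gaussian_cdf -fine_probC//.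
  apply: le_lt_trans hb; rewrite ler_pdivlMr// mulrC; apply: gaussian_markov => [|x /=].
    exact: measurableC.
  by rewrite in_itv/= => /negP; rewrite -ltNge => xb; rewrite ger0_norm; lra.
have [q _ <-] : exists2 q, q \in `[- a, b] & Phi q = u.
  apply: IVT; first by lra.
    by apply: continuous_subspaceT => x; exact: gaussian_cdf_continuous.
  by rewrite ge_min (ltW Pa)/= le_max (ltW Pb) orbT.
by exists q.
Qed.

Lemma gaussian_cdf_lt_setE q : [set z | Phi z < Phi q] = `]-oo, q[%classic.
Proof.
apply/seteqP; split => z /=; rewrite in_itv/= !ltNge gaussian_cdf_leE//.
Qed.

Lemma gaussian_point0 z : gamma [set z] = 0%E.
Proof. by rewrite /= /normal_prob integral_set1. Qed.

(** Phi of a Gaussian variable is uniform on [0, 1], which makes its binary digits independent fair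
    bits. The levels 0 and 1 are treated apart because Phi does not attain them. *)
Lemma gaussian_cdf_uniform u : 0 <= u -> u <= 1 ->
  measurable [set z | Phi z < u] /\ pr [set z | Phi z < u] = u.
Proof.
rewrite le_eqVlt => /predU1P[<- _|u0].
  have -> : [set z | Phi z < 0] = set0.
    by rewrite -subset0 => z /=; rewrite ltNge ltW// gaussian_cdf_gt0.
  by rewrite measure0.
rewrite le_eqVlt => /predU1P[->|u1].
  have -> : [set z | Phi z < 1] = setT.
    by rewrite -subTset => z _ /=; exact: gaussian_cdf_lt1.
  by rewrite probability_setT.
have [q <-] := gaussian_quantile u u0 u1.
rewrite gaussian_cdf_lt_setE; split => //.
rewrite /gaussian_cdf -(@setUitv1 _ _ _ q true)// fine_probU//; last first.
  rewrite disj_set2E; apply/eqP; rewrite -subset0 => x []/=.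
  by rewrite in_itv/= => + xq; rewrite xq ltxx.
by rewrite [X in _ + X](_ : _ = 0) ?addr0// -[RHS]/(fine 0%:E); congr fine; exact: gaussian_point0.
Qed.

Lemma gaussian_cdf_itv u v : 0 <= u -> u <= v -> v <= 1 ->
  measurable [set z | u <= Phi z < v] /\ pr [set z | u <= Phi z < v] = v - u.
Proof.
move=> u0 uv v1.
have [mu1 pu] := gaussian_cdf_uniform u u0 (le_trans uv v1).
have [mv pv] := gaussian_cdf_uniform v (le_trans u0 uv) v1.
have E : [set z | u <= Phi z < v] = [set z | Phi z < v] `\` [set z | Phi z < u].
  apply/seteqP; split => z /=; first by move=> /andP[uz zv]; split=> //; rewrite ltNge uz.
  by move=> [-> /negP]; rewrite -leNgt => ->.
have mE : measurable [set z | u <= Phi z < v] by rewrite E; exact: measurableD.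
split => //.
have : pr [set z | Phi z < v] = pr [set z | Phi z < u] + pr [set z | u <= Phi z < v].
  rewrite -fine_probU//.
    congr (fine (gamma _)); rewrite E; apply/seteqP; split => z /=.
      by move=> zv; have [|] := ltP (Phi z) u; [left|right; split => //; apply/negP; rewrite -leNgt].
    by move=> [zu|[]//]; exact: lt_le_trans zu uv.
  rewrite disj_set2E; apply/eqP; rewrite -subset0 => x []/= xu /andP[].
  by rewrite leNgt xu.
by rewrite pv pu => E1; rewrite [X in _ = X - _]E1 addrC addKr.
Qed.

End GaussianCdf.

(** * Sums over the cube, sums of random signs, and integrals of finite codes *)

Fixpoint cube N : seq (seq bool) :=
  if N is M.+1 then map (cons true) (cube M) ++ map (cons false) (cube M) else [:: [::]].

Lemma mem_cube N s : (s \in cube N) = (size s == N).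
Proof.
elim: N s => [|N IH] s /=; first by rewrite inE; case: s.
have inj (b : bool) : injective (cons b) by move=> x y [].
rewrite mem_cat; case: s => [|b s] /=.
  by apply/negbTE; rewrite negb_or; apply/andP; split; apply/mapP => -[].
rewrite eqSS -IH; case: b.
  rewrite (mem_map (inj true)); case: (s \in cube N) => //=.
  by apply/negbTE/mapP => -[].
rewrite (mem_map (inj false)) orbC; case: (s \in cube N) => //=.
by apply/negbTE/mapP => -[].
Qed.

Lemma cube_uniq N : uniq (cube N).
Proof.
have inj (b : bool) : injective (cons b) by move=> x y [].
elim: N => [//|N IH] /=; rewrite cat_uniq !(map_inj_uniq (inj _)) IH /= andbT.
by apply/hasPn => _ /mapP[s _ ->]; apply/mapP => -[].
Qed.

Lemma big_cube_cat {R : realType} M N (F : seq bool -> R) :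
  \sum_(s <- cube (M + N)) F s = \sum_(s <- cube M) \sum_(t <- cube N) F (s ++ t).
Proof.
elim: M F => [|M IH] F; first by rewrite big_seq1.
by rewrite addSn /= !big_cat !big_map /= !IH.
Qed.

Section CubeSums.
Context {R : realType}.
Implicit Types (F : seq bool -> R).

Lemma cube_meanE N F : cube_mean N F = 2^-1 ^+ N * \sum_(s <- cube N) F s.
Proof.
elim: N F => [|N IH] F; first by rewrite /= big_seq1 mul1r.
by rewrite /= !IH big_cat !big_map exprS /=; field.
Qed.

Lemma sum_cube_eq N F t : size t = N -> \sum_(s <- cube N) F s * (t == s)%:R = F t.
Proof.
move=> tN; rewrite (bigD1_seq t) ?cube_uniq ?mem_cube ?tN//=.
rewrite eqxx mulr1 big1 ?addr0// => s st.
by rewrite eq_sym (negbTE st) mulr0.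
Qed.

Definition bit_sum (s : seq bool) : R := \sum_(b <- s) (if b then 1 else -1).

Lemma bit_sum_cons b s : bit_sum (b :: s) = (if b then 1 else -1) + bit_sum s.
Proof. by rewrite /bit_sum big_cons. Qed.

Lemma cube_mean_bit_sum N : cube_mean N bit_sum = 0.
Proof.
elim: N => [|N IH]; first by rewrite /= /bit_sum big_nil.
rewrite /=.
under eq_cube_mean do rewrite bit_sum_cons.
under [X in (_ + X) / 2]eq_cube_mean do rewrite bit_sum_cons.
by rewrite !cube_meanD !cube_mean_cst IH; field.
Qed.

(** The constant 2 in place of the sharp 1/2 allows an elementary proof and only affects the final
    constant. For x^2 <= 1/2, the bound e^y <= 1/(1 - y) gives the mean at most 1/(1 - x^2), and 1
    <= (1 - x^2)(1 + 2 x^2). For larger x already |x| <= 2 x^2. *)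
Lemma cosh_le (x : R) : (expR x + expR (- x)) / 2 <= expR (2 * x ^+ 2).
Proof.
have [x2|x2] := leP (x ^+ 2) 2^-1.
  have x1 : x < 1 by nra.
  have xN1 : -1 < x by nra.
  have inv (y : R) : y < 1 -> expR y <= (1 - y)^-1.
    move=> y1; rewrite -[y]opprK expRN opprK lef_pV2 ?posrE ?expR_gt0 ?subr_gt0//.
    exact: expR_ge1Dx.
  have e1 := inv _ x1.
  have e2 : expR (- x) <= (1 + x)^-1 by rewrite -[1 + x](_ : 1 - - x = _) ?inv ?opprK; lra.
  have e3 : expR (- (2 * x ^+ 2)) <= (1 + 2 * x ^+ 2)^-1.
    by rewrite -[1 + _](_ : 1 - - (2 * x ^+ 2) = _) ?inv ?opprK; nra.
  apply: (@le_trans _ _ (1 - x ^+ 2)^-1).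
    have -> : (1 - x ^+ 2)^-1 = ((1 - x)^-1 + (1 + x)^-1) / 2.
      field; apply/and3P; split; apply/eqP; nra.
    lra.
  rewrite -[expR (2 * _)]invrK -expRN lef_pV2 ?posrE ?expR_gt0//; last by lra.
  apply: le_trans e3 _.
  rewrite -[(_)^-1]mul1r ler_pdivrMr; nra.
have x0 : x != 0 by apply/eqP => x0; move: x2; rewrite x0 expr0n /=; lra.
have hx : `|x| <= 2 * x ^+ 2.
  rewrite -(real_normK (num_real x)) in x2 *.
  have := normr_ge0 x; set y := `|x| in x2 * => y0; nra.
move: hx; rewrite ler_norml => /andP[h1 h2].
have : expR x <= expR (2 * x ^+ 2) by rewrite ler_expR.
have : expR (- x) <= expR (2 * x ^+ 2) by rewrite ler_expR; lra.
lra.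
Qed.

Lemma cube_mean_exp_bit_sum N (a : R) :
  cube_mean N (fun s => expR (a * bit_sum s)) <= expR (2 * a ^+ 2 * N%:R).
Proof.
elim: N => [|N IH]; first by rewrite /= /bit_sum big_nil !mulr0 expR0.
rewrite /=.
under eq_cube_mean do rewrite bit_sum_cons mulrDr expRD mulr1.
under [X in (_ + X) / 2 <= _]eq_cube_mean do rewrite bit_sum_cons mulrDr expRD mulrN1.
rewrite !cube_meanZ -mulrDl mulrAC -[N.+1%:R]natr1 mulrDr mulr1 expRD [leRHS]mulrC.
apply: ler_pM => //.
- by apply: cube_mean_ge0 => s _; exact: expR_ge0.
- exact: cosh_le.
Qed.

End CubeSums.

Section CodeIntegral.
Context {d} {T : measurableType d} {R : realType} (P : probability T R).
Variables (c : T -> seq bool) (N : nat).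
Hypothesis mc : forall s, measurable (c @^-1` [set s]).
Hypothesis sizec : forall x, size (c x) = N.
Implicit Types (F : seq bool -> R) (D : set T).
Notation pr B := (fine (P B)).

Let codeE F x : F (c x) = \sum_(s <- cube N) F s * \1_(c @^-1` [set s]) x.
Proof.
rewrite -(sum_cube_eq N F (c x))//; apply: eq_bigr => s _; congr (_ * _).
rewrite indicE; congr (_%:R); congr nat_of_bool.
by apply/eqP/idP => [/= cs|/set_mem]; rewrite ?inE.
Qed.

Lemma measurable_code F : measurable_fun [set: T] (fun x => F (c x)).
Proof.
under eq_fun do rewrite codeE.
by apply: measurable_sum => s; apply: measurable_funM.
Qed.

Lemma integrable_code F D : measurable D -> P.-integrable D (EFin \o (fun x => F (c x))).
Proof.
move=> mD; apply: measurable_bounded_integrable => //.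
- by rewrite (le_lt_trans (probability_le1 _ mD))// ltry.
- by apply: measurable_funTS; exact: measurable_code.
exists (\sum_(s <- cube N) `|F s|); split; first by rewrite num_real.
move=> y /ltW Fy x _ /=; apply: le_trans Fy.
rewrite (bigD1_seq (c x)) ?cube_uniq ?mem_cube ?sizec//= lerDl.
exact: sumr_ge0.
Qed.

(** A function of a finite code is simple. The abstract [c] will be both the digits of one
    coordinate and the digits of a whole vector. *)
Lemma Rintegral_code F D : measurable D ->
  \int[P]_(x in D) F (c x) = \sum_(s <- cube N) F s * pr (D `&` c @^-1` [set s]).
Proof.
move=> mD; under eq_Rintegral do rewrite codeE.
elim: (cube N) => [|t r IH].
  by under eq_Rintegral do rewrite big_nil; rewrite big_nil Rintegral_cst// mul0r.
under eq_Rintegral do rewrite big_cons.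
have i1 s : P.-integrable D (EFin \o (fun x => F s * \1_(c @^-1` [set s]) x)).
  apply: (integrableS measurableT mD (@subsetT _ _)).
  rewrite (_ : _ \o _ = fun x => (F s)%:E * (\1_(c @^-1` [set s]) x)%:E)%E; last first.
    by apply/funext => x; rewrite /= EFinM.
  by apply: integrableZl => //; exact: integrable_indic.
have i2 : P.-integrable D (EFin \o (fun x => \sum_(s <- r) F s * \1_(c @^-1` [set s]) x)).
  rewrite (_ : _ \o _ = fun x => \sum_(s <- r) (F s * \1_(c @^-1` [set s]) x)%:E)%E; last first.
    by apply/funext => x; rewrite /= sumEFin.
  by apply: integrable_sum => // s _; exact: i1.
rewrite RintegralD// IH big_cons; congr (_ + _).
rewrite RintegralZl//; last by apply: (integrableS measurableT mD (@subsetT _ _)); exact: integrable_indic.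
by congr (_ * _); rewrite /Rintegral integral_indic// setIC.
Qed.

Lemma sum_code D : measurable D -> pr D = \sum_(s <- cube N) pr (D `&` c @^-1` [set s]).
Proof.
move=> mD; have := Rintegral_code (fun=> 1) D mD.
by rewrite Rintegral_cst// mul1r => ->; apply: eq_bigr => s _; rewrite mul1r.
Qed.

End CodeIntegral.

(** * Binary digits of a Gaussian coordinate *)

Section Digits.
Context {R : realFieldType}.
Implicit Types (u : R) (s t : seq bool).

Fixpoint digits m u : seq bool :=
  if m is k.+1 then let b := 2^-1 <= u in b :: digits k (2 * u - b%:R) else [::].

Fixpoint binval s : R := if s is b :: s' then (b%:R + binval s') / 2 else 0.

Lemma size_digits m u : size (digits m u) = m.
Proof. by elim: m u => [//|m IH] u /=; rewrite IH. Qed.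

Lemma binval_ge0 s : 0 <= binval s.
Proof. by elim: s => [//|b s IH] /=; rewrite divr_ge0// addr_ge0. Qed.

Lemma binval_le s : binval s + 2^-1 ^+ size s <= 1.
Proof.
elim: s => [|b s IH] /=; first by rewrite add0r.
by rewrite exprS; case: b => /=; lra.
Qed.

Lemma digitsP m u s : 0 <= u < 1 -> size s = m ->
  (digits m u == s) = (binval s <= u < binval s + 2^-1 ^+ m).
Proof.
move=> + <-; elim: s u => [|b s IH] u /andP[u0 u1] /=.
  by rewrite eqxx add0r u0 u1.
have p0 : 0 < 2^-1 ^+ size s :> R by rewrite exprn_gt0// invr_gt0.
have v0 := binval_ge0 s; have v1 := binval_le s.
rewrite eqseq_cons exprS; case: (leP 2^-1 u) => hu /=.
  rewrite IH; last by apply/andP; split; lra.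
  case: b => /=; first by apply/andP/andP => -[]; split; lra.
  by apply/esym/negbTE/negP => /andP[]; lra.
rewrite IH; last by apply/andP; split; lra.
case: b => /=; last by apply/andP/andP => -[]; split; lra.
by apply/esym/negbTE/negP => /andP[]; lra.
Qed.

Definition bit_le : rel (seq bool) := all2 (fun a b => a ==> b).

Lemma bit_le_size s t : bit_le s t -> size s = size t.
Proof. by rewrite /bit_le all2E => /andP[/eqP]. Qed.

Lemma bit_le_refl s : bit_le s s.
Proof. by elim: s => [//|b s IH] /=; rewrite implybb. Qed.

(** Only the first bit where the two differ matters: there [s] has 0 and [t] has 1, and later digits
    cannot make up for it. *)
Lemma binval_bit_lt s t : bit_le s t -> s != t ->
  binval s + 2^-1 ^+ size s <= binval t.
Proof.
elim: s t => [|a s IH] [|b t]//= /andP[ab st].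
rewrite eqseq_cons negb_and exprS => /orP[|st'].
  move: a b ab => [] [] //= _ _.
  by have := binval_le s; have := binval_ge0 t; lra.
by have := IH _ st st'; move: a b ab => [] [] //= _; lra.
Qed.

End Digits.

Section UpSets.
Context {R : realType}.
Implicit Types (a b h u x y z : R) (B D : set R) (s t : seq bool) (m : nat).
Notation gamma := (normal_prob (0 : R) 1).
Notation pr B := (fine (gamma B)).
Notation pdf := (normal_pdf (0 : R) 1).
Notation peak := (normal_peak (1 : R)).
Notation Phi := gaussian_cdf.

Definition up_set B := forall x y, B x -> x <= y -> B y.

Definition gcode m (z : R) : seq bool := digits m (Phi z).
Notation cell m s := (gcode m @^-1` [set s]).

Lemma size_gcode m z : size (gcode m z) = m.
Proof. exact: size_digits. Qed.

Lemma gcodeP m s z : size s = m ->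
  (gcode m z = s) <-> (binval s <= Phi z < binval s + 2^-1 ^+ m).
Proof.
move=> sm; rewrite -(digitsP m) ?(ltW (gaussian_cdf_gt0 z)) ?gaussian_cdf_lt1//.
by split=> /eqP.
Qed.

Lemma cellE m s : size s = m ->
  cell m s = [set z | binval s <= Phi z < binval s + 2^-1 ^+ m].
Proof. by move=> sm; apply/seteqP; split => z /=; rewrite gcodeP. Qed.

Lemma cell_prob m s : size s = m ->
  measurable (cell m s) /\ pr (cell m s) = 2^-1 ^+ m.
Proof.
move=> sm; rewrite cellE//.
have p0 : 0 < 2^-1 ^+ m :> R by rewrite exprn_gt0// invr_gt0.
have := binval_le (R := R) s; rewrite sm => v1.
have vl : binval s <= binval s + 2^-1 ^+ m :> R by rewrite lerDl ltW.
have [mC ->] := gaussian_cdf_itv _ _ (binval_ge0 s) vl v1.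
by split=> //; rewrite addrAC subrr add0r.
Qed.

Lemma measurable_cell m s : measurable (cell m s).
Proof.
have [sm|sm] := eqVneq (size s) m; first exact: (cell_prob m s sm).1.
rewrite (_ : _ @^-1` _ = set0)//; rewrite -subset0 => z /= zs.
by move: sm; rewrite -zs size_gcode eqxx.
Qed.

(** For distinct codes the cell of [t] lies wholly to the right of the cell of [s]. As soon as [B]
    meets the latter it contains the former, and all cells have the same mass. *)
Lemma up_set_cell_le m s t B : measurable B -> up_set B -> bit_le s t -> size s = m ->
  pr (B `&` cell m s) <= pr (B `&` cell m t).
Proof.
move=> mB uB st sm; have tm : size t = m by rewrite -(bit_le_size _ _ st).
have [->//|snt] := eqVneq s t.
have lt z z' : cell m s z -> cell m t z' -> z <= z'.
  rewrite !cellE//= => /andP[_ h1] /andP[h2 _].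
  rewrite -gaussian_cdf_leE; apply: ltW; apply: lt_le_trans h1 _.
  by apply: le_trans h2; rewrite -sm binval_bit_lt.
have [E|/set0P[z [Bz cz]]] := eqVneq (B `&` cell m s) set0.
  by rewrite E measure0 fine_prob_ge0.
apply: (@le_trans _ _ (2^-1 ^+ m)).
  rewrite -(cell_prob m s sm).2; apply: fine_prob_le => //.
  - by apply: measurableI => //; exact: measurable_cell.
  - exact: measurable_cell.
rewrite -(cell_prob m t tm).2; apply: fine_prob_le => //.
- exact: measurable_cell.
- by apply: measurableI => //; exact: measurable_cell.
- by move=> z' cz'; split => //; apply: uB Bz (lt _ _ cz cz').
Qed.

Definition gpsi m z : R := bit_sum (gcode m z).

Lemma integrable_gpsi m D : measurable D -> gamma.-integrable D (EFin \o gpsi m).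
Proof.
move=> mD; apply: (integrable_code (normal_prob 0 1) (gcode m) m) => //.
- by move=> s; exact: measurable_cell.
- exact: size_gcode.
Qed.

Lemma gaussian_gcode m (F : seq bool -> R) :
  \int[gamma]_x F (gcode m x) = cube_mean m F.
Proof.
rewrite (Rintegral_code (normal_prob 0 1) (gcode m) m)//; last 2 first.
- by move=> s; exact: measurable_cell.
- exact: size_gcode.
rewrite cube_meanE mulr_sumr big_seq [RHS]big_seq; apply: eq_bigr => s.
by rewrite mem_cube => /eqP sm; rewrite setTI (cell_prob m s sm).2 mulrC.
Qed.

(* Level-1 inequality: tilting by exp(a psi) and using the tangent line of exp
   at the optimal height bounds the mean of psi over a set of given mass. *)
Lemma gpsi_level1 m D b (v : R) : (0 < m)%N -> measurable D -> 0 <= b ->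
  pdf (b + 1) <= pr D -> v ^+ 2 = 1 ->
  v * \int[gamma]_(z in D) gpsi m z <=
    2 * (1 + peak^-1) * (b + 1) * Num.sqrt m%:R * pr D.
Proof.
move=> m0 mD b0 hD v1.
set k := peak^-1.
have k0 : 0 < k by rewrite invr_gt0 normal_peak_gt0// oner_neq0.
have sm0 : 0 < Num.sqrt m%:R :> R by rewrite sqrtr_gt0 ltr0n.
(* Chosen so that the exponential moment bound exp(2 a^2 m) equals exp((b + 1)^2 / 2), the inverse
   of the Gaussian factor in [pdf (b + 1)]. *)
set a := v * ((b + 1) / (2 * Num.sqrt m%:R)).
(* Height at which the tangent to exp is taken. Since exp(k) >= k = 1/peak, exp(c) [pdf (b + 1)] is
   at least exp((b + 1)^2 / 2), so the tilted integral over D is at most exp(c) times the mass of D.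
   The tangent then gives a times the integral of psi at most c times that mass. *)
set c := (b + 1) ^+ 2 + k.
have mc s : measurable (cell m s) by exact: measurable_cell.
have iF F B : measurable B -> gamma.-integrable B (EFin \o (fun z => F (gcode m z))).
  by move=> mB; apply: (integrable_code (normal_prob 0 1) (gcode m) m) => //; exact: size_gcode.
have ek : expR (- k) <= peak.
  rewrite expRN -[leRHS]invrK lef_pV2 ?posrE ?expR_gt0//.
  by apply: le_trans (expR_ge1Dx k); rewrite lerDr.
have upper : \int[gamma]_(z in D) expR (a * gpsi m z) <= expR ((b + 1) ^+ 2 / 2).
  apply: (@le_trans _ _ (\int[gamma]_z expR (a * gpsi m z))).
    rewrite Rintegral_mkcond; apply: le_Rintegral => //.
    - rewrite -restrict_EFin.
      apply: (proj1 (@integrable_mkcond _ _ _ gamma D (EFin \o (fun z => expR (a * gpsi m z))) mD)).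
      exact: (iF (fun s => expR (a * bit_sum s))).
    - exact: (iF (fun s => expR (a * bit_sum s)) setT).
    - by move=> x _; rewrite patchE; case: ifP => // _; exact: expR_ge0.
  rewrite (gaussian_gcode m (fun s => expR (a * bit_sum s))).
  apply: le_trans (cube_mean_exp_bit_sum m a) _.
  rewrite ler_expR /a exprMn v1 mul1r expr_div_n exprMn sqr_sqrtr//.
  have mR : (m%:R : R) != 0 by rewrite pnatr_eq0 -lt0n.
  by rewrite le_eqVlt; apply/orP; left; apply/eqP; field.
have lower : expR c * ((1 - c) * pr D + a * \int[gamma]_(z in D) gpsi m z) <=
    \int[gamma]_(z in D) expR (a * gpsi m z).
  have -> : expR c * ((1 - c) * pr D + a * \int[gamma]_(z in D) gpsi m z) =
      \int[gamma]_(z in D) (expR c * ((1 - c) + a * gpsi m z)).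
    rewrite RintegralZl//; last first.
      by apply: (iF (fun s => (1 - c) + a * bit_sum s)).
    rewrite RintegralD//; last 2 first.
    - exact: (iF (fun=> 1 - c)).
    - exact: (iF (fun s => a * bit_sum s)).
    rewrite Rintegral_cst// RintegralZl//; exact: integrable_gpsi.
  apply: le_Rintegral => //.
  - exact: (iF (fun s => expR c * ((1 - c) + a * bit_sum s))).
  - exact: (iF (fun s => expR (a * bit_sum s))).
  - move=> z _; rewrite -[a * _ in leRHS](subrK c) [leRHS]expRD [leLHS]mulrC.
    rewrite ler_pM2r ?expR_gt0//.
    by apply: le_trans (expR_ge1Dx _); rewrite le_eqVlt; apply/orP; left; apply/eqP; ring.
have main : a * \int[gamma]_(z in D) gpsi m z <= c * pr D.
  have : (1 - c) * pr D + a * \int[gamma]_(z in D) gpsi m z <= pr D.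
    apply: le_trans hD; rewrite -(ler_pM2l (expR_gt0 c)).
    apply: le_trans lower _; apply: le_trans upper _.
    rewrite normal_pdf1E subr0 mulrCA -expRD.
    have -> : c + - (b + 1) ^+ 2 / 2 = k + (b + 1) ^+ 2 / 2 by rewrite /c; field.
    rewrite expRD mulrA ler_peMl ?expR_ge0//.
    by rewrite -(ler_pM2r (expR_gt0 (- k))) mul1r -mulrA -expRD subrr expR0 mulr1.
  set X := a * _; set Y := pr D; lra.
have b1 : 0 < b + 1 by lra.
have : v * \int[gamma]_(z in D) gpsi m z * ((b + 1) / (2 * Num.sqrt m%:R)) <= c * pr D.
  by move: main; rewrite /a mulrAC.
rewrite -ler_pdivlMr; last by rewrite divr_gt0// mulr_gt0.
move=> h; apply: le_trans h _.
have -> : c * pr D / ((b + 1) / (2 * Num.sqrt m%:R)) =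
    (c / (b + 1)) * (2 * Num.sqrt m%:R * pr D).
  by field; rewrite ?gt_eqF.
have -> : 2 * (1 + k) * (b + 1) * Num.sqrt m%:R * pr D =
    ((1 + k) * (b + 1)) * (2 * Num.sqrt m%:R * pr D) by ring.
apply: ler_wpM2r.
  by rewrite !mulr_ge0 ?fine_prob_ge0// ltW.
rewrite ler_pdivrMr// /c; nra.
Qed.

End UpSets.

(** Complements [binval_bit_lt] for codes that need not be comparable bit by bit; it serves to show
    that an up-set cuts at most one cell. *)
Lemma binval_separated {R : realFieldType} (s t : seq bool) : size s = size t -> s != t ->
  (binval s + 2^-1 ^+ size s <= binval t :> R) || (binval t + 2^-1 ^+ size t <= binval s :> R).
Proof.
elim: s t => [|a s IH] [|b t]//= [st].
have := @binval_le R s; have := @binval_le R t.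
have := @binval_ge0 R s; have := @binval_ge0 R t.
have := IH t st; rewrite st eqseq_cons negb_and !exprS.
case: a b => [] [] /= h t0 s0 t1 s1 ne; apply/orP.
- by case/orP: (h ne) => ?; [left|right]; lra.
- by right; lra.
- by left; lra.
- by case/orP: (h ne) => ?; [left|right]; lra.
Qed.

(** * Half-lines: digit sums and within-cell variance against the first moment *)

Section UpSetMoments.
Context {R : realType}.
Implicit Types (a b h u v x y z : R) (B D : set R) (s t : seq bool) (m : nat).
Notation gamma := (normal_prob (0 : R) 1).
Notation pr B := (fine (gamma B)).
Notation pdf := (normal_pdf (0 : R) 1).
Notation peak := (normal_peak (1 : R)).
Notation Phi := gaussian_cdf.
Notation cell m s := (gcode m @^-1` [set s]).

Lemma integrable_gaussian_scale v D : measurable D ->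
  gamma.-integrable D (EFin \o (fun z => v * z)).
Proof.
move=> mD; rewrite (_ : _ \o _ = fun z => v%:E * z%:E)%E; last first.
  by apply/funext => x; rewrite /= EFinM.
by apply: integrableZl => //; exact: integrable_gaussian_idS.
Qed.

Lemma gaussian_mean0 : \int[gamma]_z z = 0.
Proof.
have i1 := @integrable_gaussian_id R.
rewrite /Rintegral integralE.
have mp : measurable_fun [set: R] (EFin \o (@id R))^\+%E.
  by apply: measurable_funepos; exact/measurable_EFinP.
have p0 x : (0 <= (EFin \o (@id R))^\+ x)%E by exact: funepos_ge0.
have E : (\int[gamma]_x (EFin \o (@id R))^\+ x = \int[gamma]_x (EFin \o (@id R))^\- x)%E.
  apply: etrans (ge0_integral_gaussian_opp _ mp p0) _.
  apply: eq_integral => x _; by rewrite funeposE funenegE.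
rewrite -[X in fine X]/(\int[gamma]_x (EFin \o (@id R))^\+ x - \int[gamma]_x (EFin \o (@id R))^\- x)%E E subee//.
exact: integrable_neg_fin_num.
Qed.

Lemma Rintegral_gaussian_nonneg_sub D (E : set R) v :
  measurable D -> measurable E -> E `<=` D -> (forall z, D z -> 0 <= v * z) ->
  \int[gamma]_(z in E) (v * z) <= \int[gamma]_(z in D) (v * z).
Proof.
move=> mD mE ED D0.
have ind : gamma.-integrable D (EFin \o (fun z => v * z)) by exact: integrable_gaussian_scale.
have ine : gamma.-integrable E (EFin \o (fun z => v * z)) by exact: integrable_gaussian_scale.
rewrite /Rintegral fine_le//; try exact: integrable_fin_num.
apply: ge0_subset_integral => //; first exact: (measurable_int gamma ind).
Qed.

(** The sign [v] covers both directions, and it is left open whether the end point belongs to [D].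
    The last bound integrates over the window y < v z < y + 1 only; its free [y] is what helps when
    b is small and b times the mass says little. *)
Lemma half_line_moment D b v : measurable D -> 0 <= b -> v ^+ 2 = 1 ->
  (forall z, b < v * z -> D z) -> (forall z, D z -> b <= v * z) ->
  [/\ pdf (b + 1) <= pr D, b * pr D <= \int[gamma]_(z in D) (v * z) &
    forall y, b <= y -> y * pdf (y + 1) <= \int[gamma]_(z in D) (v * z)].
Proof.
move=> mD b0 v1 bD Db.
pose I y : set R := [set z | y < v * z < y + 1].
have IE y : I y = if 0 < v then `]y, (y + 1)[%classic else `](- (y + 1)), (- y)[%classic.
  have : v = 1 \/ v = -1.
    by have /eqP := v1; rewrite sqrf_eq1 => /orP[/eqP|/eqP]; [left|right].
  rewrite /I; case=> ->; rewrite ?ltr01 ?ltr0N1 ?oppr_gt0 ?ltr10; apply/seteqP; split => z /=;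
    rewrite in_itv/= ?mul1r ?mulN1r// => /andP[? ?]; apply/andP; split; lra.
have mI y : measurable (I y) by rewrite IE; case: ifP.
have pI y : 0 <= y -> pdf (y + 1) <= pr (I y).
  move=> y0; rewrite IE; case: ifP => _.
    have h : (y + 1 - y) * pdf (y + 1) <= pr `]y, (y + 1)[%classic.
      by apply: gaussian_itv_ge; rewrite ?lerDl// ger0_norm; lra.
    by move: h; rewrite (_ : y + 1 - y = 1) ?mul1r//; ring.
  have h : (- y - - (y + 1)) * pdf (y + 1) <= pr `](- (y + 1)), (- y)[%classic.
    by apply: gaussian_itv_ge; rewrite ?normrN ?lerN2 ?lerDl// ger0_norm; lra.
  by move: h; rewrite (_ : - y - - (y + 1) = 1) ?mul1r//; ring.
have ID y : b <= y -> I y `<=` D by move=> yb z /andP[yz _]; apply: bD; exact: le_lt_trans yz.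
have Dpos z : D z -> 0 <= v * z by move=> /Db; exact: le_trans.
split.
- apply: le_trans (pI _ b0) _; apply: fine_prob_le; [exact: mI|exact: mD|exact: (ID b (lexx b))].
- rewrite -Rintegral_cst//; apply: le_Rintegral => //.
  + exact: finite_measure_integrable_cst.
  + exact: integrable_gaussian_scale.
- move=> y yb.
  apply: le_trans (Rintegral_gaussian_nonneg_sub D (I y) v mD (mI y) (ID y yb) Dpos).
  apply: (@le_trans _ _ (y * pr (I y))).
    by rewrite ler_wpM2l ?pI//; lra.
  have mIy := mI y.
  rewrite -(Rintegral_cst gamma mIy); apply: le_Rintegral => //.
  + exact: finite_measure_integrable_cst.
  + exact: integrable_gaussian_scale.
  + by move=> z /andP[/ltW].
Qed.

Lemma Rintegral_setC B (f : R -> R) : measurable B ->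
  gamma.-integrable [set: R] (EFin \o f) ->
  \int[gamma]_(z in ~` B) f z = \int[gamma]_z f z - \int[gamma]_(z in B) f z.
Proof.
move=> mB fi; have mC := measurableC mB.
have := @Rintegral_setU _ _ _ gamma B (~` B) f mB mC.
rewrite setUv => /(_ fi); rewrite disj_set2E setICr eqxx => /(_ isT) ->.
by rewrite addrAC subrr add0r.
Qed.

(* A proper up-set is a half-line.  Depending on the sign of its end point, work
   with [B] or its complement, whichever has mass at most 1/2. *)
Lemma up_set_split B : measurable B -> up_set B -> B <> set0 -> B <> setT ->
  exists D b v, [/\ (D = B /\ v = 1) \/ (D = ~` B /\ v = -1), 0 <= b,
    pdf (b + 1) <= pr D, b * pr D <= \int[gamma]_(z in B) z &
    forall y, b <= y -> y * pdf (y + 1) <= \int[gamma]_(z in B) z].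
Proof.
move=> mB uB /eqP/set0P[x0 Bx0] BT.
have [y0 By0] : exists y, ~ B y.
  by apply: contrapT => /forallNP h; apply: BT; rewrite -subTset => y _; apply: contrapT (h y).
have lbB : lbound B y0.
  by move=> x Bx; rewrite leNgt; apply/negP => /ltW xy; apply: By0; apply: uB xy.
have hB : has_inf B by split; [exists x0|exists y0].
set q := inf B.
have qB z : q < z -> B z.
  by move=> qz; have [x Bx xz] := inf_lt hB.1 qz; apply: uB (ltW xz).
have Bq z : B z -> q <= z by move=> Bz; apply: ge_inf => //; exists y0.
have [q0|q0] := leP 0 q.
  exists B, q, 1.
  have EB : \int[gamma]_(z in B) z = \int[gamma]_(z in B) (1 * z).
    by apply: eq_Rintegral => z _; rewrite mul1r.
  have [|||h1 h2 h3] := half_line_moment B q 1 mB q0.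
  - by rewrite expr1n.
  - by move=> z; rewrite mul1r; exact: qB.
  - by move=> z; rewrite mul1r; exact: Bq.
  by split; rewrite ?EB//; left.
exists (~` B), (- q), (-1).
(* The Gaussian mean is 0, so the integrals of z over [B] and its complement are opposite. *)
have EB : \int[gamma]_(z in B) z = \int[gamma]_(z in ~` B) (-1 * z).
  rewrite RintegralZl//; [|exact: measurableC|by apply: integrable_gaussian_idS; exact: measurableC].
  by rewrite Rintegral_setC ?gaussian_mean0 ?mulN1r ?sub0r ?opprK//; exact: integrable_gaussian_id.
have [|||||h1 h2 h3] := half_line_moment (~` B) (- q) (-1).
- exact: measurableC.
- by lra.
- by rewrite sqrrN expr1n.
- by move=> z zq Bz; have := Bq _ Bz; lra.
- by move=> z; apply: contra_notP => /negP; rewrite -ltNge => zq; apply: qB; lra.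
by split; rewrite ?EB//; [right|lra].
Qed.

(** [gpsi_level1] leaves (b + 1) times the mass of the tail D to be bounded by the first moment G.
    For b >= 1 this is b [pr D] <= G up to a factor 2; for b < 1 the window at y = 1 shows that G is
    at least [pdf 2]. *)
Lemma up_set_gpsi : exists2 C, 0 < C & forall m B, (0 < m)%N -> measurable B -> up_set B ->
  \int[gamma]_(z in B) gpsi m z <= C * Num.sqrt m%:R * \int[gamma]_(z in B) z.
Proof.
have k0 : 0 < peak^-1 by rewrite invr_gt0 normal_peak_gt0// oner_neq0.
have p0 := @pdf_gt0 R 2.
exists (4 * (1 + peak^-1) * (1 + (pdf 2)^-1)).
  by rewrite !mulr_gt0// ?ltr_pwDl// ltW// ?invr_gt0.
move=> m B m0 mB uB; set C1 := 4 * (1 + peak^-1).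
have C10 : 0 < C1 by rewrite /C1; lra.
have psi0 : \int[gamma]_z gpsi m z = 0.
  by rewrite (gaussian_gcode m bit_sum) cube_mean_bit_sum.
have [->|Bn0] := eqVneq B set0; first by rewrite !Rintegral_set0 mulr0.
have [->|BnT] := eqVneq B setT; first by rewrite psi0 gaussian_mean0 mulr0.
have [D [b [v [DE b0 hD hG hy]]]] := up_set_split B mB uB (elimN eqP Bn0) (elimN eqP BnT).
set G := \int[gamma]_(z in B) z in hG hy *.
have mD : measurable D by case: DE => -[-> _]//; exact: measurableC.
have v1 : v ^+ 2 = 1 by case: DE => -[_ ->]; rewrite ?sqrrN expr1n.
have -> : \int[gamma]_(z in B) gpsi m z = v * \int[gamma]_(z in D) gpsi m z.
  case: DE => -[-> ->]; first by rewrite mul1r.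
  by rewrite Rintegral_setC ?psi0 ?mulN1r ?sub0r ?opprK//; exact: integrable_gpsi.
apply: le_trans (gpsi_level1 m D b v m0 mD b0 hD v1) _.
have s0 : 0 <= Num.sqrt m%:R :> R by exact: sqrtr_ge0.
have D0 : 0 <= pr D := fine_prob_ge0 (normal_prob 0 1) D.
have D1 : pr D <= 1 := fine_prob_le1 (normal_prob 0 1) D mD.
have : (b + 1) * pr D <= 2 * (1 + (pdf 2)^-1) * G.
  have [b1|b1] := leP 1 b.
    have : (b + 1) * pr D <= 2 * (b * pr D) by rewrite mulrA; apply: ler_wpM2r => //; lra.
    have G0 : 0 <= G by apply: le_trans hG; rewrite mulr_ge0.
    have : 0 <= (pdf 2)^-1 * G by rewrite mulr_ge0// ltW// invr_gt0.
    nra.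
  have := hy 1 (ltW b1); rewrite mul1r (_ : 1 + 1 = 2)// => hG2.
  have : 1 <= (pdf 2)^-1 * G by rewrite mulrC ler_pdivlMr// mul1r.
  nra.
move=> h; rewrite -(ler_pM2l C10) in h.
apply: (@le_trans _ _ (Num.sqrt m%:R * 2^-1 * (C1 * ((b + 1) * pr D)))).
  by rewrite le_eqVlt; apply/orP; left; apply/eqP; rewrite /C1; field; rewrite gt_eqF// normal_peak_gt0 ?oner_neq0.
apply: le_trans (ler_wpM2l _ h) _; first by rewrite mulr_ge0.
by rewrite le_eqVlt; apply/orP; left; apply/eqP; rewrite /C1; field; rewrite ?gt_eqF// normal_peak_gt0 ?oner_neq0.
Qed.

Lemma expr_half_le m : 2^-1 ^+ m <= expR (- (m%:R / 16)) :> R.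
Proof.
have h : 2^-1 <= expR (- 16^-1) :> R by apply: le_trans (expR_ge1Dx _); lra.
have -> : - (m%:R / 16) = m%:R * - 16^-1 :> R by ring.
by rewrite expRM_natl; apply: lerXn2r => //; rewrite nnegrE ?invr_ge0 ?expR_ge0.
Qed.

(* Within the cell [s] of mass [2^-m], [p (1 - 2^m p)] is the within-cell variance. *)
Definition cell_var (m : nat) (p : R) : R := p * (1 - 2 ^+ m * p).

(** The sum V is at most the mass of the tail D and also at most the mass 2^-m of a single cell, as
    only one cell is cut. For b >= sqrt m / 4 the first bound is used with b [pr D] <= G; for
    smaller b the second one, against the window at y = sqrt m / 4. *)
Lemma up_set_cell_var : exists2 K, 0 < K & forall m B, (0 < m)%N -> measurable B -> up_set B ->
  \sum_(s <- cube m) cell_var m (pr (B `&` cell m s)) <=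
  K / Num.sqrt m%:R * \int[gamma]_(z in B) z.
Proof.
have pk0 : 0 < peak by rewrite normal_peak_gt0// oner_neq0.
have K0 : 0 < 4 * (1 + expR 1 / peak).
  by rewrite mulr_gt0// ltr_pwDl// divr_ge0 ?expR_ge0// ltW.
exists (4 * (1 + expR 1 / peak)) => // m B m0 mB uB.
have two0 : 0 < 2 ^+ m :> R by rewrite exprn_gt0.
have two1 : 2 ^+ m * 2^-1 ^+ m = 1 :> R by rewrite -exprMn divff// expr1n.
have mBc s : measurable (B `&` cell m s) by apply: measurableI => //; exact: measurable_cell.
have mC s : measurable (cell m s : set R) by exact: measurable_cell.
have szm (z : R) : size (gcode m z) = m by exact: size_gcode.
have ple s : size s = m -> 0 <= pr (B `&` cell m s) <= 2^-1 ^+ m.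
  move=> sm; rewrite fine_prob_ge0/= -(cell_prob m s sm).2.
  by apply: fine_prob_le; [exact: mBc|exact: mC|exact: subIsetr].
have [->|Bn0] := eqVneq B set0.
  rewrite Rintegral_set0 mulr0 big1// => s _.
  by rewrite set0I measure0 /cell_var mul0r.
have [->|BnT] := eqVneq B setT.
  rewrite gaussian_mean0 mulr0 big_seq big1// => s; rewrite mem_cube => /eqP sm.
  by rewrite setTI (cell_prob m s sm).2 /cell_var two1 subrr mulr0.
have [D [b [v [DE b0 hD hG hy]]]] := up_set_split B mB uB (elimN eqP Bn0) (elimN eqP BnT).
set G := \int[gamma]_(z in B) z in hG hy *.
set V := \sum_(s <- _) _.
(* [cell_var m] is unchanged under p -> 2^-m - p, so V may be computed from the complement when D is
   the complement. *)
have VD : V <= pr D.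
  case: DE => -[-> _].
    rewrite (sum_code (normal_prob 0 1) (gcode m) m mC szm _ mB) /V big_seq [leRHS]big_seq.
    apply: ler_sum => s; rewrite mem_cube => /eqP sm.
    have /andP[p1 p2] := ple s sm; rewrite /cell_var ler_piMr// gerBl mulr_ge0//.
  rewrite (sum_code (normal_prob 0 1) (gcode m) m mC szm _ (measurableC mB)) /V big_seq [leRHS]big_seq.
  apply: ler_sum => s; rewrite mem_cube => /eqP sm.
  have /andP[p1 p2] := ple s sm.
  have -> : pr (~` B `&` cell m s) = 2^-1 ^+ m - pr (B `&` cell m s).
    have mNBc : measurable (~` B `&` cell m s) by apply: measurableI => //; exact: measurableC.
    rewrite -(cell_prob m s sm).2.
    have dis : [disjoint B `&` cell m s & ~` B `&` cell m s].
      by rewrite disj_set2E setIACA setICr set0I eqxx.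
    have := fine_probU (normal_prob 0 1) _ _ (mBc s) mNBc dis.
    by rewrite -setIUl setUv setTI => ->; rewrite addrAC subrr add0r.
  have h1 : 2 ^+ m * pr (B `&` cell m s) <= 1.
    by apply: le_trans (ler_wpM2l (ltW two0) p2) _; rewrite two1.
  have h2 : 1 - 2 ^+ m * pr (B `&` cell m s) = 2 ^+ m * (2^-1 ^+ m - pr (B `&` cell m s)).
    by rewrite mulrBr two1.
  by rewrite /cell_var h2 mulrA ler_piMl ?subr_ge0// mulrC.
have V2 : V <= 2^-1 ^+ m.
  have term s : size s = m -> cell_var m (pr (B `&` cell m s)) <= 2^-1 ^+ m.
    move=> sm; have /andP[p1 p2] := ple s sm; apply: le_trans p2.
    by rewrite /cell_var ler_piMr// gerBl mulr_ge0// ltW.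
  (* A cell with nonzero variance contains a point of [B] and a point outside. Two such cells are
     impossible: the point of [B] in the left one would lie below the outside point in the right
     one. *)
  have [[s [sm sn0]]|none] := pselect (exists s, size s = m /\ cell_var m (pr (B `&` cell m s)) != 0).
    rewrite /V (bigD1_seq s) ?cube_uniq ?mem_cube ?sm//= big_seq_cond big1 ?addr0 ?term//.
    move=> t /andP[]; rewrite mem_cube => /eqP tm ts; apply/eqP; apply: contraT => tn0.
    have inside w : size w = m -> cell_var m (pr (B `&` cell m w)) != 0 ->
        (exists2 z, B z & gcode m z = w) /\ (exists2 z, ~ B z & gcode m z = w).
      move=> wm wn0; split; apply: contrapT => no.
        move: wn0; rewrite (_ : B `&` _ = set0) ?measure0 /cell_var ?mul0r ?eqxx//.
        by rewrite -subset0 => z [Bz zw]; apply: no; exists z.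
      move: wn0; rewrite (_ : B `&` _ = cell m w) ?(cell_prob m w wm).2 /cell_var ?two1 ?subrr ?mulr0 ?eqxx//.
      by apply: setIidr => z zw; apply: contrapT => nB; apply: no; exists z.
    have [[z1 B1 c1] [z2 B2 c2]] := inside s sm sn0.
    have [[z3 B3 c3] [z4 B4 c4]] := inside t tm tn0.
    have [h|h] := leP (Phi z1) (Phi z4); first by exfalso; apply: B4; apply: uB B1 _; rewrite -gaussian_cdf_leE.
    have [h'|h'] := leP (Phi z3) (Phi z2); first by exfalso; apply: B2; apply: uB B3 _; rewrite -gaussian_cdf_leE.
    move: c1 c2 c3 c4; rewrite !gcodeP// => /andP[a1 a2] /andP[a3 a4] /andP[a5 a6] /andP[a7 a8].
    have := @binval_separated R t s; rewrite tm sm => /(_ erefl ts) /orP[]; lra.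
  rewrite /V big_seq big1 ?exprn_ge0// => s; rewrite mem_cube => /eqP sm.
  by apply/eqP; apply: contraT => n0; exfalso; apply: none; exists s.
set r := Num.sqrt m%:R.
have r0 : 0 < r by rewrite sqrtr_gt0 ltr0n.
have r2 : r ^+ 2 = m%:R by rewrite sqr_sqrtr.
rewrite mulrAC ler_pdivlMr//.
have e0 : 0 < expR 1 / peak by rewrite divr_gt0// expR_gt0.
have [hb|hb] := leP (r / 4) b.
  have G0 : 0 <= G by apply: le_trans hG; rewrite mulr_ge0// fine_prob_ge0.
  have : V * r <= 4 * (b * pr D).
    apply: (@le_trans _ _ (pr D * r)); first by rewrite ler_wpM2r// ltW.
    have D0 : 0 <= pr D := fine_prob_ge0 (normal_prob 0 1) D.
    nra.
  nra.
have := hy (r / 4) (ltW hb); rewrite normal_pdf1E subr0 => h.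
(* With m = r^2 and the rate 1/16 of [expr_half_le], comparing exponents gives exactly (r - 4)^2 >=
   0. This explains the threshold r / 4 and the factor [expR 1] in the constant. *)
have h2 : 2^-1 ^+ m <= expR 1 * expR (- (r / 4 + 1) ^+ 2 / 2).
  rewrite -expRD; apply: le_trans (expr_half_le m) _; rewrite ler_expR -r2.
  by have := sqr_ge0 (r - 4); lra.
have G0 : 0 <= G by apply: le_trans h; rewrite !mulr_ge0 ?expR_ge0 ?ltW// divr_gt0.
set e := expR (- _ / 2) in h h2.
have h3 : V * r <= 4 * (expR 1 / peak * (r / 4 * (peak * e))).
  apply: (@le_trans _ _ (expR 1 * e * r)).
    by rewrite ler_pM2r//; exact: le_trans V2 h2.
  by rewrite le_eqVlt; apply/orP; left; apply/eqP; field; rewrite gt_eqF.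
apply: le_trans h3 _.
rewrite -[leRHS]mulrA ler_pM2l// mulrDl mul1r.
apply: (@le_trans _ _ (expR 1 / peak * G)); first by rewrite ler_pM2l.
by rewrite lerDr.
Qed.

End UpSetMoments.

Definition tcons {T : Type} {n} (z : T) (o : n.-tuple T) : n.+1.-tuple T := [tuple of z :: o].

Definition slice1 {T : Type} {n} (A : set (n.+1.-tuple T)) (z : T) : set (n.-tuple T) :=
  [set o | A (tcons z o)].

Definition slice2 {T : Type} {n} (A : set (n.+1.-tuple T)) (o : n.-tuple T) : set T :=
  [set z | A (tcons z o)].

Lemma tnth_tcons0 {T : Type} n (z : T) (o : n.-tuple T) : tnth (tcons z o) ord0 = z.
Proof. by []. Qed.

Lemma tnth_tconsS {T : Type} n (z : T) (o : n.-tuple T) i :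
  tnth (tcons z o) (lift ord0 i) = tnth o i.
Proof. exact: tnthS. Qed.

Lemma tcons_surj {T : Type} n (x : n.+1.-tuple T) : exists z y, x = tcons z y.
Proof. by exists (thead x), [tuple of behead x]; exact: tuple_eta. Qed.

(** * Tensorisation *)

Section Slices.
Context {d} {T : measurableType d} {R : realType} (P : probability T R).
Local Open Scope ereal_scope.

Lemma measurable_slice1 n (A : set (n.+1.-tuple T)) z :
  measurable A -> measurable (slice1 A z).
Proof.
move=> mA; rewrite -[X in measurable X]setTI.
have h : measurable_fun [set: n.-tuple T] (fun o => tcons z o).
  by apply: measurable_cons => //; exact: measurable_id.
exact: h.
Qed.

Lemma measurable_slice2 n (A : set (n.+1.-tuple T)) o :
  measurable A -> measurable (slice2 A o).
Proof.
move=> mA; rewrite -[X in measurable X]setTI.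
have h : measurable_fun [set: T] (fun z => tcons z o).
  by apply: measurable_cons => //; exact: measurable_id.
exact: h.
Qed.

Section Tonelli.
Variables (n : nat) (A : set (n.+1.-tuple T)) (F : n.+1.-tuple T -> \bar R).
Hypotheses (mA : measurable A) (mF : measurable_fun [set: n.+1.-tuple T] F).
Hypothesis F0 : forall x, 0 <= F x.

Let mFA : measurable_fun [set: n.+1.-tuple T] (F \_ A).
Proof. exact/(measurable_restrictT _ mA)/measurable_funTS. Qed.

Let FA0 x : 0 <= (F \_ A) x.
Proof. by rewrite patchE; case: ifP. Qed.

Let mFc : measurable_fun setT ((F \_ A) \o @tuple_cons _ T n).
Proof. by apply: measurableT_comp mFA _; exact: measurable_tuple_cons. Qed.

Lemma integral_slice1 :
  \int[power_prob P n.+1]_(x in A) F x =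
  \int[P]_z \int[power_prob P n]_(o in slice1 A z) F (tcons z o).
Proof.
rewrite integral_mkcond power_tonelli1//.
by apply: eq_integral => z _; rewrite [RHS]integral_mkcond; apply: eq_integral.
Qed.

Lemma integral_slice2 :
  \int[power_prob P n.+1]_(x in A) F x =
  \int[power_prob P n]_o \int[P]_(z in slice2 A o) F (tcons z o).
Proof.
rewrite integral_mkcond power_tonelli2//.
by apply: eq_integral => z _; rewrite [RHS]integral_mkcond; apply: eq_integral.
Qed.

Lemma measurable_integral_slice1 : measurable_fun [set: T]
  (fun z => \int[power_prob P n]_(o in slice1 A z) F (tcons z o)).
Proof.
have := measurable_fun_fubini_tonelli_F (m2 := power_prob P n) _ mFc (fun x => FA0 _).
apply: eq_measurable_fun => z _.
by rewrite /fubini_F [RHS]integral_mkcond; apply: eq_integral.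
Qed.

Lemma measurable_integral_slice2 : measurable_fun [set: n.-tuple T]
  (fun o => \int[P]_(z in slice2 A o) F (tcons z o)).
Proof.
have := measurable_fun_fubini_tonelli_G (m1 := P) _ mFc (fun x => FA0 _).
apply: eq_measurable_fun => z _.
by rewrite /fubini_G [RHS]integral_mkcond; apply: eq_integral.
Qed.

End Tonelli.

Lemma power_prob_slice1 n (A : set (n.+1.-tuple T)) : measurable A ->
  power_prob P n.+1 A = \int[P]_z power_prob P n (slice1 A z).
Proof.
move=> mA; have := integral_slice1 n A (cst 1) mA (measurable_cst _ ) (fun=> lee01).
rewrite integral_cst// mul1e => ->; apply: eq_integral => z _.
by rewrite integral_cst ?mul1e//; exact: measurable_slice1.
Qed.

Lemma power_prob_slice2 n (A : set (n.+1.-tuple T)) : measurable A ->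
  power_prob P n.+1 A = \int[power_prob P n]_o P (slice2 A o).
Proof.
move=> mA; have := integral_slice2 n A (cst 1) mA (measurable_cst _ ) (fun=> lee01).
rewrite integral_cst// mul1e => ->; apply: eq_integral => z _.
by rewrite integral_cst ?mul1e//; exact: measurable_slice2.
Qed.

Lemma measurable_power_prob_slice1 n (A : set (n.+1.-tuple T)) : measurable A ->
  measurable_fun [set: T] (fun z => power_prob P n (slice1 A z)).
Proof.
move=> mA.
have := measurable_integral_slice1 n A (cst 1) mA (measurable_cst _ ) (fun=> lee01).
apply: eq_measurable_fun => z _.
by rewrite integral_cst ?mul1e//; exact: measurable_slice1.
Qed.

Lemma measurable_prob_slice2 n (A : set (n.+1.-tuple T)) : measurable A ->
  measurable_fun [set: n.-tuple T] (fun o => P (slice2 A o)).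
Proof.
move=> mA.
have := measurable_integral_slice2 n A (cst 1) mA (measurable_cst _ ) (fun=> lee01).
apply: eq_measurable_fun => z _.
by rewrite integral_cst ?mul1e//; exact: measurable_slice2.
Qed.

Lemma measurable_coord n (i : 'I_n) (u : T -> \bar R) : measurable_fun [set: T] u ->
  measurable_fun [set: n.-tuple T] (fun x => u (tnth x i)).
Proof. by move=> mu; apply: measurableT_comp mu _; exact: measurable_tnth. Qed.

Lemma integral_coord n (i : 'I_n) (u : T -> \bar R) : measurable_fun [set: T] u ->
  (forall z, 0 <= u z) -> \int[power_prob P n]_x u (tnth x i) = \int[P]_z u z.
Proof.
move=> mu u0; elim: n i => [|n IH] i; first by case: i.
have mui := measurable_coord n.+1 i u mu.
have [j ij|->] := unliftP ord0 i.
  rewrite power_tonelli1// ij.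
  transitivity (\int[P]_z \int[power_prob P n]_y u (tnth y j)).
    by apply: eq_integral => z _; apply: eq_integral => y _; congr u; exact: tnthS.
  rewrite IH; apply: etrans (integral_cst P measurableT _) _.
  by rewrite [X in _ * X](_ : _ = 1) ?mule1//; exact: probability_setT.
rewrite power_tonelli2//; last exact: measurable_coord.
transitivity (\int[power_prob P n]_y \int[P]_z u z); first by [].
apply: etrans (integral_cst (power_prob P n) measurableT _) _.
by rewrite [X in _ * X](_ : _ = 1) ?mule1//; exact: probability_setT.
Qed.

End Slices.

Section MonotoneSlices.
Context {R : realType}.

Lemma monotone_slice1 n (A : set (n.+1.-tuple R)) z :
  monotone_increasing A -> monotone_increasing (slice1 A z).
Proof.
move=> monA x y Ax xy; apply: monA Ax _ => j.
have [i ->|->] := unliftP ord0 j; first by rewrite !tnth_tconsS.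
by rewrite !tnth_tcons0.
Qed.

Lemma up_set_slice2 n (A : set (n.+1.-tuple R)) o :
  monotone_increasing A -> up_set (slice2 A o).
Proof.
move=> monA x y Ax xy; apply: monA Ax _ => j.
have [i ->|->] := unliftP ord0 j; first by rewrite !tnth_tconsS.
by rewrite !tnth_tcons0.
Qed.

(** Fixing all coordinates but the i-th leaves an up-set of the line, to which the one-dimensional
    hypothesis applies; the induction peels off the coordinates before i. Taking [u] and [v]
    nonnegative keeps everything within Tonelli. *)
Lemma monotone_coord_le (P : probability (measurableTypeR R) R) (u v : R -> \bar R) :
  measurable_fun [set: R] u -> measurable_fun [set: R] v ->
  (forall z, 0 <= u z)%E -> (forall z, 0 <= v z)%E ->
  (forall B, measurable B -> up_set B -> \int[P]_(z in B) u z <= \int[P]_(z in B) v z)%E ->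
  forall n (i : 'I_n) (A : set (n.-tuple R)), measurable A -> monotone_increasing A ->
  (\int[power_prob P n]_(x in A) u (tnth x i) <=
   \int[power_prob P n]_(x in A) v (tnth x i))%E.
Proof.
move=> mu mv u0 v0 uv; elim=> [|n IH] i A mA monA; first by case: i.
have [j ij|i0] := unliftP ord0 i.
  rewrite !integral_slice1//; try exact: measurable_coord.
  apply: ge0_le_integral => //.
  - by move=> z _; exact: integral_ge0.
  - exact: (measurable_integral_slice1 P n A (fun x => u (tnth x i)) mA (measurable_coord _ i u mu) (fun=> u0 _)).
  - exact: (measurable_integral_slice1 P n A (fun x => v (tnth x i)) mA (measurable_coord _ i v mv) (fun=> v0 _)).
  - move=> z _; rewrite ij; under eq_integral do rewrite tnth_tconsS.
    under [leRHS]eq_integral do rewrite tnth_tconsS.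
    by apply: IH; [exact: measurable_slice1|exact: monotone_slice1].
rewrite !integral_slice2//; try exact: measurable_coord.
apply: ge0_le_integral => //.
- by move=> z _; exact: integral_ge0.
- exact: (measurable_integral_slice2 P n A (fun x => u (tnth x i)) mA (measurable_coord _ i u mu) (fun=> u0 _)).
- exact: (measurable_integral_slice2 P n A (fun x => v (tnth x i)) mA (measurable_coord _ i v mv) (fun=> v0 _)).
- move=> o _; rewrite i0.
  by apply: uv; [exact: measurable_slice2|exact: up_set_slice2].
Qed.

End MonotoneSlices.

Section CoordinateMoments.
Context {R : realType} (P : probability (measurableTypeR R) R).
Implicit Types (f : R -> R).

Lemma integrable_coord n (i : 'I_n) f (A : set (n.-tuple R)) : measurable A ->
  P.-integrable [set: R] (EFin \o f) ->
  (power_prob P n).-integrable A (EFin \o (fun x => f (tnth x i))).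
Proof.
move=> mA /integrableP[mf fi]; apply: (@integrableS _ _ _ (power_prob P n) setT A) => //.
apply/integrableP; split; first exact: (measurable_coord n i (EFin \o f) mf).
have mfa : measurable_fun [set: R] (fun z => `|(f z)%:E|%E) by exact: measurableT_comp.
by have := integral_coord P n i _ mfa (fun=> abse_ge0 _); rewrite /= => ->.
Qed.

(** The signed version: [monotone_coord_le] compares the negative part of [f] with its positive
    part. *)
Lemma monotone_coord_ge0 f : P.-integrable [set: R] (EFin \o f) ->
  (forall B, measurable B -> up_set B -> 0 <= \int[P]_(z in B) f z) ->
  forall n (i : 'I_n) (A : set (n.-tuple R)), measurable A -> monotone_increasing A ->
  0 <= \int[power_prob P n]_(x in A) f (tnth x i).
Proof.
move=> fi fB n i A mA monA.
have mf : measurable_fun [set: R] (EFin \o f) by case/integrableP : fi.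
have ineq := monotone_coord_le P ((EFin \o f)^\-)%E ((EFin \o f)^\+)%E
  (measurable_funeneg mf) (measurable_funepos mf) (funeneg_ge0 _) (funepos_ge0 _) _ n i A mA monA.
have fiA := integrable_coord n i f A mA fi.
rewrite /Rintegral integralE fine_ge0// sube_ge0; last first.
  by rewrite (@integrable_pos_fin_num _ _ _ (power_prob P n) A mA _ fiA) orbT.
rewrite (_ : (EFin \o _)^\-%E = fun x => ((EFin \o f)^\-)%E (tnth x i)); last first.
  by apply/funext => x; rewrite !funenegE.
rewrite (_ : (EFin \o _)^\+%E = fun x => ((EFin \o f)^\+)%E (tnth x i)); last first.
  by apply/funext => x; rewrite !funeposE.
apply: ineq => B mB uB.
have fiB : P.-integrable B (EFin \o f).
  exact: (@integrableS _ _ _ P setT B _ measurableT mB (@subsetT _ _) fi).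
have := fB B mB uB; rewrite /Rintegral integralE => h.
have pf := @integrable_pos_fin_num _ _ _ P B mB _ fiB.
have nf := @integrable_neg_fin_num _ _ _ P B mB _ fiB.
by move: h; rewrite -(fineK pf) -(fineK nf) -EFinB /= subr_ge0 lee_fin.
Qed.

End CoordinateMoments.

Lemma bit_diffE {R : rcfType} l (f : seq bool -> R) s : (l < size s)%N ->
  bit_diff l f s = (f (set_nth false s l true) - f (set_nth false s l false)) / 2.
Proof. by elim: l f s => [|l IH] f [|x s]//= ls; rewrite IH. Qed.

Lemma bit_le_set_nth s l : bit_le (set_nth false s l false) (set_nth false s l true).
Proof.
elim: s l => [|x s IH] [|l] //=.
- by elim: l => [//|l IHl] /=.
- exact: bit_le_refl.
- by rewrite implybb IH.
Qed.

Lemma bit_le_take k s t : bit_le s t -> bit_le (take k s) (take k t).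
Proof. by elim: k s t => [|k IH] [|a s] [|b t] //= /andP[-> /IH]. Qed.

Lemma bit_le_drop k s t : bit_le s t -> bit_le (drop k s) (drop k t).
Proof. by elim: k s t => [|k IH] [|a s] [|b t] //= /andP[_ /IH]. Qed.

Definition bit_sign {R : pzRingType} (b : bool) : R := if b then 1 else -1.

(** Both sides are the Fourier coefficient of the singleton {l}. For a monotone function the left
    side is the L^1 norm of the derivative, so influences become integrals of digit signs. *)
Lemma cube_mean_bit_diff {R : rcfType} N l (f : seq bool -> R) : (l < N)%N ->
  cube_mean N (bit_diff l f) = cube_mean N (fun s => bit_sign (nth false s l) * f s).
Proof.
elim: N l f => [//|N IH] [|l] f lN.
  rewrite [LHS]cube_mean_head [RHS]cube_mean_head; apply: eq_cube_mean => s _.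
  by rewrite /head_avg /= /head_diff /bit_sign; field.
by rewrite /= !IH.
Qed.

(** * Digit codes of a whole vector *)

Section Codes.
Context {R : realType} (m : nat).
Notation gamma := (normal_prob (0 : R) 1).
Notation gn n := (power_prob gamma n).
Notation cell s := (gcode m @^-1` [set s]).

Definition codes n (x : n.-tuple R) : seq bool := flatten [seq gcode m z | z <- x].
Notation box n s := (codes n @^-1` [set s]).

Lemma codes_cons n z (o : n.-tuple R) : codes n.+1 (tcons z o) = gcode m z ++ codes n o.
Proof. by []. Qed.

Lemma size_codes n (x : n.-tuple R) : size (codes n x) = (n * m)%N.
Proof.
elim: n x => [|n IH] x; first by rewrite tuple0.
have [z [y ->]] := tcons_surj n x; rewrite codes_cons size_cat size_gcode IH mulSn//.
Qed.

Lemma slice1_box n s z : slice1 (box n.+1 s) z =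
  if gcode m z == take m s then box n (drop m s) else set0.
Proof.
rewrite /slice1; case: eqP => [zs|zs]; apply/seteqP; split => o //=; rewrite codes_cons.
- by move=> <-; rewrite drop_size_cat// size_gcode.
- by move=> ->; rewrite zs cat_take_drop.
- by move=> E; apply: zs; rewrite -E take_size_cat// size_gcode.
Qed.

Lemma slice2_box n s o : slice2 (box n.+1 s) o =
  if codes n o == drop m s then cell (take m s) else set0.
Proof.
rewrite /slice2; case: eqP => [zs|zs]; apply/seteqP; split => z //=; rewrite codes_cons.
- by move=> <-; rewrite take_size_cat// size_gcode.
- by move=> ->; rewrite zs cat_take_drop.
- by move=> E; apply: zs; rewrite -E drop_size_cat// size_gcode.
Qed.

Lemma measurable_box n s : measurable (box n s).
Proof.
elim: n s => [|n IH] s.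
  have [->|s0] := eqVneq s [::].
    rewrite (_ : _ @^-1` _ = setT)//; rewrite -subTset => x _ /=; by rewrite tuple0.
  rewrite (_ : _ @^-1` _ = set0)//; rewrite -subset0 => x /=; rewrite tuple0 => xs.
  by move: s0; rewrite -xs.
rewrite (_ : _ @^-1` _ = ((@tnth _ R ^~ ord0) @^-1` cell (take m s)) `&`
   ((fun x : n.+1.-tuple R => [tuple of behead x]) @^-1` box n (drop m s))).
  apply: measurableI; rewrite -[X in measurable X]setTI.
    by apply: (@measurable_tnth _ R n.+1 ord0) => //; exact: measurable_cell.
  by apply: measurable_behead.
have bE z (o : n.-tuple R) : [tuple of behead (tcons z o)] = o by apply: val_inj.
apply/seteqP; split => x /=; have [z [y ->]] := tcons_surj n x;
  rewrite codes_cons bE.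
  by move=> <-; rewrite take_size_cat ?drop_size_cat// size_gcode.
by move=> [-> ->]; rewrite cat_take_drop.
Qed.

Lemma box_prob n s : size s = (n * m)%N -> fine (gn n (box n s)) = 2^-1 ^+ (n * m).
Proof.
move=> sn; apply: EFin_inj; rewrite fine_probK; last exact: measurable_box.
elim: n s sn => [|n IH] s sn.
  rewrite (_ : box _ _ = setT) ?probability_setT//.
  by rewrite -subTset => x _ /=; rewrite tuple0; apply/esym/size0nil.
have s1 : size (take m s) = m by rewrite size_takel// sn mulSn leq_addr.
have s2 : size (drop m s) = (n * m)%N by rewrite size_drop sn mulSn addKn.
rewrite power_prob_slice1; last exact: measurable_box.
transitivity (\int[gamma]_z ((2^-1 ^+ (n * m))%:E * (\1_(cell (take m s)) z)%:E))%E.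
  apply: eq_integral => z _; rewrite slice1_box indicE.
  case: eqP => [zs|zs].
    by rewrite mem_set// mule1 IH.
  by rewrite memNset// mule0 measure0.
have mi : measurable_fun [set: R] (fun z => (\1_(cell (take m s)) z : R)%:E).
  by apply/measurable_EFinP; exact: (measurable_indic (@measurable_cell R _ _)).
have i0 (z : R) : (0 <= (\1_(cell (take m s)) z : R)%:E)%E by rewrite lee_fin.
rewrite (ge0_integralZl gamma measurableT mi (fun z _ => i0 z)); last by rewrite lee_fin exprn_ge0.
rewrite integral_indic//; last exact: (@measurable_cell R).
have E : gamma (cell (take m s)) = (2^-1 ^+ m)%:E.
  apply: etrans (esym (fine_probK (normal_prob 0 1) _ (@measurable_cell R m (take m s)))) _.
  by congr (_%:E); exact: (cell_prob m _ s1).2.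
rewrite setIT mulSn exprD mulrC EFinM; congr (_ * _)%E; exact: E.
Qed.

Lemma monotone_box_le n s t (A : set (n.-tuple R)) :
  measurable A -> monotone_increasing A -> bit_le s t -> size s = (n * m)%N ->
  (gn n (A `&` box n s) <= gn n (A `&` box n t))%E.
Proof.
elim: n s t A => [|n IH] s t A mA monA st sn.
  have s0 : s = [::] by apply: size0nil.
  have t0 : t = [::] by apply: size0nil; rewrite -(bit_le_size _ _ st) sn.
  by rewrite s0 t0.
have s1 : size (take m s) = m by rewrite size_takel// sn mulSn leq_addr.
have s2 : size (drop m s) = (n * m)%N by rewrite size_drop sn mulSn addKn.
have st2 := bit_le_drop m s t st; have st1 := bit_le_take m s t st.
have mAb u : measurable (A `&` box n.+1 u) by apply: measurableI => //; exact: measurable_box.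
(* The code is raised in two stages: from [s] to [u] only the later coordinates change, which is the
   induction hypothesis on slices; from [u] to [t] only the first one changes, which is
   [up_set_cell_le]. *)
pose u := take m s ++ drop m t.
have u1 : take m u = take m s by rewrite take_size_cat.
have u2 : drop m u = drop m t by rewrite drop_size_cat.
apply: (@le_trans _ _ (gn n.+1 (A `&` box n.+1 u))).
  rewrite (power_prob_slice1 gamma _ _ (mAb s)) (power_prob_slice1 gamma _ _ (mAb u)).
  apply: ge0_le_integral => //.
  - exact: (measurable_power_prob_slice1 gamma n _ (mAb s)).
  - exact: (measurable_power_prob_slice1 gamma n _ (mAb u)).
  - move=> z _.
    rewrite -[slice1 _ _]/(slice1 A z `&` slice1 (box n.+1 s) z).
    rewrite -[X in (_ <= _ X)%E]/(slice1 A z `&` slice1 (box n.+1 u) z).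
    rewrite !slice1_box u1 u2; case: eqP => _; last by rewrite !setI0.
    by apply: IH => //; [exact: measurable_slice1|exact: monotone_slice1].
rewrite (power_prob_slice2 gamma _ _ (mAb u)) (power_prob_slice2 gamma _ _ (mAb t)).
apply: ge0_le_integral => //.
- exact: (measurable_prob_slice2 gamma n _ (mAb u)).
- exact: (measurable_prob_slice2 gamma n _ (mAb t)).
- move=> o _.
  rewrite -[slice2 _ _]/(slice2 A o `&` slice2 (box n.+1 u) o).
  rewrite -[X in (_ <= _ X)%E]/(slice2 A o `&` slice2 (box n.+1 t) o).
  rewrite !slice2_box u1 u2; case: eqP => _; last by rewrite !setI0.
  have mo := measurable_slice2 n A o mA.
  have mI w : measurable (slice2 A o `&` cell w).
    by apply: measurableI => //; exact: measurable_cell.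
  have := up_set_cell_le m _ _ _ mo (up_set_slice2 _ _ o monA) st1 s1.
  by rewrite -lee_fin (fine_probK (normal_prob 0 1) _ (mI _)) (fine_probK (normal_prob 0 1) _ (mI _)).
Qed.

Lemma bit_sum_nth s : bit_sum s = \sum_(j < size s) bit_sign (nth false s j) :> R.
Proof. by rewrite /bit_sum (big_nth false) big_mkord. Qed.

Lemma bit_sum_codes n (i : 'I_n) (x : n.-tuple R) :
  \sum_(j < m) bit_sign (nth false (codes n x) (i * m + j)) = gpsi m (tnth x i) :> R.
Proof.
elim: n i x => [|n IH] i x; first by case: i.
have [z [y ->]] := tcons_surj n x; rewrite codes_cons.
have [j ->|->] := unliftP ord0 i.
  rewrite tnthS -IH; apply: eq_bigr => k _.
  rewrite nth_cat size_gcode /= /bump add1n mulSn -addnA ltnNge leq_addr /=.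
  by rewrite addKn.
rewrite /gpsi bit_sum_nth size_gcode; apply: eq_bigr => k _.
by rewrite mul0n add0n nth_cat size_gcode ltn_ord.
Qed.

End Codes.

Section Bounded.
Context {d} {T : measurableType d} {R : realType} (P : probability T R).

Lemma bounded_integrable (f : T -> R) (M : R) : measurable_fun [set: T] f ->
  (forall x, 0 <= f x <= M) -> P.-integrable [set: T] (EFin \o f).
Proof.
move=> mf fM; apply: measurable_bounded_integrable => //.
  by rewrite (le_lt_trans (probability_le1 P measurableT))// ltry.
exists M; split; first exact: num_real.
move=> y /ltW My x _ /=; have /andP[f0 f1] := fM x.
by rewrite ger0_norm// (le_trans f1).
Qed.

Lemma Rintegral_sum (I : Type) (r : seq I) (f : I -> T -> R) :
  (forall i, P.-integrable [set: T] (EFin \o f i)) ->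
  \int[P]_x (\sum_(i <- r) f i x) = \sum_(i <- r) \int[P]_x f i x.
Proof.
move=> fi; elim: r => [|i r IH].
  under eq_Rintegral do rewrite big_nil.
  by rewrite big_nil Rintegral_cst// mul0r.
under eq_Rintegral do rewrite big_cons.
rewrite RintegralD// ?IH ?big_cons//.
rewrite (_ : _ \o _ = fun x => \sum_(j <- r) (f j x)%:E)%E; last first.
  by apply/funext => x; rewrite /= sumEFin.
by apply: integrable_sum => // j _; exact: fi.
Qed.

Lemma measurable_fun_fine (f : T -> \bar R) : measurable_fun [set: T] f ->
  measurable_fun [set: T] (fun x => fine (f x)).
Proof. by move=> mf; exact: measurableT_comp. Qed.

Lemma Rintegral_EFin (f : T -> R) : P.-integrable [set: T] (EFin \o f) ->
  (\int[P]_x f x)%:E = (\int[P]_x (f x)%:E)%E.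
Proof. by move=> fi; rewrite fineK//; exact: (integrable_fin_num measurableT fi). Qed.

End Bounded.

(** * Variance lost when coordinates are replaced by their digits *)

Section RectangleVariance.
Context {d} {T : measurableType d} {R : realType} (P : probability T R).
Variables (n : nat) (E : set (n.+1.-tuple T)) (w k : R).
Hypotheses (mE : measurable E) (k0 : 0 < k).
Notation p z := (fine (power_prob P n (slice1 E z))).
Notation b y := (fine (P (slice2 E y))).
Hypotheses (pw : forall z, p z <= w) (bk : forall y, b y <= k).
Notation Q := (fine (power_prob P n.+1 E)).

Let mp : measurable_fun [set: T] (fun z => p z).
Proof. by apply: measurable_fun_fine; exact: measurable_power_prob_slice1. Qed.

Let mb : measurable_fun [set: n.-tuple T] (fun y => b y).
Proof. by apply: measurable_fun_fine; exact: measurable_prob_slice2. Qed.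

Let pint : P.-integrable [set: T] (EFin \o (fun z => p z)).
Proof. by apply: (bounded_integrable P _ w) => // z; rewrite pw andbT fine_ge0. Qed.

Let bint : (power_prob P n).-integrable [set: n.-tuple T] (EFin \o (fun y => b y)).
Proof. by apply: (bounded_integrable (power_prob P n) _ k) => // z; rewrite bk andbT fine_ge0. Qed.

Let Qp : \int[P]_z p z = Q.
Proof.
apply: EFin_inj; rewrite Rintegral_EFin// fine_probK// power_prob_slice1//.
by apply: eq_integral => z _; rewrite fine_probK//; exact: measurable_slice1.
Qed.

Let Qb : \int[power_prob P n]_y b y = Q.
Proof.
apply: EFin_inj; rewrite Rintegral_EFin// fine_probK// power_prob_slice2//.
by apply: eq_integral => z _; rewrite fine_probK//; exact: measurable_slice2.
Qed.

(** For [E] inside a rectangle with sides of mass [k] and [w], this says that the variance in z of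
    an average over y is at most the average of the variances in z; dividing by k is the
    conditioning on the first side. *)
Lemma slice_variance :
  \int[P]_z (p z ^+ 2) <= k^-1 * Q ^+ 2 + w * \int[power_prob P n]_y (b y * (1 - k^-1 * b y)).
Proof.
have w0 : 0 <= w by apply: le_trans (pw point); rewrite fine_ge0.
have kb y : 0 <= 1 - k^-1 * b y <= 1.
  rewrite subr_ge0 mulrC ler_pdivrMr// mul1r bk/= lerBlDr lerDl.
  by rewrite divr_ge0 ?fine_ge0// ltW.
have mkb : measurable_fun [set: n.-tuple T] (fun y => 1 - k^-1 * b y).
  by apply: measurable_funB => //; exact: measurable_funM.
have ikb : (power_prob P n).-integrable [set: n.-tuple T] (EFin \o (fun y => 1 - k^-1 * b y)).
  exact: (bounded_integrable (power_prob P n) _ 1).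
pose F (x : n.+1.-tuple T) := (1 - k^-1 * b [tuple of behead x])%:E.
have mF : measurable_fun [set: n.+1.-tuple T] F.
  apply/measurable_EFinP; apply: (@measurableT_comp _ _ _ _ _ _ (fun y => 1 - k^-1 * b y)) => //.
  exact: measurable_behead.
have F0 x : (0 <= F x)%E by rewrite lee_fin; have /andP[] := kb [tuple of behead x].
have FE z y : F (tcons z y) = (1 - k^-1 * b y)%:E.
  by rewrite /F; congr (1 - k^-1 * fine (P (slice2 E _)))%:E; apply: val_inj.
pose h z := \int[power_prob P n]_(y in slice1 E z) (1 - k^-1 * b y).
have ikbS z : (power_prob P n).-integrable (slice1 E z) (EFin \o (fun y => 1 - k^-1 * b y)).
  by apply: (integrableS measurableT) ikb => //; exact: measurable_slice1.
have hE z : (h z)%:E = (\int[power_prob P n]_(y in slice1 E z) F (tcons z y))%E.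
  rewrite fineK; last by apply: (integrable_fin_num _ (ikbS z)); exact: measurable_slice1.
  by apply: eq_integral => y _; rewrite FE.
have mh : measurable_fun [set: T] h.
  apply/measurable_EFinP; apply: eq_measurable_fun (measurable_integral_slice1 P n E F mE mF F0).
  by move=> z _; rewrite -hE.
have h01 z : 0 <= h z <= w.
  apply/andP; split; first by apply: Rintegral_ge0 => y _; have /andP[] := kb y.
  apply: le_trans (pw z).
  have mS := measurable_slice1 n E z mE.
  rewrite -[leRHS]mul1r -(Rintegral_cst _ mS); apply: le_Rintegral => //.
    exact: finite_measure_integrable_cst.
  by move=> y _; have /andP[] := kb y.
have hint : P.-integrable [set: T] (EFin \o h) by exact: (bounded_integrable P _ w).
have intE : \int[P]_z h z = \int[power_prob P n]_y (b y * (1 - k^-1 * b y)).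
  apply: EFin_inj; rewrite Rintegral_EFin// Rintegral_EFin; last first.
    apply: (bounded_integrable (power_prob P n) _ k); first exact: measurable_funM.
    move=> y; have /andP[l u] := kb y; rewrite mulr_ge0 ?fine_ge0//=.
    by rewrite (le_trans _ (bk y))// ler_piMr// fine_ge0.
  transitivity (\int[power_prob P n.+1]_(x in E) F x)%E.
    by rewrite integral_slice1//; apply: eq_integral => z _; rewrite hE.
  rewrite integral_slice2//; apply: eq_integral => y _.
  have mS := measurable_slice2 n E y mE.
  under eq_integral do rewrite FE.
  by rewrite integral_cst// EFinM fine_probK// muleC.
(* Pointwise form of the claim: p z - h z is the integral of b/k over a slice, hence at most Q/k;
   multiply by p z <= w. Integrating in z and exchanging the order in h gives the lemma. *)
have step z : p z ^+ 2 <= k^-1 * Q * p z + w * h z.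
  have : p z <= k^-1 * Q + h z.
    have mS := measurable_slice1 n E z mE.
    have iS : (power_prob P n).-integrable (slice1 E z) (EFin \o (fun y => k^-1 * b y)).
      apply: (integrableS measurableT) => //.
      apply: (bounded_integrable (power_prob P n) _ 1); first exact: measurable_funM.
      by move=> y; have /andP[] := kb y; have := bk y; lra.
    have -> : h z = p z - \int[power_prob P n]_(y in slice1 E z) (k^-1 * b y).
      rewrite /h RintegralB//; last exact: finite_measure_integrable_cst.
      by rewrite Rintegral_cst// mul1r.
    suff : \int[power_prob P n]_(y in slice1 E z) (k^-1 * b y) <= k^-1 * Q by lra.
    rewrite RintegralZl//; last by apply: (integrableS measurableT) bint.
    rewrite ler_wpM2l ?invr_ge0 ?(ltW k0)// -Qb.
    rewrite /Rintegral fine_le//.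
    - by apply: (integrable_fin_num mS); apply: (integrableS measurableT) bint.
    - exact: (integrable_fin_num measurableT bint).
    apply: ge0_subset_integral => //; first exact: (measurable_int _ bint).
    by move=> y _; rewrite lee_fin fine_ge0.
  have p0 : 0 <= p z by rewrite fine_ge0.
  have := pw z; have /andP[] := h01 z => h0 h1 pz hp; nra.
have i1 : P.-integrable [set: T] (EFin \o (fun z => k^-1 * Q * p z)).
  rewrite (_ : _ \o _ = fun z => (k^-1 * Q)%R%:E * (p z)%:E)%E; last by apply/funext => z; rewrite /= EFinM.
  exact: integrableZl.
have i2 : P.-integrable [set: T] (EFin \o (fun z => w * h z)).
  rewrite (_ : _ \o _ = fun z => w%:E * (h z)%:E)%E; last by apply/funext => z; rewrite /= EFinM.
  exact: integrableZl.
apply: (@le_trans _ _ (\int[P]_z (k^-1 * Q * p z + w * h z))).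
  apply: le_Rintegral => //.
    apply: (bounded_integrable P _ (w ^+ 2)); first exact: measurable_funX.
    by move=> z; rewrite sqr_ge0/= lerXn2r// nnegrE fine_ge0.
  rewrite (_ : _ \o _ = ((EFin \o (fun z => k^-1 * Q * p z)%R) \+ (EFin \o (fun z => w * h z)%R))%E).
    exact: integrableD.
  by apply/funext => z; rewrite /= EFinD.
by rewrite RintegralD// RintegralZl// RintegralZl// Qp intE expr2 mulrA.
Qed.

End RectangleVariance.

Section BoxEnergy.
Context {R : realType} (m : nat).
Notation gamma := (normal_prob (0 : R) 1).
Notation gn n := (power_prob gamma n).
Notation cell s := (gcode m @^-1` [set s]).
Notation box n s := (@codes R m n @^-1` [set s]).

(* The second moment of the conditional probability of [A] given the codes. *)
Definition box_energy n (A : set (n.-tuple R)) : R :=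
  2 ^+ (n * m) * \sum_(s <- cube (n * m)) fine (gn n (A `&` box n s)) ^+ 2.

Definition cells_var (B : set R) : R :=
  \sum_(c <- cube m) cell_var m (fine (gamma (B `&` cell c))).

Let two1 k : 2 ^+ k * 2^-1 ^+ k = 1 :> R.
Proof. by rewrite -exprMn divff// expr1n. Qed.

Section Step.
Variables (n : nat) (A : set (n.+1.-tuple R)).
Hypothesis mA : measurable A.
Let E c s := A `&` box n.+1 (c ++ s).
Let p c s z : R := fine (gn n (slice1 (E c s) z)).
Let b c s o : R := fine (gamma (slice2 (E c s) o)).

Let mE c s : measurable (E c s).
Proof. by apply: measurableI => //; exact: measurable_box. Qed.

Let mp c s : measurable_fun [set: R] (p c s).
Proof. by apply: measurable_fun_fine; exact: (measurable_power_prob_slice1 gamma n _ (mE c s)). Qed.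

Let mb c s : measurable_fun [set: n.-tuple R] (b c s).
Proof. by apply: measurable_fun_fine; exact: (measurable_prob_slice2 gamma n _ (mE c s)). Qed.

Let p01 c s z : 0 <= p c s z <= 1.
Proof.
rewrite /p fine_ge0//=; apply: (fine_prob_le1 (gn n)).
exact: (measurable_slice1 _ _ _ (mE c s)).
Qed.

Let b01 c s o : 0 <= b c s o <= 1.
Proof.
rewrite /b fine_ge0//=; apply: (fine_prob_le1 (normal_prob (0 : R) 1)).
exact: (measurable_slice2 _ _ _ (mE c s)).
Qed.

Let slice1E c s z : size c = m -> slice1 (E c s) z =
  if gcode m z == c then slice1 A z `&` box n s else set0.
Proof.
move=> cm; rewrite -[LHS]/(slice1 A z `&` slice1 (box n.+1 (c ++ s)) z) slice1_box.
by rewrite take_size_cat// drop_size_cat//; case: ifP; rewrite ?setI0.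
Qed.

Let slice2E c s o : size c = m -> slice2 (E c s) o =
  if codes m n o == s then slice2 A o `&` cell c else set0.
Proof.
move=> cm; rewrite -[LHS]/(slice2 A o `&` slice2 (box n.+1 (c ++ s)) o) slice2_box.
by rewrite take_size_cat// drop_size_cat//; case: ifP; rewrite ?setI0.
Qed.

(** For a given z only the term c = [gcode m z] has a nonempty slice. *)
Let sum_p s z : \sum_(c <- cube m) p c s z ^+ 2 = fine (gn n (slice1 A z `&` box n s)) ^+ 2.
Proof.
rewrite -(sum_cube_eq m (fun=> _ ^+ 2) (gcode m z))//; last exact: size_gcode.
rewrite big_seq [RHS]big_seq; apply: eq_bigr => c; rewrite mem_cube => /eqP cm.
rewrite /p slice1E//; case: ifP => _; first by rewrite mulr1.
by rewrite measure0 expr0n mulr0.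
Qed.

Let sum_b c o : c \in cube m -> \sum_(s <- cube (n * m)) cell_var m (b c s o) =
  cell_var m (fine (gamma (slice2 A o `&` cell c))).
Proof.
rewrite mem_cube => /eqP cm.
rewrite -(sum_cube_eq (n * m) (fun=> cell_var m _) (codes m n o))//; last exact: size_codes.
apply: eq_bigr => s _; rewrite /b slice2E//; case: ifP => _; first by rewrite mulr1.
by rewrite measure0 /cell_var mul0r mulr0.
Qed.

Let step c s : c \in cube m -> s \in cube (n * m) ->
  2 ^+ (n * m) * \int[gamma]_z (p c s z ^+ 2) <=
  2 ^+ (n.+1 * m) * fine (gn n.+1 (E c s)) ^+ 2 + \int[gn n]_o cell_var m (b c s o).
Proof.
rewrite !mem_cube => /eqP cm /eqP sm.
have pw z : p c s z <= 2^-1 ^+ (n * m).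
  rewrite -(box_prob m n s sm); apply: (fine_prob_le (gn n)).
  - exact: (measurable_slice1 _ _ _ (mE c s)).
  - exact: measurable_box.
  - by rewrite slice1E//; case: ifP => _ y; [case|].
have bk y : b c s y <= 2^-1 ^+ m.
  rewrite -(cell_prob m c cm).2; apply: (fine_prob_le (normal_prob (0 : R) 1)).
  - exact: (measurable_slice2 _ _ _ (mE c s)).
  - exact: measurable_cell.
  - by rewrite slice2E//; case: ifP => _ z; [case|].
have k0 : 0 < 2^-1 ^+ m :> R by rewrite exprn_gt0// invr_gt0.
have := slice_variance gamma n (E c s) _ _ (mE c s) k0 pw bk.
have -> : (2^-1 ^+ m)^-1 = 2 ^+ m :> R by rewrite exprVn invrK.
rewrite -(ler_pM2l (_ : 0 < 2 ^+ (n * m) :> R)); last by rewrite exprn_gt0.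
by rewrite mulrDr !mulrA two1 mul1r mulSn exprD [2 ^+ m * _]mulrC.
Qed.

(** Knowing only the digits of the first coordinate, instead of its value, costs at most the mean
    within-cell variance of its one-dimensional slices: [slice_variance] on each product of a cell
    and a box. *)
Lemma slice_energy :
  \int[gamma]_z box_energy n (slice1 A z) <=
  box_energy n.+1 A + \int[gn n]_o cells_var (slice2 A o).
Proof.
have ip c s : gamma.-integrable [set: R] (EFin \o (fun z => 2 ^+ (n * m) * p c s z ^+ 2)).
  apply: (bounded_integrable (normal_prob (0 : R) 1) _ (2 ^+ (n * m))).
    by apply: measurable_funM; [exact: measurable_cst|apply: measurable_funX; exact: mp].
  move=> z; have /andP[p0 p1] := p01 c s z.
  by rewrite mulr_ge0 ?exprn_ge0//= ler_piMr ?exprn_ge0// exprn_ile1.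
have ip' c s : gamma.-integrable [set: R] (EFin \o (fun z => p c s z ^+ 2)).
  apply: (bounded_integrable (normal_prob (0 : R) 1) _ 1); first by apply: measurable_funX; exact: mp.
  by move=> z; have /andP[p0 p1] := p01 c s z; rewrite exprn_ge0//= exprn_ile1.
have ib c s : (gn n).-integrable [set: n.-tuple R] (EFin \o (fun o => cell_var m (b c s o))).
  have mcv : measurable_fun [set: n.-tuple R] (fun o => cell_var m (b c s o)).
    rewrite /cell_var; apply: measurable_funM; first exact: mb.
    by apply: measurable_funB => //; apply: measurable_funM => //; exact: mb.
  apply: (measurable_bounded_integrable (mu := gn n)) => //.
    by rewrite (le_lt_trans (probability_le1 (gn n) measurableT))// ltry.
  exists (1 + 2 ^+ m); split; first exact: num_real.
  move=> y /ltW My x _ /=; apply: le_trans My.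
  have /andP[b0 b1] := b01 c s x; have t0 : 0 <= 2 ^+ m :> R by rewrite exprn_ge0.
  rewrite normrM (ger0_norm b0) -[leRHS]mul1r ler_pM// (le_trans (ler_normB _ _))//.
  by rewrite normr1 lerD2l ger0_norm ?mulr_ge0// ler_piMr.
have -> : \int[gamma]_z box_energy n (slice1 A z) =
    \sum_(s <- cube (n * m)) \sum_(c <- cube m) 2 ^+ (n * m) * \int[gamma]_z (p c s z ^+ 2).
  transitivity (\int[gamma]_z (\sum_(s <- cube (n * m)) \sum_(c <- cube m) 2 ^+ (n * m) * p c s z ^+ 2)).
    apply: eq_Rintegral => z _; rewrite /box_energy mulr_sumr; apply: eq_bigr => s _.
    by rewrite -sum_p mulr_sumr.
  rewrite (Rintegral_sum (normal_prob (0 : R) 1)); last first.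
    move=> s; rewrite (_ : _ \o _ = fun z => \sum_(c <- cube m) (2 ^+ (n * m) * p c s z ^+ 2)%:E)%E.
      by apply: integrable_sum => // c _; exact: ip.
    by apply/funext => z; rewrite /= sumEFin.
  apply: eq_bigr => s _; rewrite (Rintegral_sum (normal_prob (0 : R) 1)); last by move=> c; exact: ip.
  by apply: eq_bigr => c _; rewrite RintegralZl//; exact: ip'.
have -> : \int[gn n]_o cells_var (slice2 A o) =
    \sum_(c <- cube m) \sum_(s <- cube (n * m)) \int[gn n]_o cell_var m (b c s o).
  transitivity (\int[gn n]_o (\sum_(c <- cube m) \sum_(s <- cube (n * m)) cell_var m (b c s o))).
    apply: eq_Rintegral => o _; rewrite /cells_var big_seq [RHS]big_seq.
    by apply: eq_bigr => c cm; rewrite sum_b.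
  rewrite (Rintegral_sum (gn n)); last first.
    move=> c; rewrite (_ : _ \o _ = fun o => \sum_(s <- cube (n * m)) (cell_var m (b c s o))%:E)%E.
      by apply: integrable_sum => // s _; exact: ib.
    by apply/funext => o; rewrite /= sumEFin.
  by apply: eq_bigr => c _; rewrite (Rintegral_sum (gn n)).
rewrite /box_energy mulSn big_cube_cat mulr_sumr exchange_big /= -big_split /=.
rewrite big_seq [leRHS]big_seq; apply: ler_sum => c cm.
rewrite mulr_sumr -big_split /= big_seq [leRHS]big_seq; apply: ler_sum => s sm.
by have := step c s cm sm; rewrite mulSn.
Qed.

End Step.

End BoxEnergy.

Section BoxResidual.
Context {R : realType} (m : nat).
Notation gamma := (normal_prob (0 : R) 1).
Notation gn n := (power_prob gamma n).
Notation cell s := (gcode m @^-1` [set s]).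
Notation box n s := (@codes R m n @^-1` [set s]).

Lemma box_energy_ge0 n (A : set (n.-tuple R)) : 0 <= box_energy m n A.
Proof. by rewrite /box_energy mulr_ge0 ?exprn_ge0// sumr_ge0// => s _; exact: sqr_ge0. Qed.

Lemma cells_var_ge0 (B : set R) : measurable B -> 0 <= cells_var m B.
Proof.
move=> mB; rewrite /cells_var big_seq sumr_ge0// => c; rewrite mem_cube => /eqP cm.
have h : fine (gamma (B `&` cell c)) <= 2^-1 ^+ m.
  rewrite -(cell_prob m c cm).2; apply: (fine_prob_le (normal_prob (0 : R) 1)).
  - by apply: measurableI => //; exact: measurable_cell.
  - exact: measurable_cell.
  - exact: subIsetr.
rewrite /cell_var mulr_ge0 ?fine_ge0// subr_ge0.
have t0 : 0 <= 2 ^+ m :> R by rewrite exprn_ge0.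
by apply: le_trans (ler_wpM2l t0 h) _; rewrite -exprMn divff// expr1n.
Qed.

Section Measurability.
Variables (n : nat) (A : set (n.+1.-tuple R)).
Hypothesis mA : measurable A.

Lemma measurable_box_energy_slice1 :
  measurable_fun [set: R] (fun z => box_energy m n (slice1 A z)).
Proof.
apply: measurable_funM; first exact: measurable_cst.
apply: measurable_sum => s; apply: measurable_funX; apply: measurable_fun_fine.
pose E := A `&` ((fun x : n.+1.-tuple R => [tuple of behead x]) @^-1` box n s).
have mE : measurable E.
  apply: measurableI => //; rewrite -[X in measurable X]setTI.
  by apply: measurable_behead => //; exact: measurable_box.
apply: eq_measurable_fun (measurable_power_prob_slice1 gamma n E mE) => z _.
congr (power_prob _ _ _); apply/seteqP; split=> y [Ay ys]; split=> //; move: ys => /=;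
  by rewrite (_ : [tuple of behead (tcons z y)] = y)//; apply: val_inj.
Qed.

Lemma measurable_cells_var_slice2 :
  measurable_fun [set: n.-tuple R] (fun o => cells_var m (slice2 A o)).
Proof.
apply: measurable_sum => c.
pose E := A `&` ((fun x : n.+1.-tuple R => tnth x ord0) @^-1` cell c).
have mE : measurable E.
  apply: measurableI => //; rewrite -[X in measurable X]setTI.
  by apply: measurable_tnth => //; exact: measurable_cell.
have mb : measurable_fun [set: n.-tuple R] (fun o => fine (gamma (slice2 A o `&` cell c))).
  apply: measurable_fun_fine.
  by apply: eq_measurable_fun (measurable_prob_slice2 gamma n E mE) => o _.
rewrite /cell_var; apply: measurable_funM; first exact: mb.
by apply: measurable_funB => //; apply: measurable_funM => //; exact: mb.
Qed.

End Measurability.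

Lemma box_energy_le n (A : set (n.-tuple R)) : measurable A -> box_energy m n A <= 1.
Proof.
move=> mA; rewrite /box_energy.
have t0 : 0 <= 2 ^+ (n * m) :> R by rewrite exprn_ge0.
have tt : 2 ^+ (n * m) * 2^-1 ^+ (n * m) = 1 :> R by rewrite -exprMn divff// expr1n.
apply: (@le_trans _ _ (2 ^+ (n * m) * \sum_(s <- cube (n * m)) 2^-1 ^+ (n * m) * fine (gn n (A `&` box n s)))).
  apply: ler_wpM2l => //; rewrite big_seq [leRHS]big_seq; apply: ler_sum => s; rewrite mem_cube => /eqP sm.
  rewrite expr2 ler_wpM2r ?fine_ge0// -(box_prob m n s sm); apply: (fine_prob_le (gn n)).
  - by apply: measurableI => //; exact: measurable_box.
  - exact: measurable_box.
  - exact: subIsetr.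
rewrite -mulr_sumr mulrA tt mul1r.
rewrite -(sum_code (gn n) (@codes R m n) (n * m) _ _ A mA).
- exact: (fine_prob_le1 (gn n)).
- by move=> s; exact: measurable_box.
- exact: size_codes.
Qed.

Lemma cells_var_le (B : set R) : measurable B -> cells_var m B <= 1.
Proof.
move=> mB; apply: le_trans (fine_prob_le1 (normal_prob (0 : R) 1) B mB).
rewrite (sum_code (normal_prob (0 : R) 1) (gcode m) m _ _ B mB).
- apply: ler_sum => c _; rewrite /cell_var ler_piMr ?fine_ge0// gerBl.
  by rewrite mulr_ge0 ?exprn_ge0// fine_ge0.
- by move=> s; exact: measurable_cell.
- exact: size_gcode.
Qed.

(** As 1_A is its own square, the mass of [A] is its energy when all coordinates are known exactly.
    They are replaced by digits one at a time, each paid for by the one-dimensional hypothesis. [u]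
    and [v] stand for the negative and positive parts of one function, kept on opposite sides to
    avoid subtraction. *)
Lemma box_residual (u v : R -> \bar R) :
  measurable_fun [set: R] u -> measurable_fun [set: R] v ->
  (forall z, 0 <= u z)%E -> (forall z, 0 <= v z)%E ->
  (forall B, measurable B -> up_set B ->
    ((cells_var m B)%:E + \int[gamma]_(z in B) u z <= \int[gamma]_(z in B) v z)%E) ->
  forall n (A : set (n.-tuple R)), measurable A -> monotone_increasing A ->
  (gn n A + \sum_(i < n) \int[gn n]_(x in A) u (tnth x i) <=
   (box_energy m n A)%:E + \sum_(i < n) \int[gn n]_(x in A) v (tnth x i))%E.
Proof.
move=> mu mv u0 v0 uv.
(* The three inequalities are chained by regrouping alone, since terms in [\bar R] may be infinite
   and cannot be cancelled. *)
have chain (a U0 U V0 V I BE CV : \bar R) : (a + U <= I + V -> I <= BE + CV ->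
    CV + U0 <= V0 -> a + (U0 + U) <= BE + (V0 + V))%E.
  move=> hI hE hV; rewrite addeCA; apply: (le_trans (leeD2l _ hI)).
  apply: (le_trans (leeD2l _ (leeD2r _ hE))).
  by rewrite addeA addeCA -addeA [(U0 + CV)%E]addeC; apply: leeD2l; exact: leeD2r.
elim=> [|n IH] A mA monA.
  rewrite !big_ord0 !adde0 -(fine_probK (gn 0) A mA) lee_fin.
  rewrite /box_energy mul0n mul1r big_seq1.
  have -> : A `&` box 0 [::] = A by apply/setIidPl => x _ /=; rewrite tuple0.
  (* In dimension 0 the measure is a point mass, so mass and energy agree. *)
  have : fine (gn 0 A) = 0 \/ fine (gn 0 A) = 1.
    by rewrite /= /dirac indicE; case: (_ \in _); [right|left].
  by case=> ->; rewrite ?expr0n ?expr1n.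
have mcu (i : 'I_n.+1) := measurable_coord n.+1 i u mu.
have mcv (i : 'I_n.+1) := measurable_coord n.+1 i v mv.
have split_sum (f : R -> \bar R) : measurable_fun [set: R] f -> (forall z, 0 <= f z)%E ->
    (\sum_(i < n.+1) \int[gn n.+1]_(x in A) f (tnth x i) =
     \int[gn n.+1]_(x in A) f (tnth x ord0) +
     \int[gamma]_z \sum_(i < n) \int[gn n]_(y in slice1 A z) f (tnth y i))%E.
  move=> mf f0; rewrite big_ord_recl; congr (_ + _)%E.
  have mS (i : 'I_n) : measurable_fun [set: R] (fun z => \int[gn n]_(y in slice1 A z) f (tnth y i))%E.
    apply: eq_measurable_fun (measurable_integral_slice1 gamma n A
      (fun x => f (tnth x (lift ord0 i))) mA (measurable_coord _ _ f mf) (fun=> f0 _)) => z _.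
    by apply: eq_integral => y _; rewrite tnth_tconsS.
  rewrite ge0_integral_sum//; last by move=> i z _; exact: integral_ge0.
  apply: eq_bigr => i _.
  rewrite (integral_slice1 gamma n A (fun x => f (tnth x (lift ord0 i))) mA (measurable_coord _ _ f mf) (fun=> f0 _)).
  by apply: eq_integral => z _; apply: eq_integral => y _; rewrite tnth_tconsS.
rewrite (split_sum u mu u0) (split_sum v mv v0).
have mS (f : R -> \bar R) : measurable_fun [set: R] f -> (forall z, 0 <= f z)%E ->
    measurable_fun [set: R] (fun z => \sum_(i < n) \int[gn n]_(y in slice1 A z) f (tnth y i))%E.
  move=> mf f0; apply: emeasurable_sum => i.
  apply: eq_measurable_fun (measurable_integral_slice1 gamma n A
    (fun x => f (tnth x (lift ord0 i))) mA (measurable_coord _ _ f mf) (fun=> f0 _)) => z _.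
  by apply: eq_integral => y _; rewrite tnth_tconsS.
have S0 (f : R -> \bar R) z : (forall z, 0 <= f z)%E ->
    (0 <= \sum_(i < n) \int[gn n]_(y in slice1 A z) f (tnth y i))%E.
  by move=> f0; apply: sume_ge0 => i _; exact: integral_ge0.
have mbe : measurable_fun [set: R] (fun z => (box_energy m n (slice1 A z))%:E).
  by apply/measurable_EFinP; exact: measurable_box_energy_slice1.
have hI : (\int[gamma]_z gn n (slice1 A z) +
    \int[gamma]_z \sum_(i < n) \int[gn n]_(y in slice1 A z) u (tnth y i) <=
    \int[gamma]_z (box_energy m n (slice1 A z))%:E +
    \int[gamma]_z \sum_(i < n) \int[gn n]_(y in slice1 A z) v (tnth y i))%E.
  rewrite -ge0_integralD//; try exact: mS; try exact: (measurable_power_prob_slice1 gamma n A mA);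
    try (by move=> z _; exact: S0).
  rewrite -ge0_integralD//; try exact: mS; try (by move=> z _; exact: S0); last first.
    by move=> z _; rewrite lee_fin box_energy_ge0.
  apply: ge0_le_integral => //.
  - by move=> z _; apply: adde_ge0 => //; exact: S0.
  - apply: emeasurable_funD; last exact: mS.
    exact: (measurable_power_prob_slice1 gamma n A mA).
  - by apply: emeasurable_funD => //; exact: mS.
  - by move=> z _; apply: IH; [exact: measurable_slice1|exact: monotone_slice1].
have hE : (\int[gamma]_z (box_energy m n (slice1 A z))%:E <=
   (box_energy m n.+1 A)%:E + \int[gn n]_o (cells_var m (slice2 A o))%:E)%E.
  have ib : gamma.-integrable [set: R] (EFin \o (fun z => box_energy m n (slice1 A z))).
    apply: (bounded_integrable (normal_prob (0 : R) 1) _ 1).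
      exact: measurable_box_energy_slice1.
    by move=> z; rewrite box_energy_ge0 box_energy_le//; exact: measurable_slice1.
  have ic : (gn n).-integrable [set: n.-tuple R] (EFin \o (fun o => cells_var m (slice2 A o))).
    apply: (bounded_integrable (gn n) _ 1); first exact: measurable_cells_var_slice2.
    by move=> o; rewrite cells_var_ge0 ?cells_var_le//; exact: measurable_slice2.
  rewrite -(Rintegral_EFin (normal_prob (0 : R) 1) _ ib) -(Rintegral_EFin (gn n) _ ic) -EFinD lee_fin.
  exact: slice_energy.
have hV : (\int[gn n]_o (cells_var m (slice2 A o))%:E + \int[gn n.+1]_(x in A) u (tnth x ord0) <=
    \int[gn n.+1]_(x in A) v (tnth x ord0))%E.
  rewrite (integral_slice2 gamma n A (fun x => u (tnth x ord0)) mA (mcu ord0) (fun=> u0 _)).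
  rewrite (integral_slice2 gamma n A (fun x => v (tnth x ord0)) mA (mcv ord0) (fun=> v0 _)).
  have mI (f : R -> \bar R) : measurable_fun [set: R] f -> (forall z, 0 <= f z)%E ->
      measurable_fun [set: n.-tuple R] (fun o => \int[gamma]_(z in slice2 A o) f (tnth (tcons z o) ord0))%E.
    move=> mf f0.
    exact: (measurable_integral_slice2 gamma n A (fun x => f (tnth x ord0)) mA
      (measurable_coord _ _ f mf) (fun=> f0 _)).
  have cv0 o : (0 <= (cells_var m (slice2 A o))%:E)%E.
    by rewrite lee_fin cells_var_ge0//; exact: measurable_slice2.
  have mcv' : measurable_fun [set: n.-tuple R] (fun o => (cells_var m (slice2 A o))%:E).
    by apply/measurable_EFinP; exact: measurable_cells_var_slice2.
  have I0 (f : R -> \bar R) o : (forall z, 0 <= f z)%E ->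
      (0 <= \int[gamma]_(z in slice2 A o) f (tnth (tcons z o) ord0))%E.
    by move=> f0; exact: integral_ge0.
  rewrite -(ge0_integralD (gn n) measurableT (fun o _ => cv0 o) mcv' (fun o _ => I0 u o u0) (mI u mu u0)).
  apply: ge0_le_integral => //.
  - by move=> o _; apply: adde_ge0 => //; exact: I0.
  - by apply: emeasurable_funD => //; exact: mI.
  - exact: mI.
  - by move=> o _; apply: uv; [exact: measurable_slice2|exact: up_set_slice2].
rewrite (power_prob_slice1 gamma n A mA).
by move: hI hE hV; apply: chain.
Qed.

End BoxResidual.

Lemma sum_ord_mul {R : nmodType} n m (F : nat -> R) :
  \sum_(l < n * m) F l = \sum_(i < n) \sum_(j < m) F (i * m + j)%N.
Proof.
elim: n F => [|n IH] F; first by rewrite !big_ord0.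
rewrite mulSn big_split_ord /= (IH (fun l => F (m + l)%N)) big_ord_recl /=; congr (_ + _).
by apply: eq_bigr => i _; apply: eq_bigr => j _; rewrite /bump add1n mulSn addnA.
Qed.

(** * Influences of a monotone set *)

Section InfluenceBound.
Context {R : realType}.
Notation gamma := (normal_prob (0 : R) 1).
Notation gn n := (power_prob gamma n).
Notation box m n s := (@codes R m n @^-1` [set s]).
Implicit Types (m n : nat).

Definition coord_mean n (A : set (n.-tuple R)) (i : 'I_n) : R :=
  \int[gn n]_(x in A) tnth x i.

Lemma Rintegral_pos_neg (d : measure_display) (T : measurableType d)
    (P : probability T R) (D : set T) (f : T -> R) :
  measurable D -> P.-integrable D (EFin \o f) ->
  exists p q : R, [/\ (\int[P]_(x in D) ((EFin \o f)^\+)%E x = p%:E)%E,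
    (\int[P]_(x in D) ((EFin \o f)^\-)%E x = q%:E)%E & \int[P]_(x in D) f x = p - q].
Proof.
move=> mD fi.
have pf := integrable_pos_fin_num mD fi; have nf := integrable_neg_fin_num mD fi.
exists (fine (\int[P]_(x in D) ((EFin \o f)^\+)%E x)%E), (fine (\int[P]_(x in D) ((EFin \o f)^\-)%E x)%E).
by rewrite !fineK//; split => //; rewrite /Rintegral integralE fineB.
Qed.

Lemma box_residual_real : exists2 K : R, 0 < K & forall m n (A : set (n.-tuple R)),
  (0 < m)%N -> measurable A -> monotone_increasing A ->
  fine (gn n A) - box_energy m n A <= K / Num.sqrt m%:R * \sum_(i < n) coord_mean n A i.
Proof.
have [K K0 hK] := @up_set_cell_var R.
exists K => // m n A m0 mA monA; set k := K / Num.sqrt m%:R.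
pose f (z : R) := k * z.
have fi : gamma.-integrable [set: R] (EFin \o f) by exact: integrable_gaussian_scale.
have mf : measurable_fun [set: R] (EFin \o f) by case/integrableP : fi.
have uv B : measurable B -> up_set B ->
    ((cells_var m B)%:E + \int[gamma]_(z in B) ((EFin \o f)^\-)%E z <=
     \int[gamma]_(z in B) ((EFin \o f)^\+)%E z)%E.
  move=> mB uB.
  have fiB : gamma.-integrable B (EFin \o f) by exact: integrable_gaussian_scale.
  have [p [q [-> -> pq]]] := Rintegral_pos_neg _ _ (normal_prob (0 : R) 1) B f mB fiB.
  rewrite -EFinD lee_fin -lerBrDr -pq.
  have -> : \int[gamma]_(z in B) f z = k * \int[gamma]_(z in B) z.
    by rewrite RintegralZl//; exact: integrable_gaussian_idS.
  exact: hK.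
have := box_residual m _ _ (measurable_funeneg mf) (measurable_funepos mf)
  (funeneg_ge0 _) (funepos_ge0 _) uv n A mA monA.
have idi i : (gn n).-integrable A (EFin \o (fun x => tnth x i)).
  have := @integrable_coord R (normal_prob (0 : R) 1) n i id A mA (@integrable_gaussian_id R).
  by apply.
have fiA i : (gn n).-integrable A (EFin \o (fun x => f (tnth x i))).
  exact: (@integrable_coord R (normal_prob (0 : R) 1) n i f A mA fi).
pose N i := fine (\int[gn n]_(x in A) ((EFin \o f)^\-)%E (tnth x i))%E.
pose M i := fine (\int[gn n]_(x in A) ((EFin \o f)^\+)%E (tnth x i))%E.
have key i : [/\ (\int[gn n]_(x in A) ((EFin \o f)^\-)%E (tnth x i) = (N i)%:E)%E,
    (\int[gn n]_(x in A) ((EFin \o f)^\+)%E (tnth x i) = (M i)%:E)%E &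
    k * coord_mean n A i = M i - N i].
  have EN : (fun x => ((EFin \o f)^\-)%E (tnth x i)) = ((EFin \o (fun x : n.-tuple R => f (tnth x i)))^\-)%E.
    by apply/funext => x; rewrite !funenegE.
  have EM : (fun x => ((EFin \o f)^\+)%E (tnth x i)) = ((EFin \o (fun x : n.-tuple R => f (tnth x i)))^\+)%E.
    by apply/funext => x; rewrite !funeposE.
  rewrite /N /M EN EM.
  have [p [q [-> -> pq]]] := Rintegral_pos_neg _ _ (gn n) A _ mA (fiA i).
  by split=> //=; rewrite -pq /coord_mean RintegralZl.
under eq_bigr => i _ do rewrite (let: And3 h _ _ := key i in h).
under [X in (_ <= _ + X)%E -> _]eq_bigr => i _ do rewrite (let: And3 _ h _ := key i in h).
rewrite !sumEFin -(fine_probK (gn n) A mA) -!EFinD lee_fin => h.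
rewrite mulr_sumr (eq_bigr (fun i => M i - N i)); last by move=> i _; case: (key i).
rewrite sumrB; lra.
Qed.

Section Cube.
Variables (m n : nat) (A : set (n.-tuple R)).
Hypotheses (mA : measurable A) (monA : monotone_increasing A).
Let N := (n * m)%N.

(** Each box has mass 2^-(nm), so this is the conditional probability of [A] given the codes. *)
Definition box_density (s : seq bool) : R := 2 ^+ (n * m) * fine (gn n (A `&` box m n s)).
Notation g := box_density.

Let t0 : 0 <= 2 ^+ N :> R. Proof. by rewrite exprn_ge0. Qed.
Let tt : 2 ^+ N * 2^-1 ^+ N = 1 :> R. Proof. by rewrite -exprMn divff// expr1n. Qed.
Let mAb s : measurable (A `&` box m n s).
Proof. by apply: measurableI => //; exact: measurable_box. Qed.

Lemma box_density01 s : size s = N -> 0 <= g s <= 1.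
Proof.
move=> sN; rewrite /g mulr_ge0 ?fine_ge0//= -[leRHS]tt ler_wpM2l//.
rewrite -(box_prob m n s sN); apply: (fine_prob_le (gn n)).
- exact: mAb.
- exact: (@measurable_box R).
- exact: subIsetr.
Qed.

Lemma box_density_mono s t : size s = N -> bit_le s t -> g s <= g t.
Proof.
move=> sN st; rewrite /g ler_wpM2l// -lee_fin !(fine_probK (gn n) _ (mAb _)).
exact: monotone_box_le.
Qed.

Lemma cube_mean_box_density : cube_mean N g = fine (gn n A).
Proof.
rewrite cube_meanE (sum_code (gn n) (@codes R m n) N _ _ A mA).
- by rewrite -mulr_sumr mulrA [_ * 2 ^+ _]mulrC tt mul1r.
- by move=> s; exact: measurable_box.
- exact: size_codes.
Qed.

Lemma cube_mean_box_density_sqr : cube_mean N (fun s => g s ^+ 2) = box_energy m n A.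
Proof.
rewrite cube_meanE /box_energy.
under eq_bigr do rewrite /g exprMn expr2 -mulrA.
rewrite -!mulr_sumr (mulrA (2^-1 ^+ N)) [2^-1 ^+ N * _]mulrC; by rewrite tt mul1r.
Qed.

Lemma bit_diff_density01 l s : (l < N)%N -> size s = N -> 0 <= bit_diff l g s <= 1.
Proof.
move=> lN sN; have ls : (l < size s)%N by rewrite sN.
rewrite bit_diffE//.
have sz b : size (set_nth false s l b) = N by rewrite size_set_nth sN; apply/maxn_idPr.
have h := box_density_mono _ _ (sz false) (bit_le_set_nth s l).
have /andP[a1 a2] := box_density01 _ (sz true).
have /andP[b1 b2] := box_density01 _ (sz false).
apply/andP; split; lra.
Qed.

(** By [cube_mean_bit_diff] each mean derivative is a mean against a digit sign, and the signs of
    the digits of coordinate i add up to [gpsi m]. *)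
Lemma sum_bit_diff_density i : \sum_(j < m) cube_mean N (bit_diff (nat_of_ord (i : 'I_n) * m + j) g) =
  \int[gn n]_(x in A) gpsi m (tnth x i).
Proof.
have mb s : measurable (box m n s) by exact: measurable_box.
have lN (j : 'I_m) : (i * m + j < N)%N.
  by rewrite /N (leq_trans (_ : _ < i.+1 * m)%N) ?leq_mul2r ?ltn_ord ?orbT// mulSn addnC ltn_add2r.
under eq_bigr => j _ do rewrite cube_mean_bit_diff ?lN//.
rewrite -cube_mean_sum.
under eq_cube_mean do rewrite -mulr_suml.
under eq_Rintegral do rewrite -bit_sum_codes.
rewrite (Rintegral_code (gn n) (@codes R m n) N mb _
  (fun s => \sum_(j < m) bit_sign (nth false s (i * m + j))) A mA);
  last exact: size_codes.
rewrite cube_meanE mulr_sumr; apply: eq_bigr => s _.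
by rewrite /g [X in _ * X = _]mulrCA (mulrA (2^-1 ^+ N)) [2^-1 ^+ N * _]mulrC tt mul1r.
Qed.

End Cube.

(** [up_set_gpsi] passes to n dimensions by applying [monotone_coord_ge0] to the difference of its
    two integrands. *)
Lemma gpsi_coord_le : exists2 C : R, 0 < C & forall m n (A : set (n.-tuple R)) i,
  (0 < m)%N -> measurable A -> monotone_increasing A ->
  \int[gn n]_(x in A) gpsi m (tnth x i) <= C * Num.sqrt m%:R * coord_mean n A i.
Proof.
have [C C0 hC] := @up_set_gpsi R; exists C => // m n A i m0 mA monA.
set k := C * Num.sqrt m%:R.
pose f (z : R) := k * z - gpsi m z.
have i1 D : measurable D -> gamma.-integrable D (EFin \o (fun z => k * z)).
  exact: integrable_gaussian_scale.
have i2 D : measurable D -> gamma.-integrable D (EFin \o gpsi m).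
  exact: integrable_gpsi.
have fi : gamma.-integrable [set: R] (EFin \o f).
  rewrite (_ : _ \o _ = ((EFin \o (fun z => k * z)%R) \- (EFin \o gpsi m))%E).
    by apply: integrableB => //; [exact: (i1 setT)|exact: (i2 setT)].
  by apply/funext => z; rewrite /= EFinB.
have fB B : measurable B -> up_set B -> 0 <= \int[gamma]_(z in B) f z.
  move=> mB uB; rewrite /f RintegralB//; [|exact: i1|exact: i2].
  rewrite subr_ge0 RintegralZl//; last exact: integrable_gaussian_idS.
  exact: hC.
have := @monotone_coord_ge0 R (normal_prob (0 : R) 1) f fi fB n i A mA monA.
have j1 : (gn n).-integrable A (EFin \o (fun x => k * tnth x i)).
  exact: (@integrable_coord R (normal_prob (0 : R) 1) n i (fun z => k * z) A mA (i1 setT measurableT)).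
have j2 : (gn n).-integrable A (EFin \o (fun x => gpsi m (tnth x i))).
  exact: (@integrable_coord R (normal_prob (0 : R) 1) n i (gpsi m) A mA (i2 setT measurableT)).
have j3 : (gn n).-integrable A (EFin \o (fun x => tnth x i)).
  have := @integrable_coord R (normal_prob (0 : R) 1) n i id A mA (@integrable_gaussian_id R).
  by apply.
rewrite /f RintegralB// subr_ge0 RintegralZl//.
Qed.

End InfluenceBound.

Section InfluenceTheorem.
Context {R : realType}.
Notation gamma := (normal_prob (0 : R) 1).
Notation gn n := (power_prob gamma n).

Lemma sqrt_ln_le n d : (0 < n)%N -> (n < 256 ^ d)%N ->
  Num.sqrt (ln n%:R) <= 3 * Num.sqrt d%:R :> R.
Proof.
move=> n0 nd.
have h2 : ln 2 <= 1 :> R.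
  by have := @le_ln1Dx R 1 (ltac:(lra)); rewrite (_ : 1 + 1 = 2).
(* 256 = 2^8 and ln 2 <= 1 give 8 d; it is rounded up to 9 d to have an exact square root. *)
have h : ln n%:R <= 9 * d%:R :> R.
  apply: (@le_trans _ _ (ln (2 ^+ (8 * d)))).
    rewrite ler_ln ?posrE ?ltr0n ?exprn_gt0//.
    by rewrite exprM -natrX -natrX ler_nat; exact: ltnW.
  rewrite lnXn// -[ln 2 *+ _]mulr_natr natrM.
  have : ln 2 * (8 * d%:R) <= 1 * (8 * d%:R) :> R by apply: ler_wpM2r => //; rewrite mulr_ge0.
  have : 0 <= d%:R :> R by [].
  lra.
apply: le_trans (ler_wsqrtr h) _.
rewrite sqrtrM// (_ : 9 = 3 ^+ 2) ?sqrtr_sqr ?ger0_norm//; ring.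
Qed.

(** Squaring reduces the claim to 16^d d^3 <= 256 n, and d <= 2^d bounds the left side by 128^d <=
    256^d. Hence the base 256 in the choice of d. *)
Lemma pow_bound d n (C : R) : 0 <= C -> (0 < d)%N -> (256 ^ d.-1 <= n)%N ->
  4 ^+ d * Num.sqrt (C * d%:R / n%:R) <= 16 * Num.sqrt C / d%:R.
Proof.
move=> C0 d0 hn.
have dR : 0 < d%:R :> R by rewrite ltr0n.
have n0 : 0 < n%:R :> R by rewrite ltr0n (leq_trans _ hn)// expn_gt0.
have dR' := ltW dR; have n0' := ltW n0.
rewrite -(@ler_pXn2r _ 2)// ?nnegrE ?divr_ge0 ?mulr_ge0 ?exprn_ge0 ?sqrtr_ge0//.
rewrite exprMn sqr_sqrtr; last by rewrite divr_ge0 ?mulr_ge0.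
rewrite expr_div_n exprMn sqr_sqrtr// ler_pdivlMr ?exprn_gt0//.
have -> : (4 ^+ d) ^+ 2 * (C * d%:R / n%:R) * d%:R ^+ 2 =
    C * ((4 ^+ d) ^+ 2 * d%:R ^+ 3 / n%:R) :> R by field; rewrite gt_eqF.
rewrite [leRHS]mulrC; apply: ler_wpM2l => //.
rewrite ler_pdivrMr//.
have h1 : d%:R ^+ 3 <= (2 ^+ d) ^+ 3 :> R.
  by rewrite lerXn2r ?nnegrE// -natrX ler_nat ltnW// ltn_expl.
have h2 : 256 ^+ d <= 256 * n%:R :> R.
  by rewrite -natrX -natrM ler_nat -(prednK d0) expnS leq_mul2l hn orbT.
have h4 : (4 ^+ d) ^+ 2 * (2 ^+ d) ^+ 3 <= 256 ^+ d :> R.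
  rewrite -!exprM [(d * 2)%N]mulnC [(d * 3)%N]mulnC [X in X * _ <= _]exprM [X in _ * X <= _]exprM -exprMn.
  by apply: lerXn2r; rewrite ?nnegrE; lra.
apply: (@le_trans _ _ ((4 ^+ d) ^+ 2 * (2 ^+ d) ^+ 3)).
  by rewrite ler_wpM2l// !exprn_ge0.
by apply: le_trans h4 _; apply: le_trans h2 _; rewrite -natrX ler_wpM2r// ler_nat.
Qed.

Theorem influence_bound : exists2 c : R, 0 < c & forall n (A : set (n.-tuple R)),
  (2 <= n)%N -> measurable A -> monotone_increasing A ->
  (forall i j, coord_mean n A i = coord_mean n A j) ->
  fine (gn n A) * (1 - fine (gn n A)) * Num.sqrt (ln n%:R) <=
    c * \sum_(i < n) coord_mean n A i.
Proof.
have [K K0 hK] := @box_residual_real R; have [C C0 hC] := @gpsi_coord_le R.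
pose c0 := K + (1 + 16 * Num.sqrt C) * C + 1.
have sC0 : 0 <= Num.sqrt C by exact: sqrtr_ge0.
have c00 : 0 < c0 by rewrite /c0; have : 0 <= 16 * Num.sqrt C * C; [rewrite !mulr_ge0// ltW|lra].
exists (3 * c0); first by rewrite mulr_gt0.
move=> n A n2 mA monA symA.
have n0 : (0 < n)%N by exact: ltnW.
have nR : 0 < n%:R :> R by rewrite ltr0n.
set p := fine (gn n A); set W := \sum_(i < n) _.
have p0 : 0 <= p by rewrite fine_ge0.
have p1 : p <= 1 by exact: (fine_prob_le1 (gn n)).
pose d := (trunc_log 256 n).+1.
have hd1 : (256 ^ d.-1 <= n)%N by exact: trunc_logP.
have hd2 : (n < 256 ^ d)%N by exact: trunc_log_ltn.
have dR : 0 < d%:R :> R by rewrite ltr0n.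
set r := Num.sqrt d%:R : R.
have r0 : 0 < r by rewrite sqrtr_gt0.
have r2 : r ^+ 2 = d%:R by rewrite sqr_sqrtr// ltW.
have WE i : coord_mean n A i = W / n%:R.
  rewrite /W (eq_bigr (fun=> coord_mean n A i)); last by move=> j _; exact: symA.
  by rewrite sumr_const card_ord -[_ *+ n]mulr_natr mulfK// gt_eqF.
pose N := (n * d)%N.
pose g := box_density d n A.
pose e l : R := cube_mean N (bit_diff l g).
have D01 l s : (l < N)%N -> size s = N -> 0 <= bit_diff l g s <= 1.
  exact: bit_diff_density01.
have e0 l : (l < N)%N -> 0 <= e l.
  by move=> lN; apply: cube_mean_ge0 => s sN; have /andP[] := D01 l s lN sN.
have lN (i : 'I_n) (j : 'I_d) : (i * d + j < N)%N.
  by rewrite /N (leq_trans (_ : _ < i.+1 * d)%N) ?leq_mul2r ?ltn_ord ?orbT// mulSn addnC ltn_add2r.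
have block (i : 'I_n) : \sum_(j < d) e (i * d + j)%N <= C * r * (W / n%:R).
  by rewrite /e sum_bit_diff_density// -(WE i); exact: hC.
have W0 : 0 <= W.
  have h : 0 <= C * r * (W / n%:R).
    by apply: le_trans (block (Ordinal n0)); apply: sumr_ge0 => j _; exact: e0.
  by move: h; rewrite pmulr_rge0 ?mulr_gt0// pmulr_lge0// invr_gt0.
have main : p * (1 - p) * r <= c0 * W.
  have pp : p * (1 - p) <= 1 by nra.
  (* For W >= sqrt d the claim is immediate from p (1 - p) <= 1. Otherwise W < sqrt d makes every
     single influence small. *)
  have [rW|Wr] := leP r W.
    apply: (@le_trans _ _ (1 * r)); first by rewrite ler_wpM2r// ltW.
    rewrite mul1r (le_trans rW)// ler_peMl// /c0.
    by have : 0 <= (1 + 16 * Num.sqrt C) * C; [rewrite !mulr_ge0// ?addr_ge0 ?mulr_ge0// ltW|lra].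
  have sum_e : \sum_(l < N) e l <= C * r * W.
    rewrite /N sum_ord_mul (le_trans (ler_sum _ (fun i _ => block i)))//.
    by rewrite sumr_const card_ord -[_ *+ n]mulr_natr -!mulrA mulVf ?gt_eqF// mulr1.
  (* A nonnegative term is at most the sum over its coordinate, C r W / n, and W < r with r^2 =
     d. *)
  have e_le l : (l < N)%N -> e l <= C * d%:R / n%:R.
    move=> lN'; have d0 : (0 < d)%N by [].
    have ilt : (l %/ d < n)%N by rewrite ltn_divLR.
    pose i := Ordinal ilt; pose j := Ordinal (ltn_pmod l d0).
    apply: (@le_trans _ _ (C * r * (W / n%:R))).
      apply: le_trans (block i); rewrite (bigD1 j)//= -divn_eq lerDl.
      by apply: sumr_ge0 => k _; exact: (e0 _ (lN i k)).
    rewrite !mulrA ler_pM2r ?invr_gt0// -r2 expr2 -!mulrA ler_pM2l// ler_pM2l//.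
    exact: ltW.
  have cube_bd := cube_variance_bound N g d (ltn0Sn _).
  rewrite (cube_mean_box_density_sqr d n A) // (cube_mean_box_density d n A mA) -/p in cube_bd.
  set eta := Num.sqrt (C * d%:R / n%:R).
  (* The derivatives take values in [0, 1], so their squares are at most themselves, and L^1 norms
     are means. *)
  have S1 : \sum_(l < N) cube_mean N (fun s => bit_diff l g s ^+ 2) <= \sum_(l < N) e l.
    apply: ler_sum => l _; apply: ler_cube_mean => s sN.
    have /andP[a b] := D01 l s (ltn_ord l) sN; nra.
  have S2 : \sum_(l < N) cube_mean N (fun s => `|bit_diff l g s|) *
       Num.sqrt (cube_mean N (fun s => bit_diff l g s ^+ 2)) <= (\sum_(l < N) e l) * eta.
    rewrite mulr_suml; apply: ler_sum => l _; apply: ler_pM.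
    - by apply: cube_mean_ge0.
    - exact: sqrtr_ge0.
    - by apply: ler_cube_mean => s sN; have /andP[a b] := D01 l s (ltn_ord l) sN; rewrite ger0_norm.
    - apply: ler_wsqrtr; apply: le_trans (e_le l (ltn_ord l)).
      by apply: ler_cube_mean => s sN; have /andP[a b] := D01 l s (ltn_ord l) sN; nra.
  have eta_le : 4 ^+ d * eta <= 16 * Num.sqrt C / d%:R by apply: pow_bound => //; exact: ltW.
  have S0 : 0 <= \sum_(l < N) e l by apply: sumr_ge0 => l _; exact: e0.
  have bd2 : box_energy d n A - p ^+ 2 <= (1 + 16 * Num.sqrt C) / d%:R * (C * r * W).
    apply: le_trans cube_bd _.
    apply: (@le_trans _ _ ((d%:R^-1 + 4 ^+ d * eta) * \sum_(l < N) e l)).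
      rewrite mulrDl lerD//; first by rewrite ler_pM2l// invr_gt0.
      by rewrite -mulrA ler_pM2l ?exprn_gt0// mulrC.
    apply: ler_pM => //.
      by rewrite addr_ge0 ?invr_ge0// mulr_ge0 ?exprn_ge0// sqrtr_ge0.
    by rewrite mulrDl mul1r lerD2l.
  have res := hK d n A (ltn0Sn _) mA monA; rewrite -/p -/W -/r in res.
  have E1 : (1 + 16 * Num.sqrt C) / d%:R * (C * r * W) * r = (1 + 16 * Num.sqrt C) * C * W.
    by rewrite -r2; field; rewrite gt_eqF.
  have E2 : K / r * W * r = K * W by field; rewrite gt_eqF.
  (* Law of total variance: the part within the boxes, bounded by [box_residual_real], plus the
     variance of g on the cube. *)
  have -> : p * (1 - p) * r = (p - box_energy d n A) * r + (box_energy d n A - p ^+ 2) * r by ring.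
  have h1 : (p - box_energy d n A) * r <= K * W by rewrite -E2 ler_pM2r.
  have h2 : (box_energy d n A - p ^+ 2) * r <= (1 + 16 * Num.sqrt C) * C * W by rewrite -E1 ler_pM2r.
  by rewrite /c0; lra.
apply: (@le_trans _ _ (p * (1 - p) * (3 * r))).
  by apply: ler_wpM2l; [rewrite mulr_ge0// subr_ge0|exact: sqrt_ln_le].
by move: main; lra.
Qed.

End InfluenceTheorem.

(** * Shifting the mean *)

Section Shift.
Context {R : realType}.
Notation gamma := (normal_prob (0 : R) 1).
Notation gn n := (power_prob gamma n).
Implicit Types (a h : R).

Definition shift_tuple n a (x : n.-tuple R) : n.-tuple R := [tuple tnth x i + a | i < n].
Definition shift_set n a (A : set (n.-tuple R)) : set (n.-tuple R) := shift_tuple n a @^-1` A.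

Lemma measurable_shift_tuple n a :
  measurable_fun [set: n.-tuple (measurableTypeR R)]
    (shift_tuple n a : n.-tuple (measurableTypeR R) -> n.-tuple (measurableTypeR R)).
Proof.
apply/measurable_fun_tnthP => i.
rewrite (_ : _ \o _ = fun x => tnth x i + a); last first.
  by apply/funext => x /=; rewrite tnth_mktuple.
apply: (@measurable_funD _ _ R setT (fun x : n.-tuple (measurableTypeR R) => tnth x i : R) (cst a)) => //.
exact: measurable_tnth.
Qed.

Lemma measurable_shift_set n a (A : set (n.-tuple R)) : measurable A -> measurable (shift_set n a A).
Proof.
by move=> mA; rewrite -[X in measurable X]setTI; exact: (measurable_shift_tuple n a measurableT).
Qed.

Lemma monotone_shift_set n a (A : set (n.-tuple R)) :
  monotone_increasing A -> monotone_increasing (shift_set n a A).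
Proof. by move=> monA x y Ax xy; apply: monA Ax _ => j; rewrite !tnth_mktuple lerD2r. Qed.

Lemma shift_setD n a h (A : set (n.-tuple R)) : shift_set n h (shift_set n a A) = shift_set n (a + h) A.
Proof.
apply/seteqP; split => x; rewrite /shift_set /=; congr A; apply: eq_from_tnth => i;
  by rewrite !tnth_mktuple addrAC addrA.
Qed.

Lemma power_normal_shift n a (A : set (n.-tuple R)) : measurable A ->
  power_prob (normal_prob a 1) n A = gn n (shift_set n a A).
Proof.
move=> mA.
pose mf := isMeasurableFun.Build _ _ _ _ _ (measurable_shift_tuple n a).
pose f : {mfun n.-tuple (measurableTypeR R) >-> n.-tuple (measurableTypeR R)} :=
  HB.pack (shift_tuple n a : n.-tuple (measurableTypeR R) -> n.-tuple (measurableTypeR R)) mf.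
rewrite -[RHS]/(distribution (gn n) f A).
apply: tuple_measure_unique => // B mB.
rewrite power_prob_box//= /distribution /pushforward.
rewrite (_ : _ @^-1` _ = [set x | forall i, ((fun z => z + a) @^-1` B i) (tnth x i)]); last first.
  by apply/seteqP; split => x /= hx i; have := hx i; rewrite tnth_mktuple.
rewrite (power_prob_box gamma (B := fun i => (fun z => z + a) @^-1` B i)).
  by apply: eq_bigr => i _; exact: (normal_prob_shift a (B i) (mB i)).
move=> i; have h := @measurable_funD _ _ R setT (@id R) (cst a) (@measurable_id _ R setT) (measurable_cst a).
  by rewrite -[X in measurable X]setTI; exact: (h measurableT (B i) (mB i)).
Qed.

Definition tilt_fun h n (x : n.-tuple R) : R :=
  \prod_(i < n) expR (h * tnth x i - h ^+ 2 / 2).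

Lemma tilt_funE h n x :
  tilt_fun h n x = expR (h * (\sum_(i < n) tnth x i) - n%:R * (h ^+ 2 / 2)).
Proof.
rewrite /tilt_fun -expR_sum sumrB mulr_sumr; congr (expR (_ - _)).
by rewrite sumr_const card_ord mulr_natl.
Qed.

Lemma measurable_tilt_fun h n : measurable_fun [set: n.-tuple R] (tilt_fun h n).
Proof.
apply: measurable_prod => i _; apply: measurableT_comp => //.
apply: measurable_funB => //; apply: measurable_funM => //.
exact: measurable_tnth.
Qed.

Lemma power_normal_tilt h n (A : set (n.-tuple R)) : measurable A ->
  power_prob (normal_prob h 1) n A = (\int[gn n]_(x in A) (tilt_fun h n x)%:E)%E.
Proof.
elim: n A => [|n IH] A mA.
  under eq_integral do rewrite /tilt_fun big_ord0.
  by rewrite integral_cst// mul1e.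
have mt : measurable_fun [set: n.+1.-tuple R] (fun x => (tilt_fun h n.+1 x)%:E).
  by apply/measurable_EFinP; exact: measurable_tilt_fun.
have t0 k (x : k.-tuple R) : (0 <= (tilt_fun h k x)%:E)%E.
  by rewrite lee_fin prodr_ge0// => i _; exact: expR_ge0.
rewrite (integral_slice1 gamma n A _ mA mt (t0 _)).
rewrite (power_prob_slice1 (normal_prob h 1) n A mA).
rewrite (normal_tilt h _ (measurable_power_prob_slice1 (normal_prob h 1) n A mA) (fun=> measure_ge0 _ _)).
apply: eq_integral => z _; rewrite IH; last exact: measurable_slice1.
rewrite -(@ge0_integralZr _ _ _ (gn n) _ (measurable_slice1 _ _ z mA)); last 3 first.
- by apply: measurable_funTS; apply/measurable_EFinP; exact: measurable_tilt_fun.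
- by move=> x _; exact: t0.
- by rewrite lee_fin expR_ge0.
apply: eq_integral => y _; rewrite -EFinM; congr (_%:E).
rewrite /tilt_fun big_ord_recl mulrC; congr (_ * _).
by apply: eq_bigr => i _; rewrite tnth_tconsS.
Qed.

Lemma power_normal_growth h n (A : set (n.-tuple R)) : measurable A ->
  fine (gn n A) + h * (\sum_(i < n) coord_mean n A i) - n%:R * (h ^+ 2 / 2) <=
  fine (power_prob (normal_prob h 1) n A).
Proof.
move=> mA.
have mt : measurable_fun [set: n.-tuple R] (tilt_fun h n) := measurable_tilt_fun h n.
have t0 (x : n.-tuple R) : 0 <= tilt_fun h n x by rewrite prodr_ge0// => i _; exact: expR_ge0.
have it : (gn n).-integrable A (EFin \o tilt_fun h n).
  apply/integrableP; split; first by apply: measurable_funTS; exact/measurable_EFinP.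
  under eq_integral do rewrite /= ger0_norm//.
  by rewrite -power_normal_tilt// (le_lt_trans (probability_le1 (power_prob (normal_prob h 1) n) mA))// ltry.
have ic i : (gn n).-integrable A (EFin \o (fun x => h * tnth x i)).
  apply: (@integrable_coord R (normal_prob (0 : R) 1) n i (fun z => h * z) A mA).
  exact: integrable_gaussian_scale.
have ii i : (gn n).-integrable A (EFin \o (fun x => tnth x i)).
  exact: (@integrable_coord R (normal_prob (0 : R) 1) n i id A mA (@integrable_gaussian_id R)).
pose c := 1 - n%:R * (h ^+ 2 / 2).
have is_sum (r : seq 'I_n) : (gn n).-integrable A (EFin \o (fun x => \sum_(i <- r) (h * tnth x i))).
  rewrite (_ : _ \o _ = fun x : n.-tuple R => \sum_(i <- r) (h * tnth x i)%:E)%E.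
    by apply: integrable_sum => // i _; exact: ic.
  by apply/funext => x; rewrite /= sumEFin.
have Esum (r : seq 'I_n) : \int[gn n]_(x in A) (\sum_(i <- r) (h * tnth x i)) =
    h * \sum_(i <- r) coord_mean n A i.
  elim: r => [|i r IH].
    under eq_Rintegral do rewrite big_nil.
    by rewrite big_nil Rintegral_cst// mul0r mulr0.
  under eq_Rintegral do rewrite big_cons.
  by rewrite RintegralD// IH big_cons mulrDr RintegralZl.
have ict : (gn n).-integrable A (EFin \o cst c) by exact: finite_measure_integrable_cst.
have -> : fine (power_prob (normal_prob h 1) n A) = \int[gn n]_(x in A) tilt_fun h n x.
  by rewrite power_normal_tilt.
apply: (@le_trans _ _ (\int[gn n]_(x in A) (c + \sum_(i < n) (h * tnth x i)))).
  rewrite RintegralD// Rintegral_cst// Esum /c.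
  have p0 : 0 <= fine (gn n A) by rewrite fine_ge0.
  have p1 : fine (gn n A) <= 1 by exact: (fine_prob_le1 (gn n)).
  have : 0 <= n%:R * (h ^+ 2 / 2) by rewrite mulr_ge0// divr_ge0// sqr_ge0.
  set q := n%:R * _ => q0; set p := fine _ in p0 p1 *.
  have : q * p <= q by rewrite ler_piMr.
  lra.
apply: le_Rintegral => //.
  rewrite (_ : _ \o _ = ((EFin \o cst c) \+
    (EFin \o (fun x : n.-tuple R => \sum_(i < n) (h * tnth x i))%R))%E).
    by apply: integrableD => //; exact: is_sum.
  by apply/funext => x; rewrite /= EFinD.
move=> x _; rewrite tilt_funE; apply: le_trans (expR_ge1Dx _).
by rewrite /c mulr_sumr le_eqVlt; apply/orP; left; apply/eqP; ring.
Qed.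

(** Gives a bound on W that does not depend on the shift, from which p is shown to be locally
    Lipschitz. *)
Lemma coord_mean_le n (A : set (n.-tuple R)) i : measurable A ->
  `|coord_mean n A i| <= \int[gamma]_z `|z|.
Proof.
move=> mA.
have ii B : measurable B -> (gn n).-integrable B (EFin \o (fun x => tnth x i)).
  by move=> mB; exact: (@integrable_coord R (normal_prob (0 : R) 1) n i id B mB (@integrable_gaussian_id R)).
apply: le_trans (@le_normr_Rintegral _ _ _ (gn n) A _ mA (ii A mA)) _.
have ia B : measurable B -> (gn n).-integrable B (EFin \o (fun x => `|tnth x i|)).
  by move=> mB; exact: (integrable_abse (ii B mB)).
have -> : \int[gamma]_z `|z| = \int[gn n]_x `|tnth x i|.
  rewrite /Rintegral; congr fine.
  by rewrite (integral_coord gamma n i (fun z => `|z|%:E))//; exact/measurable_EFinP.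
rewrite /Rintegral fine_le//.
- exact: (@integrable_fin_num _ _ _ (gn n) A mA _ (ia A mA)).
- exact: (@integrable_fin_num _ _ _ (gn n) setT measurableT _ (ia setT measurableT)).
- apply: ge0_subset_integral => //.
  exact: (@measurable_int _ _ _ (gn n) setT _ (ia setT measurableT)).
Qed.

Lemma coord_mean_permute n (s : 'S_n) (A : set (n.-tuple R)) i : measurable A ->
  permute_coords s @^-1` A = A -> coord_mean n A (s i) = coord_mean n A i.
Proof.
move=> mA sA; rewrite /coord_mean /Rintegral; congr fine.
have ms := @measurable_permute_coords _ (measurableTypeR R) n s.
have mt : measurable_fun [set: n.-tuple (measurableTypeR R)] (fun x => (tnth x i : R)%:E).
  by apply/measurable_EFinP; exact: measurable_tnth.
have int : (gn n).-integrable (permute_coords s @^-1` A)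
    ((fun x : n.-tuple R => (tnth x i)%:E) \o permute_coords s).
  rewrite sA (_ : _ \o _ = EFin \o (fun x : n.-tuple R => tnth x (s i))).
    exact: (@integrable_coord R (normal_prob (0 : R) 1) n (s i) id A mA (@integrable_gaussian_id R)).
  by apply/funext => x; rewrite /= tnth_mktuple.
have := integral_pushforward ms mt int mA; rewrite sA => E.
transitivity (\int[gn n]_(x in A) ((fun x : n.-tuple R => (tnth x i)%:E) \o permute_coords s) x)%E.
  by apply: eq_integral => x _; rewrite /= tnth_mktuple.
rewrite -E; apply: eq_measure_integral => B mB _.
exact: power_prob_permute.
Qed.

End Shift.

(** * From the growth inequality to the existence and spacing of thresholds *)

Section Growth.
Context {R : realType}.
Implicit Types (F : R -> R).

(** Cutting [a, b] into N + 1 equal steps brings the total quadratic error down to C (b - a)^2 / (N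
    + 1). This replaces integrating a lower bound on a derivative. *)
Lemma telescope_growth F (a b K C : R) : a <= b -> 0 <= C ->
  (forall x h, a <= x -> 0 <= h -> x + h <= b -> K * h - C * h ^+ 2 <= F (x + h) - F x) ->
  K * (b - a) <= F b - F a.
Proof.
move=> ab C0 FK.
have step N : K * (b - a) - C * (b - a) ^+ 2 / N.+1%:R <= F b - F a.
  set h := (b - a) / N.+1%:R.
  have N0 : 0 < N.+1%:R :> R by rewrite ltr0n.
  have h0 : 0 <= h by rewrite divr_ge0 ?subr_ge0// ltW.
  have hN : N.+1%:R * h = b - a by rewrite /h mulrC divfK// gt_eqF.
  have ind k : (k <= N.+1)%N -> k%:R * (K * h - C * h ^+ 2) <= F (a + k%:R * h) - F a.
    elim: k => [|k IH] kN; first by rewrite !mul0r addr0 subrr.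
    have kR : k%:R * h + h <= b - a by rewrite -hN -[X in _ + X]mul1r -mulrDl ler_wpM2r// natr1 ler_nat.
    have kh : 0 <= k%:R * h by rewrite mulr_ge0.
    have := FK (a + k%:R * h) h (ltac:(lra)) h0 (ltac:(lra)).
    have := IH (ltnW kN).
    rewrite -natr1 !mulrDl !mul1r -addrA; lra.
  have := ind N.+1 (leqnn _); rewrite mulrBr mulrCA !hN subrKC.
  suff -> : C * (b - a) ^+ 2 / N.+1%:R = N.+1%:R * (C * h ^+ 2) by [].
  by rewrite -hN; field; rewrite addrC natr1 gt_eqF.
rewrite leNgt; apply/negP => lt.
set D := C * (b - a) ^+ 2 in step.
have D0 : 0 <= D by rewrite mulr_ge0// sqr_ge0.
have gap : 0 < K * (b - a) - (F b - F a) by lra.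
set G := K * (b - a) - (F b - F a) in gap.
have := step (Num.bound (D / G)).
set N := Num.bound _.
have hN : D / G < N.+1%:R.
  by apply: lt_trans (archi_boundP (divr_ge0 D0 (ltW gap))) _; rewrite ltr_nat.
have N0 : 0 < N.+1%:R :> R by rewrite ltr0n.
have : D / N.+1%:R < G by rewrite ltr_pdivrMr// mulrC -ltr_pdivrMr.
by rewrite /G; set X := D / _; set Y := K * _; set Z := F b - F a => h1 h2; lra.
Qed.

Variables (p W : R -> R) (M K L : R).
Hypotheses (M0 : 0 <= M) (K0 : 0 < K) (L0 : 0 <= L).
Hypothesis p01 : forall a, 0 < p a < 1.
Hypothesis growth : forall a h, p a + h * W a - M * h ^+ 2 <= p (a + h).
Hypothesis WK : forall a, K * (p a * (1 - p a)) <= W a.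
Hypothesis WL : forall a, `|W a| <= L.

Let p0 a : 0 < p a. Proof. by have /andP[] := p01 a. Qed.
Let p1 a : 0 < 1 - p a. Proof. by have /andP[] := p01 a; lra. Qed.

Let W_gt0 a : 0 < W a.
Proof. by apply: lt_le_trans (WK a); rewrite !mulr_gt0. Qed.

Lemma growth_nondecreasing a b : a <= b -> p a <= p b.
Proof.
move=> ab; rewrite -subr_ge0.
have := telescope_growth p a b 0 M ab M0; rewrite mul0r; apply => x h _ h0 _.
have := growth x h; have : 0 <= h * W x by rewrite mulr_ge0// ltW.
lra.
Qed.

(** The upper bound on the increment also comes from [growth], started at a + h with the step -h. *)
Lemma growth_lip a h : `|p (a + h) - p a| <= L * `|h| + M * h ^+ 2.
Proof.
have g1 := growth a h; have := growth (a + h) (- h); rewrite addrK sqrrN => g2.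
have b1 : `|h * W a| <= L * `|h| by rewrite normrM mulrC ler_wpM2r.
have b2 : `|h * W (a + h)| <= L * `|h| by rewrite normrM mulrC ler_wpM2r.
move: b1 b2; rewrite !ler_norml => /andP[b1 b1'] /andP[b2 b2'].
apply/andP; split; lra.
Qed.

Lemma growth_continuous : continuous p.
Proof.
move=> x; apply/cvgrPdist_le => e e0.
pose c := L + M + 1.
have c0 : 0 < c by rewrite /c ltr_pwDr// addr_ge0.
near=> y.
have y1 : `|x - y| <= 1 by near: y; apply: cvgr_dist_le; [exact: cvg_id|].
have ye : `|x - y| <= e / c by near: y; apply: cvgr_dist_le; [exact: cvg_id|exact: divr_gt0].
rewrite distrC -[y](subrKC x); apply: le_trans (growth_lip x (y - x)) _.
rewrite -real_normK ?num_real// [`|y - x|]distrC.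
set d := `|x - y| in y1 ye *; have d0 : 0 <= d by exact: normr_ge0.
have : c * d <= e by rewrite mulrC -ler_pdivlMr.
have : M * d ^+ 2 <= M * d by rewrite expr2 mulrA ler_piMr// mulr_ge0.
rewrite /c; lra.
Unshelve. all: by end_near. Qed.

Lemma growth_increasing a b : a < b -> p a < p b.
Proof.
(* Short enough for the linear gain h W to exceed the error M h^2. *)
move=> ab; pose h := Num.min (b - a) (W a / (2 * (M + 1))).
have h0 : 0 < h by rewrite lt_min subr_gt0 ab divr_gt0//; have := M0; lra.
have hb : a + h <= b by rewrite addrC -lerBrDr ge_min lexx.
apply: lt_le_trans (growth_nondecreasing _ _ hb).
have h2 : h * (2 * (M + 1)) <= W a.
  by rewrite -ler_pdivlMr; [rewrite ge_min lexx orbT|have := M0; lra].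
apply: lt_le_trans (growth a h).
rewrite -addrA ltrDl subr_gt0 expr2 mulrCA ltr_pM2l//.
have := W_gt0 a; nra.
Qed.

(** If p stayed below delta, then on the positive axis p (1 - p), and hence W, would be bounded
    below, and p would gain 2 over an interval of length 2 / k. The same on the negative axis if p
    stayed above; the intermediate value theorem does the rest. *)
Lemma growth_surjective (delta : R) : 0 < delta < 1 -> exists a, p a = delta.
Proof.
move=> /andP[d0 d1].
have [b hb] : exists b, delta <= p b.
  apply: contrapT => /forallNP no.
  have lt x : p x < delta by rewrite ltNge; apply/negP/no.
  pose k := K * (p 0 * (1 - delta)).
  have k0 : 0 < k by rewrite !mulr_gt0// subr_gt0.
  have b0 : 0 <= 2 / k by rewrite divr_ge0// ltW.
  have := telescope_growth p 0 (2 / k) k M b0 M0.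
  rewrite subr0 mulrCA divff ?gt_eqF// mulr1.
  have tl : forall x h, 0 <= x -> 0 <= h -> x + h <= 2 / k -> k * h - M * h ^+ 2 <= p (x + h) - p x.
    move=> x h x0 h0 _; have := growth x h.
    have : k <= W x.
      apply: le_trans (WK x); rewrite /k ler_pM2l//; apply: ler_pM;
        [exact: ltW|by rewrite subr_ge0 ltW|exact: growth_nondecreasing|have := lt x; lra].
    move=> kW; have : k * h <= h * W x by rewrite mulrC ler_wpM2l.
    lra.
  by move=> /(_ tl); have := p0 0; have := p1 (2 / k); lra.
have [a ha] : exists a, p a <= delta.
  apply: contrapT => /forallNP no.
  have lt x : delta < p x by rewrite ltNge; apply/negP/no.
  pose k := K * (delta * (1 - p 0)).
  have k0 : 0 < k by rewrite !mulr_gt0.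
  have b0 : - (2 / k) <= 0 by rewrite oppr_le0 divr_ge0// ltW.
  have := telescope_growth p (- (2 / k)) 0 k M b0 M0.
  rewrite sub0r opprK mulrCA divff ?gt_eqF// mulr1.
  have tl : forall x h, - (2 / k) <= x -> 0 <= h -> x + h <= 0 -> k * h - M * h ^+ 2 <= p (x + h) - p x.
    move=> x h _ h0 xh; have := growth x h.
    have : k <= W x.
      apply: le_trans (WK x); rewrite /k ler_pM2l//; have px : p x <= p 0 by apply: growth_nondecreasing; lra.
      apply: ler_pM; [exact: ltW|exact: ltW|exact: ltW|lra].
    move=> kW; have : k * h <= h * W x by rewrite mulrC ler_wpM2l.
    lra.
  by move=> /(_ tl); have := p0 (- (2 / k)); have := p1 0; lra.
have ab : Num.min a b <= Num.max a b by rewrite ge_min le_max lexx.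
have [c _ <-] : exists2 c, c \in `[Num.min a b, Num.max a b] & p c = delta.
  apply: IVT => //.
    by apply: continuous_subspaceT => x; exact: growth_continuous.
  rewrite ge_min le_max; apply/andP; split.
    by apply/orP; left; apply: le_trans ha; apply: growth_nondecreasing; rewrite ge_min lexx.
  by apply/orP; right; apply: (le_trans hb); apply: growth_nondecreasing; rewrite le_max lexx orbT.
by exists c.
Qed.

Lemma ln_diff_ge (x y : R) : 0 < x -> 0 < y -> (y - x) / y <= ln y - ln x.
Proof.
move=> x0 y0; rewrite -[leRHS]opprK opprB -ln_div ?posrE// lerNr.
have := @le_ln1Dx R (x / y - 1).
rewrite (subrKC 1) => /(_ _)/le_trans; apply; first by rewrite ltrBrDl subrr divr_gt0.
by rewrite mulrBl divff ?gt_eqF// opprB.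
Qed.

(** [telescope_growth] applied to the logit of p, whose values at a and b are opposite; hence the
    factor 2. *)
Lemma growth_logit (e a b : R) : 0 < e -> e < 2^-1 -> p a = e -> p b = 1 - e ->
  K * (b - a) <= 2 * (ln (1 - e) - ln e).
Proof.
move=> e0 e1 pa pb.
have ab : a <= b.
  by rewrite leNgt; apply/negP => /growth_increasing; rewrite pa pb; lra.
pose F x := ln (p x) - ln (1 - p x).
have -> : 2 * (ln (1 - e) - ln e) = F b - F a.
  by rewrite /F pa pb (_ : 1 - (1 - e) = e); ring.
(* On [a, b] both p and 1 - p are at least e. The first summand covers the error of [growth] divided
   by p (1 - p), the second the squared increment divided by two values of p. *)
pose C := (M + (L + M * (b - a)) ^+ 2) / e ^+ 2.
have e20 : 0 < e ^+ 2 by rewrite exprn_gt0.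
have C0 : 0 <= C by rewrite divr_ge0 ?addr_ge0 ?sqr_ge0// ltW.
apply: (telescope_growth F a b K C ab C0) => x h ax h0 xb.
set q := p (x + h); set r := p x.
have rq : r <= q by apply: growth_nondecreasing; lra.
have er : e <= r by rewrite -pa; exact: growth_nondecreasing.
have qe : q <= 1 - e by rewrite -pb; exact: growth_nondecreasing.
have r0 : 0 < r by lra.
have q0 : 0 < q by lra.
have r1 : 0 < 1 - r by lra.
have q1 : 0 < 1 - q by lra.
have l1 := ln_diff_ge r q r0 q0.
have := ln_diff_ge (1 - q) (1 - r) q1 r1; rewrite (_ : 1 - r - (1 - q) = q - r); last by ring.
move=> l2.
have g : K * (r * (1 - r)) * h - M * h ^+ 2 <= q - r.
  have := growth x h; rewrite -/q -/r.
  have : h * (K * (r * (1 - r))) <= h * W x by apply: ler_wpM2l => //; exact: WK.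
  lra.
have hba : h <= b - a by lra.
have lip : q - r <= h * (L + M * (b - a)).
  have := growth_lip x h; rewrite -/q -/r (ger0_norm h0) ger0_norm ?subr_ge0// => h1.
  apply: le_trans h1 _.
  have : M * h ^+ 2 <= h * (M * (b - a)).
    by rewrite expr2 mulrA [leRHS]mulrA [h * M]mulrC ler_wpM2l// mulr_ge0.
  lra.
(* The logarithm bound gives the denominator q where the logit derivative at r wants r; the
   difference is of second order. *)
have id : (q - r) / q + (q - r) / (1 - r) = (q - r) / (r * (1 - r)) - (q - r) ^+ 2 / (r * q).
  by field; rewrite !gt_eqF.
have t1 : K * h - M * h ^+ 2 / e ^+ 2 <= (q - r) / (r * (1 - r)).
  have rr : 0 < r * (1 - r) by rewrite mulr_gt0.
  apply: (@le_trans _ _ (K * h - M * h ^+ 2 / (r * (1 - r)))).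
    rewrite lerD2l lerN2 ler_wpM2l ?mulr_ge0 ?sqr_ge0// lef_pV2 ?posrE//.
    by rewrite expr2; apply: ler_pM; lra.
  rewrite ler_pdivlMr// mulrBl divfK ?gt_eqF//; lra.
have t2 : (q - r) ^+ 2 / (r * q) <= (h * (L + M * (b - a))) ^+ 2 / e ^+ 2.
  apply: ler_pM; rewrite ?sqr_ge0 ?invr_ge0 ?mulr_ge0 ?(ltW r0) ?(ltW q0)//.
    rewrite lerXn2r ?nnegrE ?subr_ge0// mulr_ge0// addr_ge0// mulr_ge0//.
    by rewrite subr_ge0.
  rewrite lef_pV2 ?posrE ?mulr_gt0// expr2; apply: ler_pM; lra.
have -> : C * h ^+ 2 = M * h ^+ 2 / e ^+ 2 + (h * (L + M * (b - a))) ^+ 2 / e ^+ 2.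
  by rewrite /C; ring.
rewrite /F -/q -/r; lra.
Qed.

(** From 4 e (1 - e) <= 1 follows (1 - e) / e <= (1 / (2 e))^2, which turns the logit into a
    logarithm that vanishes, as it must, at e = 1/2. *)
Lemma growth_threshold (e a b : R) : 0 < e -> e < 2^-1 -> p a = e -> p b = 1 - e ->
  b - a <= 4 / K * ln (1 / (2 * e)).
Proof.
move=> e0 e1 pa pb; have h := growth_logit e a b e0 e1 pa pb.
have e2 : 0 < 1 - e by lra.
have ee : 0 < 1 / (2 * e) by rewrite divr_gt0// mulr_gt0.
have h2 : ln (1 - e) - ln e <= 2 * ln (1 / (2 * e)).
  rewrite -ln_div ?posrE// mulr_natl -lnXn// ler_ln ?posrE ?divr_gt0 ?exprn_gt0//.
  have -> : (1 / (2 * e)) ^+ 2 = (4 * e)^-1 / e by field; rewrite gt_eqF.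
  rewrite ler_pM2r ?invr_gt0// -[leRHS]mul1r ler_pdivlMr ?mulr_gt0//.
  by have := sqr_ge0 (1 - 2 * e); lra.
rewrite mulrAC ler_pdivlMr// mulrC; lra.
Qed.

End Growth.

(** * Non-Borel monotone sets *)

Section RationalInterior.
Context {R : realType} (n : nat).
Notation gamma := (normal_prob (0 : R) 1).
Notation gn n := (power_prob gamma n).
Implicit Types (A : set (n.-tuple R)) (q : n.-tuple rat).

Definition rat_tuple q : n.-tuple R := map_tuple ratr q.
Definition open_orthant (y : n.-tuple R) : set (n.-tuple R) :=
  [set x | forall i, tnth y i < tnth x i].

(* A Borel stand-in for [A]: a countable union of open orthants inside a
   monotone [A] that contains every shift of [A] by a positive amount. *)
Definition rat_interior A : set (n.-tuple R) :=
  [set x | exists q, A (rat_tuple q) /\ open_orthant (rat_tuple q) x].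

Lemma tnth_rat_tuple q i : tnth (rat_tuple q) i = ratr (tnth q i).
Proof. exact: tnth_map. Qed.

Lemma open_orthantE y : open_orthant y = [set x | forall i, `]tnth y i, +oo[%classic (tnth x i)].
Proof. by apply/seteqP; split => x /= h i; have := h i; rewrite in_itv/= andbT. Qed.

Lemma measurable_open_orthant y : measurable (open_orthant y).
Proof.
rewrite open_orthantE.
exact: (@measurable_tuple_box _ (measurableTypeR R) n (fun i => `]tnth y i, +oo[%classic)
  (fun i => measurable_itv _)).
Qed.

Lemma measurable_rat_interior A : measurable (rat_interior A).
Proof.
pose F (k : nat) : set (n.-tuple R) := if (unpickle k : option (n.-tuple rat)) is Some q then
  (if pselect (A (rat_tuple q)) then open_orthant (rat_tuple q) else set0) else set0.
have -> : rat_interior A = \bigcup_k F k.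
  apply/seteqP; split => x.
    move=> [q [Aq qx]]; exists (pickle q) => //; rewrite /F pickleK.
    by case: (pselect (A (rat_tuple q))).
  move=> [k _]; rewrite /F; case: (unpickle k) => [q|//]; case: (pselect (A (rat_tuple q))) => // Aq qx.
  by exists q.
apply: bigcupT_measurable => k; rewrite /F; case: (unpickle k) => [q|//].
by case: (pselect (A (rat_tuple q))) => /= ?; [exact: measurable_open_orthant | exact: measurable0].
Qed.

Lemma monotone_rat_interior A : monotone_increasing (rat_interior A).
Proof. by move=> x y [q [Aq qx]] xy; exists q; split => // i; exact: lt_le_trans (qx i) (xy i). Qed.

Lemma rat_interior_sub A : monotone_increasing A -> rat_interior A `<=` A.
Proof. by move=> monA x [q [Aq qx]]; apply: monA Aq _ => i; exact: ltW. Qed.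

(** Between x and its shift by [d] there is a rational point in each coordinate; it lies in [A] by
    monotonicity, and the shifted x lies in its open orthant. *)
Lemma sub_shift_rat_interior A (d : R) : monotone_increasing A -> 0 < d ->
  A `<=` shift_set n d (rat_interior A).
Proof.
move=> monA d0 x Ax.
have ex i : exists r : rat, tnth x i < ratr r < tnth x i + d.
  have h : tnth x i < tnth x i + d by rewrite ltrDl.
  have [r /= hr] := rat_in_itvoo h.
  by exists r; move: hr; rewrite in_itv.
have [f hf] := choice ex.
exists [tuple f i | i < n]; split.
  apply: monA Ax _ => i; rewrite tnth_rat_tuple tnth_mktuple.
  by have /andP[/ltW] := hf i.
move=> i; rewrite tnth_rat_tuple !tnth_mktuple.
by have /andP[] := hf i.
Qed.

(** The rational points are themselves stable under permutations, so the stand-in keeps the symmetry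
    of [A]. *)
Lemma rat_interior_permute A (s : 'S_n) :
  (forall x, A (permute_coords s x) <-> A x) ->
  permute_coords s @^-1` rat_interior A = rat_interior A.
Proof.
move=> sA; apply/seteqP; split => x.
  move=> [q [Aq qx]]; exists (permute_coords (s^-1)%g q); split.
    apply/sA; congr A: Aq; apply: eq_from_tnth => i.
    by rewrite tnth_mktuple !tnth_rat_tuple tnth_mktuple permK.
  move=> i; have := qx ((s^-1)%g i).
  by rewrite !tnth_rat_tuple !tnth_mktuple permKV.
move=> [q [Aq qx]]; exists (permute_coords s q); split.
  move/sA: Aq; congr A; apply: eq_from_tnth => i.
  by rewrite !tnth_mktuple !tnth_rat_tuple tnth_mktuple.
move=> i; have := qx (s i); by rewrite !tnth_rat_tuple !tnth_mktuple.
Qed.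

Lemma orthant_prob_gt0 (B : 'I_n -> set R) : (forall i, measurable (B i)) ->
  (forall i, 0 < fine (gamma (B i))) -> 0 < fine (gn n [set x | forall i, B i (tnth x i)]).
Proof.
move=> mB B0.
have E : gn n [set x | forall i, B i (tnth x i)] = (\prod_(i < n) fine (gamma (B i)))%:E.
  rewrite (@power_prob_box _ _ _ (normal_prob (0 : R) 1) n B mB).
  rewrite -prodEFin; apply: eq_bigr => i _; apply/esym.
  exact: (fine_probK (normal_prob (0 : R) 1) _ (mB i)).
by rewrite E /= prodr_gt0// => i _; exact: B0.
Qed.

Lemma gaussian_tail_gt0 (a : R) : 0 < fine (gamma `]a, +oo[%classic).
Proof.
rewrite -setCitvl fine_probC//; have := gaussian_cdf_lt1 a; rewrite /gaussian_cdf; lra.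
Qed.

Lemma power_open_orthant_gt0 y : 0 < fine (gn n (open_orthant y)).
Proof.
rewrite open_orthantE; apply: (@orthant_prob_gt0 (fun i => `]tnth y i, +oo[%classic)) => i.
  exact: measurable_itv.
exact: gaussian_tail_gt0.
Qed.

Lemma power_lower_orthant_gt0 (y : n.-tuple R) :
  0 < fine (gn n [set x | forall i, `]-oo, tnth y i]%classic (tnth x i)]).
Proof.
apply: (@orthant_prob_gt0 (fun i => `]-oo, tnth y i]%classic)) => i.
  exact: measurable_itv.
exact: gaussian_cdf_gt0.
Qed.

Lemma measurable_lower_orthant (y : n.-tuple R) :
  measurable [set x : n.-tuple R | forall i, `]-oo, tnth y i]%classic (tnth x i)].
Proof.
exact: (@measurable_tuple_box _ (measurableTypeR R) n (fun i => `]-oo, tnth y i]%classic)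
  (fun i => measurable_itv _)).
Qed.

(** The set contains an upper orthant and misses a lower one, both of positive mass. Strictness at
    both ends keeps the logit finite. *)
Lemma rat_interior_prob01 A (a : R) : monotone_increasing A -> A <> set0 -> A <> setT ->
  0 < fine (gn n (shift_set n a (rat_interior A))) < 1.
Proof.
move=> monA A0 AT.
have mS := measurable_shift_set n a _ (measurable_rat_interior A).
apply/andP; split.
  have [x Ax] : A !=set0 by apply/set0P/eqP.
  have [q [Aq _]] := sub_shift_rat_interior A 1 monA ltr01 x Ax.
  apply: lt_le_trans (power_open_orthant_gt0 (shift_tuple n (- a) (rat_tuple q))) _.
  apply: (@fine_prob_le _ _ _ (gn n) _ _ _ mS); first exact: measurable_open_orthant.
  move=> z hz; exists q; split => // i; have := hz i.
  rewrite !tnth_mktuple; lra.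
have [y Ay] : exists y, ~ A y.
  by apply/existsNP => h; apply: AT; apply/seteqP; split.
set B := [set x : n.-tuple R | forall i, `]-oo, tnth (shift_tuple n (- a) y) i]%classic (tnth x i)].
have B0 : 0 < fine (gn n B) by exact: power_lower_orthant_gt0.
have mB : measurable B by exact: measurable_lower_orthant.
have BS : shift_set n a (rat_interior A) `<=` ~` B.
  move=> x Ux Bx; apply: Ay; apply: monA (rat_interior_sub A monA _ Ux) _ => j.
  by have := Bx j; rewrite /= in_itv/= !tnth_mktuple; lra.
have := @fine_prob_le _ _ _ (gn n) _ _ mS (measurableC mB) BS.
have := @fine_probC _ _ _ (gn n) _ mB.
by move: B0; set u := fine _; set v := fine _; set w := fine _ => *; lra.
Qed.

End RationalInterior.

(** Adding the same number to all coordinates commutes with permuting them, so the shifted set is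
    still invariant. *)
Lemma transitive_set_coord_mean {R : realType} n (A : set (n.-tuple R)) (a : R) i j :
  transitive_set A ->
  coord_mean n (shift_set n a (rat_interior n A)) i =
  coord_mean n (shift_set n a (rat_interior n A)) j.
Proof.
move=> [G trG invG].
have [s sG ->] := atransP2 trG (finset.in_setT j) (finset.in_setT i).
apply: coord_mean_permute; first exact: (measurable_shift_set n a _ (measurable_rat_interior n A)).
have sA x : A (permute_coords s x) <-> A x.
  have /eqP := invG s sG x; rewrite !indicE eqr_nat => /eqP E.
  by split=> /mem_set h; apply: set_mem; move: E; rewrite h; case: (_ \in _).
rewrite -[in RHS](rat_interior_permute n A s sA).
apply/seteqP; split => x; rewrite /shift_set/=; congr (rat_interior n A _);
  by apply: eq_from_tnth => k; rewrite !tnth_mktuple.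
Qed.

(** * Thresholds of a monotone transitive set *)

Section GaussianProfile.
Context {R : realType} (n : nat) (A : set (n.-tuple R)) (c : R).
Notation gamma := (normal_prob (0 : R) 1).
Notation gn n := (power_prob gamma n).
Hypotheses (n2 : (2 <= n)%N) (monA : monotone_increasing A) (trA : transitive_set A).
Hypotheses (A0 : A <> set0) (AT : A <> setT) (c0 : 0 < c).
Hypothesis influence : forall (B : set (n.-tuple R)), measurable B -> monotone_increasing B ->
  (forall i j, coord_mean n B i = coord_mean n B j) ->
  fine (gn n B) * (1 - fine (gn n B)) * Num.sqrt (ln n%:R) <= c * \sum_(i < n) coord_mean n B i.

Let S a := shift_set n a (rat_interior n A).
Let p a := fine (gn n (S a)).
Let W a := \sum_(i < n) coord_mean n (S a) i.
Let M : R := n%:R / 2.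
Let K : R := Num.sqrt (ln n%:R) / c.
Let L : R := n%:R * \int[gamma]_z `|z|.

Let mS a : measurable (S a).
Proof. exact: (measurable_shift_set n a _ (measurable_rat_interior n A)). Qed.

Let M0 : 0 <= M. Proof. by rewrite /M divr_ge0. Qed.

Let K0 : 0 < K.
Proof. by rewrite /K divr_gt0// sqrtr_gt0 ln_gt0// ltr1n. Qed.

Let L0 : 0 <= L.
Proof. by rewrite /L mulr_ge0// Rintegral_ge0. Qed.

Let p01 a : 0 < p a < 1.
Proof. exact: rat_interior_prob01. Qed.

Let growth a h : p a + h * W a - M * h ^+ 2 <= p (a + h).
Proof.
have := power_normal_growth h n (S a) (mS a).
rewrite (power_normal_shift n h (S a) (mS a)) /S shift_setD -/(S a).
by apply: le_trans; rewrite /M /p /W mulrAC -mulrA.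
Qed.

Let WK a : K * (p a * (1 - p a)) <= W a.
Proof.
have := influence (S a) (mS a) (monotone_shift_set n a _ (monotone_rat_interior n A))
  (fun i j => transitive_set_coord_mean n A a i j trA).
rewrite -/(p a) -/(W a) => h.
by rewrite /K mulrAC ler_pdivrMr// mulrC (mulrC (W a)).
Qed.

Let WL a : `|W a| <= L.
Proof.
rewrite /W /L; apply: le_trans (ler_norm_sum _ _ _) _.
rewrite -[X in X%:R * _]card_ord -sum1_card natr_sum mulr_suml.
by apply: ler_sum => i _; rewrite mul1r; exact: coord_mean_le.
Qed.

(** The outer measure of [A] lies between the measures of its stand-in and of the stand-in shifted
    by d, that is between p(a) and p(a + d); continuity of p closes the gap. *)
Lemma gaussian_powerE a : gaussian_power a A = (p a)%:E.
Proof.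
have pE b B : measurable B -> gaussian_power b B = (fine (gn n (shift_set n b B)))%:E.
  move=> mB; rewrite /gaussian_power.
  apply: etrans (@measurable_mu_extE _ _ _ (power_prob (normal_prob b 1) n) B mB) _.
  apply: etrans (power_normal_shift n b B mB) _; apply/esym.
  exact: (@fine_probK _ _ _ (gn n) _ (measurable_shift_set n b B mB)).
apply/eqP; rewrite eq_le; apply/andP; split; last first.
  rewrite -(pE a _ (measurable_rat_interior n A)).
  exact: (le_mu_ext _ (rat_interior_sub n A monA)).
apply/lee_addgt0Pr => e e0.
have LM : 0 < L + M + 1 by have := L0; have := M0; lra.
(* With d <= 1 the bound L d + M d^2 of [growth_lip] is at most d (L + M + 1) <= e. *)
pose d := Num.min 1 (e / (L + M + 1)).
have d0 : 0 < d by rewrite /d lt_min ltr01 divr_gt0.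
have d1 : d <= 1 by rewrite /d ge_min lexx.
have de : d * (L + M + 1) <= e by rewrite -ler_pdivlMr// /d ge_min lexx orbT.
apply: le_trans (_ : _ <= gaussian_power a (S d))%E _.
  exact: (le_mu_ext _ (sub_shift_rat_interior n A d monA d0)).
rewrite (pE a _ (mS d)) /S shift_setD -EFinD lee_fin addrC.
have := growth_lip p W M L growth WL a d; rewrite ler_norml => /andP[_].
rewrite (gtr0_norm d0) lerBlDr => /le_trans; apply.
rewrite [leRHS]addrC lerD2r; apply: le_trans de; rewrite !mulrDr mulr1 (mulrC L) (mulrC M).
have : d ^+ 2 * M <= d * M by rewrite ler_wpM2r// expr2 ler_piMl// ltW.
lra.
Qed.

Lemma gaussian_power_exists_unique (delta : R) : 0 < delta < 1 ->
  exists! a : R, gaussian_power a A = delta%:E.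
Proof.
move=> /(growth_surjective p W M K L M0 K0 L0 p01 growth WK WL)[a pa].
exists a; split; first by rewrite gaussian_powerE pa.
move=> b; rewrite gaussian_powerE => -[pb].
have [ab|ba|//] := ltgtP a b.
  by have := growth_increasing p W M K M0 K0 p01 growth WK a b ab; rewrite pa pb ltxx.
by have := growth_increasing p W M K M0 K0 p01 growth WK b a ba; rewrite pa pb ltxx.
Qed.

Lemma threshold_width (epsilon : R) : 0 < epsilon < 1 / 2 ->
  threshold A (1 - epsilon) - threshold A epsilon <=
    4 * c * (ln (1 / (2 * epsilon)) / Num.sqrt (ln n%:R)).
Proof.
move=> /andP[e0 e1].
have pt delta : 0 < delta < 1 -> p (threshold A delta) = delta.
  move=> /gaussian_power_exists_unique[a [ha _]]; rewrite /threshold.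
  (* The default value of [xget] is excluded by the existence of a. *)
  case: xgetP => [b -> /=|/(_ a)]; last by [].
  by rewrite gaussian_powerE => -[].
have := growth_threshold p W M K L M0 K0 L0 p01 growth WK WL epsilon _ _ e0 _
  (pt epsilon (ltac:(lra))) (pt (1 - epsilon) (ltac:(lra))).
move=> /(_ (ltac:(lra))) /le_trans; apply; rewrite /K invfM invrK le_eqVlt.
by apply/orP; left; apply/eqP; ring.
Qed.

End GaussianProfile.

Theorem corollary1p7 (R : realType) :
  exists c : R, forall (n : nat) (A : set (n.-tuple R)),
    (2 <= n)%N ->
    monotone_increasing A ->
    transitive_set A ->
    A <> set0 ->
    A <> [set: n.-tuple R] ->
    (forall delta : R, 0 < delta < 1 ->
       exists! alpha : R, gaussian_power alpha A = delta%:E) /\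
    (forall epsilon : R, 0 < epsilon < 1 / 2 ->
       threshold A (1 - epsilon) - threshold A epsilon <=
         c * (ln (1 / (2 * epsilon)) / Num.sqrt (ln n%:R))).
Proof.
have [c c0 influence] := @influence_bound R.
exists (4 * c) => n A n2 monA trA A0 AT.
have inf B := influence n B n2.
split; first exact: (gaussian_power_exists_unique n A c).
exact: threshold_width.
Qed.
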